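(* Let $\gamma$ be the standard Gaussian probability measure on $\mathbb{R}$. Let $p,r>1$ and let $q$, with $1<p<q$, satisfy $\frac1p+\frac1r=1+\frac1q$. Let $\theta\in[0,\frac{\pi}{2})$ and $\xi\in(\frac{\pi}{2},\pi)$ be such that $$\cos\theta=\sqrt{\frac{p-1}{q-1}},\qquad \cos\xi=-\sqrt{\frac{r-1}{q-1}}.$$ Then for all functions $f\in L^p(\gamma)$ and $g\in L^r(\gamma)$, $$\left\|\int_{\mathbb{R}} f\big(\cos(\theta)x+\sin(\theta)y\big)\,g\big(\cos(\xi)x+\sin(\xi)y\big)\,d\gamma(y)\right\|_{L^q(d\gamma(x))}\le\|f\|_{L^p(\gamma)}\,\|g\|_{L^r(\gamma)},$$ with equality if and only if $f,g$ are of constant sign with $|f(x)|^p\,d\gamma(x)=K_1\,e^{-\lambda|x-a_1|^2}\,dx$ and $|g(x)|^r\,d\gamma(x)=K_2\,e^{-\lambda|x-a_2|^2}\,dx$ for some $K_1,K_2,\lambda\ge0$ and $a_1,a_2\in\mathbb{R}$.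
   Context: The standard Gaussian measure $\gamma$ on $\mathbb{R}$ has density $(2\pi)^{-1/2}e^{-t^2/2}$ with respect to Lebesgue measure.
   Formalization: The equality condition is corrected: equality also holds whenever f = 0 a.e. or g = 0 a.e., whatever the other function is (e.g. f = 0, g(x) = x), so these two cases are added as alternatives to the stated condition. *)

(* Defs.v *)
From HB Require Import structures.
From mathcomp Require Import all_boot all_order all_algebra.
From mathcomp Require Import all_classical all_reals all_analysis.

Set Implicit Arguments.
Unset Strict Implicit.
Unset Printing Implicit Defensive.
Import Order.TTheory GRing.Theory Num.Theory.
Import numFieldNormedType.Exports.
Local Open Scope classical_set_scope.
Local Open Scope ring_scope.

Definition gamma (R : realType) : probability (measurableTypeR R) R :=
  normal_prob 0 1.
Arguments gamma : clear implicits.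

(* Extended-real valued on purpose: should the integrand fail to be integrable,
   the value is infinite rather than a default real number, so a bound on a norm
   of this function also asserts that it is well defined almost everywhere. *)
Definition rotated_product {R : realType} (theta xi : R) (f g : R -> R)
    (x : R) : \bar R :=
  (\int[gamma R]_y (f (cos theta * x + sin theta * y) *
                    g (cos xi * x + sin xi * y))%:E)%E.

Definition constant_sign {R : realType} (f : R -> R) : Prop :=
  {ae gamma R, forall x, 0 <= f x} \/ {ae gamma R, forall x, f x <= 0}.

(* |f|^p dgamma = K e^{- lambda |x - a|^2} dx, as measures on the Borel sets. *)
Definition power_has_gaussian_density {R : realType} (p : R) (f : R -> R)
    (K lambda a : R) : Prop :=
  forall A : set (measurableTypeR R), measurable A ->
    (\int[gamma R]_(x in A) (`|f x| `^ p)%:E =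
     \int[lebesgue_measure]_(x in A)
       (K * expR (- lambda * `|x - a| ^+ 2))%:E)%E.

(* Main.v *)
(* Put c1 = 1/p, c2 = 1/r, c3 = 1 - 1/q. The unit vectors u1 = (cos theta, sin theta),
   u2 = (cos xi, sin xi), u3 = (1, 0) satisfy sum_j c_j u_j u_j^T = 1, so that, by
   duality in L^q, the inequality is the geometric Brascamp-Lieb inequality
     int int F(z.u1)^c1 G(z.u2)^c2 H(z.u3)^c3 dz <= 1
   for probability densities F, G, H. For positive continuous densities it follows
   from Barthe's transport argument: F, G, H are pushed to the normal density by
   increasing maps, a triangular change of variables, made of one-dimensional
   substitutions only, follows the transports of F and G, and the pointwise bound is
   the weighted arithmetic-geometric inequality applied to their derivatives.
   Smoothing and Fatou's lemma give all densities.

   The argument loses a factor exp(k (T_H(z.u3) - a T_F(z.u1) - b T_G(z.u2))^2), where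
   u3 = a u1 + b u2. In the equality case the exponent vanishes wherever F and G are
   positive, so the transports solve a Pexider equation; its increasing solutions are
   affine with a common slope, i.e. F and G are Gaussian with the same variance.
   Conversely, equality for such F and G is witnessed by an explicit Gaussian H.

   Equality also forces the sign of f(z.u1) g(z.u2) to depend on z.u3 only. Then every
   translation preserves or complements the set {g > 0} up to null sets; a translation
   being the square of another one, it preserves it, and by Fubini the set is null or
   conull. *)
Require Import Defs.
From HB Require Import structures.
From mathcomp Require Import all_boot all_order all_algebra.
From mathcomp Require Import all_classical all_reals all_analysis.
From mathcomp Require Import measurable_realfun.
From mathcomp Require Import ring lra.
Set Implicit Arguments.
Unset Strict Implicit.
Unset Printing Implicit Defensive.
Import Order.TTheory GRing.Theory Num.Theory.
Import numFieldNormedType.Exports.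
Local Open Scope classical_set_scope.
Local Open Scope ring_scope.


(** * Pexider's equation for increasing functions *)

(** The transports run in opposite directions: the plane is parametrized by the normal coordinates
    a1, a2 of F and G, while T_H is applied to the resulting value of z.u3. In suitable linear
    coordinates (b, t), Barthe's map sum_j c_j a_j u_j has second component b and, for fixed b, a
    first component increasing in t. Its Jacobian is thus an ordinary derivative, and this
    derivative is, up to the factor 1 / D, the arithmetic mean of the weighted inequality. The
    constant k of the lost factor is c3 (1 - c3) / 2: the triples (sqrt c_j a_j) fill three-space,
    the isometric image of the plane does not, and the factor measures the distance to that image.
    Extremizers are only known to be measurable, so equality has to be read off for arbitrary
    densities. These may vanish on intervals, where transports are not injective; right-most
    quantiles replace the inverse maps. On the side of L^q, with V the integral of |f| |g|, the
    third density is proportional to V^q times the normal one. Its positivity wherever F and G are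
    positive is not automatic: it comes from testing the trilinear form with the indicator of {V =
    0}. *)

Lemma additive_monotone_linear (R : realType) (f : R -> R) :
  {homo f : x y / x <= y} -> {morph f : x y / x + y} ->
  forall x, f x = f 1 * x.
Proof.
move=> fnd fD.
have f0 : f 0 = 0 by have := fD 0 0; rewrite addr0; lra.
have fN x : f (- x) = - f x by have := fD x (- x); rewrite subrr f0; lra.
have fn n x : f (n%:R * x) = n%:R * f x.
  elim: n => [|n ih]; first by rewrite !mul0r f0.
  by rewrite -natr1 !mulrDl !mul1r fD ih.
have f1 : 0 <= f 1 by rewrite -f0; exact/fnd.
have pos x : 0 <= x -> f x = f 1 * x.
  move=> x0; apply/eqP; rewrite -subr_eq0 -normr_le0.
  apply/ler_addgt0Pl => e e0; rewrite addr0.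
  have [n /ltW fn1] : exists n : nat, f 1 / e < n%:R.
    by exists (Num.truncn (f 1 / e)).+1; rewrite truncnS_gt.
  have n0 : 0 < n.+1%:R :> R by [].
  (* [(n + 1) * x] lies between the integers [m] and [m + 1], where [f] is already linear; after
     division by n + 1 the error is at most [f 1] / (n + 1), hence at most [e]. *)
  set m := Num.truncn (n.+1%:R * x).
  have /andP[m1 m2] : m%:R <= n.+1%:R * x < m.+1%:R.
    by apply: truncn_itv; rewrite mulr_ge0.
  have := fnd _ _ m1; have := fnd _ _ (ltW m2).
  rewrite -[m%:R]mulr1 -[m.+1%:R]mulr1 !fn -natr1 => h1 h2.
  have k1 : f 1 * (m%:R * 1) <= f 1 * (n.+1%:R * x) by rewrite ler_wpM2l ?mulr1.
  have k2 : f 1 * (n.+1%:R * x) <= f 1 * (m%:R + 1).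
    by rewrite ler_wpM2l// natr1 ltW.
  rewrite -(ler_pM2l n0) -[X in X * `|_|](ger0_norm (ltW n0)) -normrM.
  have : f 1 <= n.+1%:R * e.
    by rewrite -ler_pdivrMr// (le_trans fn1)// ler_nat.
  move=> h3; rewrite ler_norml; apply/andP; split; nra.
move=> x; have [/pos//|x0] := leP 0 x.
by rewrite -[x]opprK fN pos ?oppr_ge0 ?ltW// !mulrN.
Qed.

(* The increments of [f] over steps of length [h] interlace with those of [g],
   hence depend on [h] only. *)
Lemma order_pexider (R : realType) (f g : R -> R) :
  (forall x y x' y', x - y < x' - y' -> f x - g y < f x' - g y') ->
  exists k e1 e2 : R,
    [/\ 0 < k, forall x, f x = k * x + e1 & forall y, g y = k * y + e2].
Proof.
move=> fg.
have finc x x' h h' : h < h' -> f (x + h) - f x < f (x' + h') - f x'.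
  move=> hh'.
  have := fg (x + h) ((h + h') / 2) x 0.
  have := fg x' 0 (x' + h') ((h + h') / 2).
  move=> /(_ ltac:(lra)) h1 /(_ ltac:(lra)) h2; lra.
have fsm e : 0 < e -> exists2 d : R, 0 < d & forall x, f (x + d) - f x <= e.
  move=> e0; have [n n1] : exists n : nat, (f 1 - f 0) / e < n.+1%:R.
    by exists (Num.truncn ((f 1 - f 0) / e)); rewrite truncnS_gt.
  (* An increment over a step 1 / (n + 2) lies below each of the n + 1 increments over steps 1 / (n
     + 1) that add up to [f 1 - f 0]. The lengths must differ because [finc] compares unequal
     steps. *)
  exists n.+2%:R^-1 => // x.
  have : \sum_(0 <= i < n.+1) (f (x + n.+2%:R^-1) - f x) <=
         \sum_(0 <= i < n.+1) (f (i.+1%:R / n.+1%:R) - f (i%:R / n.+1%:R)).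
    apply: ler_sum => i _; rewrite -[i.+1]addn1 natrD mulrDl mul1r.
    by apply/ltW/finc; rewrite ltf_pV2 ?posrE// ltr_nat.
  rewrite telescope_sumr// sumr_const_nat subn0 divff// mul0r -[X in X <= _]mulr_natl => h.
  move: n1; rewrite ltr_pdivrMr// => n1.
  by rewrite -(@ler_pM2l _ n.+1%:R)// (le_trans h)// ltW.
have fle x x' h : f (x + h) - f x <= f (x' + h) - f x'.
  apply/ler_addgt0Pl => e /fsm[d d0 fd].
  have := fd (x' + h); have := @finc x x' h (h + d) ltac:(lra).
  by rewrite addrA; lra.
have feq x x' h : f (x + h) - f x = f (x' + h) - f x'.
  by apply/eqP; rewrite eq_le !fle.
have flin x : f x - f 0 = (f 1 - f 0) * x.
  have := @additive_monotone_linear _ (fun x => f x - f 0); apply.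
  - move=> a b; rewrite le_eqVlt => /predU1P[->//|ab].
    have := finc 0 a 0 (b - a); rewrite addr0 subrKC; lra.
  - by move=> a b; have := feq a 0 b; rewrite add0r; lra.
have f01 : 0 < f 1 - f 0.
  by have := finc 0 0 0 1; rewrite !add0r; lra.
exists (f 1 - f 0), (f 0), (g 0); split => // [x|y].
  by rewrite -flin subrK.
have gle y1 y2 : g y2 - g y1 <= (f 1 - f 0) * (y2 - y1).
  apply/ler_addgt0Pl => e e0.
  (* The extra length makes the premise of [fg] strict and, the slope being [f 1 - f 0], costs
     exactly [e]. *)
  have ek : 0 < e / (f 1 - f 0) by rewrite divr_gt0.
  have /fg : 0 - y1 < (y2 - y1 + e / (f 1 - f 0)) - y2 by lra.
  have := flin (y2 - y1 + e / (f 1 - f 0)).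
  rewrite mulrDr mulrCA divff ?gt_eqF// mulr1; lra.
by have := gle 0 y; have := gle y 0; lra.
Qed.

(** The exponential lies above its tangent at the weighted mean [m] of the logarithms; in the
    weighted sum of the three tangent bounds the linear terms cancel. *)
Lemma weighted_amgm3 (R : realType) (w1 w2 w3 x1 x2 x3 : R) :
  0 <= w1 -> 0 <= w2 -> 0 <= w3 -> w1 + w2 + w3 = 1 ->
  0 < x1 -> 0 < x2 -> 0 < x3 ->
  x1 `^ w1 * x2 `^ w2 * x3 `^ w3 <= w1 * x1 + w2 * x2 + w3 * x3.
Proof.
move=> w10 w20 w30 w1E x10 x20 x30.
rewrite /powR !gt_eqF// -!expRD.
set m := _ + _ + _.
have key w x : 0 <= w -> 0 < x -> w * (1 + (ln x - m)) * expR m <= w * x.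
  move=> w0 x0; rewrite -mulrA ler_wpM2l//.
  have -> : x = expR (ln x - m) * expR m by rewrite -expRD subrK lnK.
  rewrite ler_pM2r ?expR_gt0// -expRD subrK expRK.
  exact: expR_ge1Dx.
have := key _ _ w10 x10; have := key _ _ w20 x20; have := key _ _ w30 x30 => h3 h2 h1.
suff -> : expR m = w1 * (1 + (ln x1 - m)) * expR m +
  w2 * (1 + (ln x2 - m)) * expR m + w3 * (1 + (ln x3 - m)) * expR m by lra.
rewrite -!mulrDl -[LHS]mul1r; congr (_ * _).
have -> : w3 = 1 - w1 - w2 by lra.
rewrite /m; have -> : w3 = 1 - w1 - w2 by lra.
ring.
Qed.

(** * Linear substitutions *)

Section affine.
Context {R : realType}.
Notation mu := (@lebesgue_measure R).
Local Open Scope ereal_scope.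

Lemma measurable_affine (k b : R) :
  measurable_fun [set: R] (fun x : measurableTypeR R => (k * x + b)%R : measurableTypeR R).
Proof. by apply: measurable_funD => //; apply: mulrl_measurable. Qed.

(** Uniqueness of Lebesgue measure: the scaled image measure has the right values on half-open
    intervals. For negative [k] the preimage is half-open at the other end, with the same length. *)
Lemma lebesgue_measure_affine (k b : R) (A : set R) : k != 0%R -> measurable A ->
  mu A = `|k|%:E *
    pushforward mu (fun x : measurableTypeR R => (k * x + b)%R : measurableTypeR R) A.
Proof.
move=> k0 mA; have k00 : (0 <= `|k|)%R by [].
have -> : lebesgue_measure A = mscale (NngNum k00) (pushforward mu
    (fun x : measurableTypeR R => (k * x + b)%R : measurableTypeR R)) A; last by [].
- move=> mh; apply: lebesgue_measure_unique => //= _ [[x y]] _ <-.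
  rewrite /mscale/= /pushforward/=.
  have [k1|k1] := ltP 0%R k.
    rewrite (_ : _ @^-1` _ = `](x - b) / k, (y - b) / k]%classic)%R; last first.
      apply/seteqP; split => z /=; rewrite !in_itv/= ltr_pdivrMr// ler_pdivlMr//;
        by rewrite ltrBlDr lerBrDr mulrC.
    rewrite !lebesgue_measure_itv/= !lte_fin ltr_pM2r ?invr_gt0// ltrD2r.
    case: ifPn => xy; last by rewrite mule0.
    rewrite -!EFinD -EFinM; congr EFin; rewrite gtr0_norm//.
    by field.
  have {}k1 : (k < 0)%R by rewrite lt_neqAle k0.
  rewrite (_ : _ @^-1` _ = `[(y - b) / k, (x - b) / k[%classic)%R; last first.
    apply/seteqP; split => z /=; rewrite !in_itv/= ltr_ndivlMr// ler_ndivrMr//;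
      by rewrite ltrBlDr lerBrDr mulrC andbC.
  rewrite !lebesgue_measure_itv/= !lte_fin ltr_nM2r ?invr_lt0// ltrD2r.
  case: ifPn => xy; last by rewrite mule0.
  rewrite -!EFinD -EFinM; congr EFin; rewrite ltr0_norm//.
  by field.
- exact: measurable_affine.
Qed.

Lemma ge0_integral_affine (k b : R) (f : R -> \bar R) : k != 0%R ->
  measurable_fun [set: R] f -> (forall x, 0 <= f x) ->
  \int[mu]_x f x = `|k|%:E * \int[mu]_x f (k * x + b)%R.
Proof.
move=> k0 mf f0; have k00 : (0 <= `|k|)%R by [].
pose h (x : measurableTypeR R) := (k * x + b)%R : measurableTypeR R.
have := @ge0_integral_pushforward _ _ _ _ _ h (measurable_affine k b) mu setT f
  measurableT mf (fun x _ => f0 x).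
rewrite preimage_setT /comp => <-.
rewrite -(@ge0_integral_mscale _ _ _ (pushforward mu h) _ _ (NngNum k00))//.
- exact: measurable_affine.
- by move=> mh; apply: eq_measure_integral => A mA _; exact: lebesgue_measure_affine.
Qed.

(* Fubini reduces the linear substitution to one-dimensional affine ones,
   provided the lower right coefficient does not vanish. *)
Lemma ge0_integral_linear2 (a b c d : R) (f : R * R -> \bar R) :
  d != 0%R -> (a * d - b * c != 0)%R ->
  measurable_fun [set: R * R] f -> (forall z, 0 <= f z) ->
  \int[mu]_x \int[mu]_y f (x, y) =
  `|a * d - b * c|%:E * \int[mu]_x \int[mu]_y f (a * x + b * y, c * x + d * y)%R.
Proof.
move=> d0 D0 mf f0.
(* Schur complement of [d]: the substitution x -> e x + (b / d) y at fixed y, followed by y -> c x +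
   d y at fixed x, composes to the given matrix. *)
pose e := ((a * d - b * c) / d)%R.
have e0 : e != 0%R by rewrite mulf_neq0// invr_eq0.
pose g (z : R * R) := f (e * z.1 + b / d * z.2, z.2)%R.
have mg : measurable_fun [set: R * R] g.
  apply: measurableT_comp => //; apply/measurable_fun_pairP; split => /=; last exact: measurable_snd.
  by apply: measurable_funD; apply: measurableT_comp => //; exact: mulrl_measurable.
have g0 z : 0 <= g z by exact: f0.
have h0 z : 0 <= f (a * z.1 + b * z.2, c * z.1 + d * z.2)%R by exact: f0.
rewrite (@fubini_tonelli _ _ _ _ _ mu mu f)//.
under eq_integral => y _.
  rewrite (@ge0_integral_affine e (b / d * y) (fun x => f (x, y)) e0)//; last first.
    exact: measurable_fun_pair1.
  over.
rewrite /= ge0_integralZl; [|by []| |by move=> y _; exact: integral_ge0|by []].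
  2: by have := @measurable_fun_fubini_tonelli_G _ _ _ _ _ mu g mg g0; exact.
rewrite -(@fubini_tonelli _ _ _ _ _ mu mu g mg g0).
under eq_integral => x _.
  rewrite (@ge0_integral_affine d (c * x) (fun y => g (x, y)) d0);
    [|exact: measurable_fun_pair2|by []].
  over.
rewrite /= ge0_integralZl; [|by []| |by move=> y _; exact: integral_ge0|by []].
  2: {
  apply: (@measurable_fun_fubini_tonelli_F _ _ _ _ _ mu
    (fun z => g (z.1, (d * z.2 + c * z.1)%R))); last by [].
  apply: measurableT_comp => //; apply/measurable_fun_pairP; split => /=.
    exact: measurable_fst.
  by apply: measurable_funD; apply: measurableT_comp => //; exact: mulrl_measurable. }
have DE : (`|a * d - b * c| = `|e| * `|d|)%R by rewrite -normrM divfK.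
rewrite DE EFinM -muleA; congr (_ * (_ * _)).
apply: eq_integral => x _; apply: eq_integral => y _; rewrite /g/=; congr f.
by congr pair; rewrite /e; [field|exact: addrC].
Qed.
End affine.

(** * Distribution functions and monotone transport *)

Section distribution.
Context {R : realType}.
Notation mu := (@lebesgue_measure R).
Implicit Types (F G : R -> R) (x y : R).

Definition density F :=
  [/\ measurable_fun [set: R] F, (forall x, 0 <= F x) &
      (\int[mu]_x (F x)%:E = 1)%E].

Definition dist F x : R := \int[mu]_(t in `]-oo, x]) F t.

Lemma density_integrable F : density F -> mu.-integrable [set: R] (EFin \o F).
Proof.
move=> [mF F0 F1]; apply/integrableP; split; first exact/measurable_EFinP.
under eq_integral => x _ do rewrite /= ger0_norm//.
by rewrite F1 ltry.
Qed.

Lemma density_integrableS F (A : set R) : density F -> measurable A ->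
  mu.-integrable A (EFin \o F).
Proof. by move=> /density_integrable Fi mA; exact: (integrableS measurableT). Qed.

Lemma EFin_distE F x : density F ->
  ((dist F x)%:E = \int[mu]_(t in `]-oo, x]) (F t)%:E)%E.
Proof.
move=> dF; rewrite /dist /Rintegral fineK//.
by apply: integrable_fin_num => //; exact: density_integrableS.
Qed.

Lemma dist_ge0 F x : density F -> 0 <= dist F x.
Proof. by move=> [_ F0 _]; apply: Rintegral_ge0. Qed.

Lemma dist_compl F x : density F ->
  (\int[mu]_(t in `]x, +oo[) (F t)%:E = (1 - dist F x)%:E)%E.
Proof.
move=> dF; have [mF F0 F1] := dF.
have mF' : measurable_fun [set: R] (EFin \o F) by exact/measurable_EFinP.
rewrite EFinB EFin_distE// -F1 -(@itv_setU_setT _ R false x) ge0_integral_setU//=.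
- rewrite addeAC subee ?add0e//.
  by apply: integrable_fin_num => //; exact: density_integrableS.
- exact: measurable_funTS.
- by move=> t _; rewrite lee_fin.
- apply/disj_setPS => y [/=]; rewrite !in_itv/= andbT => yx.
  by rewrite ltNge yx.
Qed.

Lemma dist_le1 F x : density F -> dist F x <= 1.
Proof.
move=> dF; have [mF F0 F1] := dF.
by rewrite -subr_ge0 -lee_fin -dist_compl//; apply: integral_ge0 => t _; rewrite lee_fin.
Qed.

Lemma dist_sub F x y : density F -> x <= y ->
  (\int[mu]_(t in `]x, y]) (F t)%:E = (dist F y - dist F x)%:E)%E.
Proof.
move=> dF xy; rewrite Rintegral_itvB//; last exact: density_integrableS.
rewrite /Rintegral fineK//.
by apply: integrable_fin_num => //; exact: density_integrableS.
Qed.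

Lemma dist_nd F : density F -> {homo dist F : x y / x <= y}.
Proof.
move=> dF x y xy; rewrite -subr_ge0 -lee_fin -dist_sub//.
by apply: integral_ge0 => t _; rewrite lee_fin; case: dF.
Qed.

Lemma dist_continuous F : density F -> continuous (dist F).
Proof.
move=> dF x.
have xx : x - 1 <= x + 1 by lra.
have := @parameterized_integral_continuous R (x - 1) (x + 1) F xx
  (density_integrableS dF (measurable_itv _)).
move=> /continuous_within_itvP -/(_ ltac:(lra))[+ _ _].
move=> /(_ x ltac:(rewrite in_itv/=; apply/andP; split; lra)) h.
have near_eq : {near x, (fun y => dist F (x - 1) +
    parameterized_integral mu (x - 1) y F) =1 dist F}.
  near=> y; rewrite /= /parameterized_integral.
  have xy : x - 1 <= y.
    near: y; apply/nbhs_ballP; exists 1 => //= z.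
    by rewrite /ball/= ltr_norml; lra.
  rewrite -Rintegral_itv_obnd_cbnd; last exact: density_integrableS.
  rewrite -(@Rintegral_itvB R F -oo%O (BRight y) (x - 1))//;
    last exact: density_integrableS.
  by rewrite /dist; lra.
rewrite /continuous_at -(nbhs_singleton near_eq).
apply: cvg_trans (near_eq_cvg near_eq) _.
by apply: cvgD => //; exact: cvg_cst.
Unshelve. all: end_near. Qed.

Lemma dist_near0 F e : density F -> 0 < e -> exists x, dist F x < e.
Proof.
move=> dF e0; have [mF F0 F1] := dF.
have : (\int[mu]_(t in `](- n%:R)%R, +oo[) (F t)%:E)%E @[n --> \oo] -->
   (\int[mu]_(t in \bigcup_n `](- n%:R)%R, +oo[%classic) (F t)%:E)%E.
  apply: ge0_nondecreasing_set_cvg_integral => //.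
  - move=> n m nm; apply/subsetPset => x /=; rewrite !in_itv/= !andbT.
    by apply: le_lt_trans; rewrite lerN2 ler_nat.
  - by move=> n; apply: measurable_funTS; exact/measurable_EFinP.
  - by move=> n x _; rewrite lee_fin.
have -> : \bigcup_n `](- n%:R), +oo[%classic = [set: R].
  apply/seteqP; split => // x _; exists (Num.truncn `|x|).+1 => //=.
  by rewrite in_itv/= andbT ltrNl (le_lt_trans (ler_norm _))// normrN truncnS_gt.
rewrite F1 => /fine_cvgP[_ /cvgrPdist_lt /(_ _ e0)[N _ /(_ N)]].
rewrite /= dist_compl//= => /(_ (leqnn _)) h; exists (- N%:R).
by have := dist_ge0 (- N%:R) dF; move: h; rewrite opprB addrC subrK ltr_norml; lra.
Qed.

Lemma dist_near1 F e : density F -> 0 < e -> exists x, 1 - e < dist F x.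
Proof.
move=> dF e0; have [mF F0 F1] := dF.
have : (\int[mu]_(t in `]-oo, n%:R]) (F t)%:E)%E @[n --> \oo] -->
   (\int[mu]_(t in \bigcup_n `]-oo, n%:R]%classic) (F t)%:E)%E.
  apply: ge0_nondecreasing_set_cvg_integral => //.
  - move=> n m nm; apply/subsetPset => x /=; rewrite !in_itv/=.
    by move=> /le_trans; apply; rewrite ler_nat.
  - by move=> n; apply: measurable_funTS; exact/measurable_EFinP.
  - by move=> n x _; rewrite lee_fin.
have -> : \bigcup_n `]-oo, n%:R]%classic = [set: R].
  apply/seteqP; split => // x _; exists (Num.truncn `|x|).+1 => //=.
  by rewrite in_itv/= (le_trans (ler_norm _))// ltW// truncnS_gt.
rewrite F1 => /fine_cvgP[_ /cvgrPdist_lt /(_ _ e0)[N _ /(_ N)]].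
rewrite /= -EFin_distE//= => /(_ (leqnn _)) h; exists N%:R.
by move: h; rewrite ltr_norml; lra.
Qed.

Lemma dist_ivt F y : density F -> 0 < y < 1 -> exists x, dist F x = y.
Proof.
move=> dF /andP[y0 y1].
have [a ay] := dist_near0 dF y0.
have [b yb] := dist_near1 dF (ltac:(lra) : 0 < 1 - y).
have ab : a <= b.
  by rewrite leNgt; apply/negP => /ltW /(dist_nd dF); lra.
have h := dist_nd dF ab.
have cF : {within `[a, b], continuous (dist F)}.
  by apply: continuous_subspaceT; exact: dist_continuous.
have [|c _ <-] := @IVT R (dist F) a b y ab cF; last by exists c.
by rewrite min_l// max_r// (ltW ay)/=; lra.
Qed.

Lemma dist_is_derive F x : density F -> {for x, continuous F} ->
  is_derive x 1 (dist F) (F x).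
Proof.
move=> dF cF.
have x1 : x < x + 1 by lra.
have := @continuous_FTC1 R F -oo%O x _ x1 (density_integrableS dF (measurable_itv _)).
case; [exact: ltNyr|exact: cF|].
by rewrite derive1E => D <-; apply: DeriveDef.
Qed.

(** Lebesgue differentiation: for a merely measurable [F], the way back from [dist F] to [F]. *)
Lemma dist_ae_derive F : density F ->
  {ae mu, forall x, derivable (dist F) x 1 /\ (dist F)^`()%classic x = F x}.
Proof.
move=> dF; apply: FTC1Ny => [y|]; first exact: density_integrableS.
apply: open_integrable_locally; first exact: openT.
exact: density_integrable.
Qed.

Lemma dist_lt F : density F -> (forall x, 0 < F x) ->
  {homo dist F : x y / x < y}.
Proof.
move=> dF F0 x y xy; rewrite lt_neqAle (dist_nd dF (ltW xy)) andbT.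
apply/eqP => Fxy.
have : (\int[mu]_(t in `]x, y]) (F t)%:E = 0)%E.
  by rewrite dist_sub ?ltW// Fxy subrr.
have [mF _ _] := dF.
have mF' : measurable_fun `]x, y] (EFin \o F).
  by apply: measurable_funTS; exact/measurable_EFinP.
under eq_integral => t _.
  rewrite -[F t]ger0_norm; last exact: ltW.
  rewrite -abse_EFin; over.
move=> /((ae_eq_integral_abs mu (measurable_itv _) mF').1)[N [mN N0 Nsub]].
have : (mu `]x, y] <= mu N)%E.
  apply: le_measure; rewrite ?inE//; apply: subset_trans Nsub => z xyz /= h.
  by have /eqP := h xyz; rewrite eqe gt_eqF.
by rewrite N0 lebesgue_measure_itv/= lte_fin xy -EFinB lee_fin leNgt subr_gt0 xy.
Qed.

Lemma dist_gt0_lt1 F x : density F -> (forall x, 0 < F x) -> 0 < dist F x < 1.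
Proof.
move=> dF F0; apply/andP; split.
  by apply: le_lt_trans (dist_lt dF F0 (ltac:(lra) : x - 1 < x)); exact: dist_ge0.
by apply: lt_le_trans (dist_lt dF F0 (ltac:(lra) : x < x + 1)) _; exact: dist_le1.
Qed.

End distribution.

Section transport.
Context {R : realType}.
Notation mu := (@lebesgue_measure R).
Implicit Types (F G : R -> R) (x y : R).

Definition pdensity F := [/\ density F, continuous F & forall x, 0 < F x].

(** [xget] selects a point of the level set, and 0 if there is none. For a positive density this is
    the inverse of [dist F] on ]0, 1[ and 0 elsewhere. *)
Definition quantile F y : R := xget 0 [set x | dist F x = y].

(** The increasing rearrangement: for positive continuous densities, it carries the measure with
    density [F] to the one with density [G]. *)
Definition transport F G x := quantile G (dist F x).

Lemma dist_inj F : density F -> (forall x, 0 < F x) -> injective (dist F).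
Proof.
move=> dF F0 x y; have [xy|yx|//] := ltgtP x y => E.
- by have := dist_lt dF F0 xy; rewrite E ltxx.
- by have := dist_lt dF F0 yx; rewrite E ltxx.
Qed.

Lemma dist_quantile F y : density F -> 0 < y < 1 -> dist F (quantile F y) = y.
Proof. by move=> dF /(dist_ivt dF) /(xgetPex 0). Qed.

Lemma quantile_dist F x : pdensity F -> quantile F (dist F x) = x.
Proof.
move=> [dF _ F0]; apply: (dist_inj dF F0).
by apply: (@dist_quantile _ (dist F x)) => //; exact: dist_gt0_lt1.
Qed.

Lemma dist_transport F G x : pdensity F -> pdensity G ->
  dist G (transport F G x) = dist F x.
Proof.
by move=> [dF _ F0] [dG _ _]; apply: dist_quantile => //; exact: dist_gt0_lt1.
Qed.

Lemma transportK F G : pdensity F -> pdensity G ->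
  cancel (transport F G) (transport G F).
Proof.
by move=> pF pG x; rewrite {1}/transport dist_transport// quantile_dist.
Qed.

Lemma transport_lt F G : pdensity F -> pdensity G ->
  {homo transport F G : x y / x < y}.
Proof.
move=> pF pG x y xy; rewrite ltNge; apply/negP => /(dist_nd (let: And3 d _ _ := pG in d)).
rewrite !dist_transport// leNgt; case: pF => dF _ F0.
by rewrite dist_lt.
Qed.

Lemma quantile_is_derive G y : pdensity G -> 0 < y < 1 ->
  is_derive y 1 (quantile G) (G (quantile G y))^-1.
Proof.
move=> pG y01; have [dG cG G0] := pG.
rewrite -{1}(dist_quantile dG y01).
apply: (@is_derive_inverse R (dist G)).
- by near=> x; exact: quantile_dist.
- by near=> x; exact: dist_continuous.
- by apply: dist_is_derive => //; exact: cG.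
- by rewrite gt_eqF.
Unshelve. all: end_near. Qed.

(** The Monge-Ampere equation in dimension one, F = G(T) T', solved for the derivative. *)
Lemma transport_is_derive F G x : pdensity F -> pdensity G ->
  is_derive x 1 (transport F G) (F x / G (transport F G x)).
Proof.
move=> pF pG; have [dF cF F0] := pF.
rewrite mulrC; apply: (@is_derive1_comp _ (quantile G) (dist F)).
- by apply: quantile_is_derive => //; exact: dist_gt0_lt1.
- by apply: dist_is_derive => //; exact: cF.
Qed.

Lemma transport_continuous F G : pdensity F -> pdensity G ->
  continuous (transport F G).
Proof.
move=> pF pG x; apply: differentiable_continuous; apply/derivable1_diffP.
by have := transport_is_derive x pF pG => -[].
Qed.

Lemma pdensity_normal : pdensity (normal_pdf 0 1 : R -> R).
Proof.
split; first split.
- exact: measurable_normal_pdf.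
- by move=> x; exact: normal_pdf_ge0.
- exact: integral_normal_pdf.
- exact: continuous_normal_pdf.
- move=> x; rewrite /normal_pdf oner_eq0 mulr_gt0 ?expR_gt0//.
  by rewrite normal_peak_gt0 ?oner_eq0.
Qed.

Lemma is_derive_continuous (T T' : R -> R) :
  (forall x, is_derive x 1 T (T' x)) -> continuous T.
Proof.
move=> dT x; apply: differentiable_continuous; apply/derivable1_diffP.
by have := dT x => -[].
Qed.

(* On a segment this is the substitution rule of the library; only the
   continuity of the derivative is needed there, not at infinity. *)
Lemma substitution_segment (T T' f : R -> R) a b : a <= b ->
  (forall x, is_derive x 1 T (T' x)) -> continuous T' ->
  {homo T : x y / x < y} -> continuous f ->
  (\int[mu]_(x in `[T a, T b]) (f x)%:E =
   \int[mu]_(x in `[a, b]) (f (T x) * T' x)%:E)%E.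
Proof.
move=> ab dT cT' incT cf.
have TE : (T^`()%classic : R -> R) = T'.
  by apply/funext => x; rewrite derive1E; have := dT x => -[_ ->].
have cT := is_derive_continuous dT.
rewrite (@integration_by_substitution_increasing _ T f) ?TE//.
- by move=> x y _ _; exact: incT.
- by apply: cvgP; apply: cvg_at_right_filter; exact: cT'.
- by apply: cvgP; apply: cvg_at_left_filter; exact: cT'.
- split.
  + by move=> x _; have := dT x => -[].
  + by apply: cvg_at_right_filter; exact: cT.
  + by apply: cvg_at_left_filter; exact: cT.
- exact: continuous_subspaceT.
Qed.

Lemma ge0_integral_segments_le (f : R -> R) (M : \bar R) :
  measurable_fun [set: R] f -> (forall x, 0 <= f x) ->
  (forall n : nat, (\int[mu]_(x in `[(- n%:R)%R, n%:R]) (f x)%:E <= M)%E) ->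
  (\int[mu]_x (f x)%:E <= M)%E.
Proof.
move=> mf f0 h.
have : (\int[mu]_(t in `[(- n%:R)%R, n%:R]) (f t)%:E)%E @[n --> \oo] -->
   (\int[mu]_(t in \bigcup_n `[(- n%:R)%R, n%:R]%classic) (f t)%:E)%E.
  apply: ge0_nondecreasing_set_cvg_integral => //.
  - move=> n m nm; apply/subsetPset => x /=; rewrite !in_itv/= => /andP[h1 h2].
    by rewrite (le_trans _ h1) ?lerN2 ?ler_nat// (le_trans h2)// ler_nat.
  - by move=> n; apply: measurable_funTS; exact/measurable_EFinP.
  - by move=> n x _; rewrite lee_fin.
have -> : \bigcup_n `[(- n%:R)%R, n%:R]%classic = [set: R].
  apply/seteqP; split => // x _; exists (Num.truncn `|x|).+1 => //=.
  by rewrite in_itv/= -ler_norml ltW// truncnS_gt.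
move=> hc; rewrite -(cvg_lim _ hc)//; apply: lime_le; first by apply: cvgP hc.
by near=> n; exact: h.
Unshelve. all: end_near. Qed.

Section substitution.
Variables (T T' f : R -> R).
Hypotheses (dT : forall x, is_derive x 1 T (T' x)) (cT' : continuous T').
Hypotheses (T'0 : forall x, 0 <= T' x) (incT : {homo T : x y / x < y}).
Hypotheses (cf : continuous f) (f0 : forall x, 0 <= f x).

Let mf : measurable_fun [set: R] f.
Proof. exact: continuous_measurable_fun. Qed.

Let mfT : measurable_fun [set: R] (fun x => f (T x) * T' x).
Proof.
apply: continuous_measurable_fun => x; apply: cvgM; last exact: cT'.
apply: continuous_comp; last exact: cf.
exact: (is_derive_continuous dT).
Qed.

(** An increasing [T] may miss part of the line, hence an inequality. Segments [-n, n] are mapped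
    forward here; in [substitution_ge] surjectivity allows them to be pulled back. *)
Lemma substitution_le :
  (\int[mu]_x (f (T x) * T' x)%:E <= \int[mu]_x (f x)%:E)%E.
Proof.
apply: ge0_integral_segments_le => [//|x|n]; first by rewrite mulr_ge0.
rewrite -substitution_segment//; last by rewrite (@le_trans _ _ 0) ?oppr_le0.
apply: ge0_subset_integral => //; first exact/measurable_EFinP.
by move=> x _; rewrite lee_fin.
Qed.

Lemma substitution_ge : (forall y, exists x, T x = y) ->
  (\int[mu]_x (f x)%:E <= \int[mu]_x (f (T x) * T' x)%:E)%E.
Proof.
move=> sT; apply: ge0_integral_segments_le => // n.
have [a <-] := sT (- n%:R); have [b <-] := sT n%:R.
have [ab|ba] := leP a b; last first.
  rewrite set_itv_ge ?integral_set0; last by rewrite bnd_simp -ltNge incT.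
  by apply: integral_ge0 => x _; rewrite lee_fin mulr_ge0.
rewrite (substitution_segment ab)//.
apply: ge0_subset_integral => //; first exact/measurable_EFinP.
by move=> x _; rewrite lee_fin mulr_ge0.
Qed.

End substitution.
End transport.

(** * The Brascamp-Lieb inequality for positive continuous densities *)

Notation rho := (normal_pdf 0 1).

Section gaussian.
Context {R : realType}.
Implicit Types x y : R.

Lemma rhoE x : rho x = expR (ln (normal_peak 1) - x ^+ 2 / 2).
Proof.
rewrite /normal_pdf oner_eq0 expRD lnK ?posrE ?normal_peak_gt0 ?oner_eq0//.
by rewrite /normal_fun subr0 expr1n mulNr.
Qed.

Lemma rho_gt0 x : 0 < rho x. Proof. by rewrite rhoE expR_gt0. Qed.

End gaussian.

Section brascamp_lieb.
Context {R : realType}.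
Notation mu := (@lebesgue_measure R).
Variables (c1 c2 c3 s s' D : R).

(* With [c1, c2, c3 = 1 / p, 1 / r, 1 - 1 / q], [s, s'] stand for the sines of the
   two angles and [D] for [cos theta * sin xi - cos xi * sin theta]. The cosines
   are [c2 * D * s'] and [- (c1 * D * s)], and the equations say that the unit
   vectors [u1, u2] at these angles and [u3 = (1, 0)] decompose the identity:
   [sum_j c_j u_j u_j^T = 1]. *)
Definition bl_parameters := [/\ [/\ 0 < c1, 0 < c2 & 0 < c3],
  [/\ 0 < s, 0 < s' & 0 < D],
  [/\ c1 <= 1, c2 <= 1 & c3 <= 1],
  c1 * s ^+ 2 + c2 * s' ^+ 2 = 1 &
  [/\ c1 * c2 * D ^+ 2 = 1 - c3, c2 * c3 * s' ^+ 2 = 1 - c1 &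
      c1 * c3 * s ^+ 2 = 1 - c2]].

(* The coordinate along [u3] in terms of those along [u1] and [u2]. *)
Definition bl_comb x y := (s' * x - s * y) / D.

Hypothesis blP : bl_parameters.

Let c10 : 0 < c1. Proof. by case: blP => -[]. Qed.
Let c20 : 0 < c2. Proof. by case: blP => -[]. Qed.
Let c30 : 0 < c3. Proof. by case: blP => -[]. Qed.
Let s0 : 0 < s. Proof. by case: blP => _ []. Qed.
Let s'0 : 0 < s'. Proof. by case: blP => _ []. Qed.
Let D0 : 0 < D. Proof. by case: blP => _ []. Qed.
Let c11 : c1 <= 1. Proof. by case: blP => _ _ []. Qed.
Let c21 : c2 <= 1. Proof. by case: blP => _ _ []. Qed.
Let c31 : c3 <= 1. Proof. by case: blP => _ _ []. Qed.
Let Es : c1 * s ^+ 2 + c2 * s' ^+ 2 = 1. Proof. by case: blP. Qed.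
Let E3 : c1 * c2 * D ^+ 2 = 1 - c3. Proof. by case: blP => _ _ _ _ []. Qed.
Let E1 : c2 * c3 * s' ^+ 2 = 1 - c1. Proof. by case: blP => _ _ _ _ []. Qed.
Let E2 : c1 * c3 * s ^+ 2 = 1 - c2. Proof. by case: blP => _ _ _ _ []. Qed.

Lemma bl_sum : c1 + c2 + c3 = 2.
Proof.
have : c3 * (c1 * s ^+ 2 + c2 * s' ^+ 2) = (1 - c1) + (1 - c2).
  by rewrite -E1 -E2; ring.
by rewrite Es; lra.
Qed.

(* The rows [sqrt c_j u_j] form an isometry of the plane into the three-space;
   the right-hand square is the squared component orthogonal to its image. *)
Lemma bl_pythagoras a1 a2 a3 :
  c1 * a1 ^+ 2 + c2 * a2 ^+ 2 + c3 * a3 ^+ 2 =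
  ((1 - c3) * bl_comb a1 a2 + c3 * a3) ^+ 2 + (c1 * s * a1 + c2 * s' * a2) ^+ 2 +
  c3 * (1 - c3) * (a3 - bl_comb a1 a2) ^+ 2.
Proof.
have h : c1 * a1 ^+ 2 + c2 * a2 ^+ 2 - (c1 * s * a1 + c2 * s' * a2) ^+ 2 =
    (1 - c3) * (bl_comb a1 a2) ^+ 2.
  have -> : (1 - c3) * bl_comb a1 a2 ^+ 2 = c1 * c2 * (s' * a1 - s * a2) ^+ 2.
    by rewrite -E3 /bl_comb; field; rewrite gt_eqF.
  have -> : c1 * a1 ^+ 2 + c2 * a2 ^+ 2 =
      (c1 * a1 ^+ 2 + c2 * a2 ^+ 2) * (c1 * s ^+ 2 + c2 * s' ^+ 2).
    by rewrite Es mulr1.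
  ring.
have -> : c1 * a1 ^+ 2 + c2 * a2 ^+ 2 =
  (1 - c3) * (bl_comb a1 a2) ^+ 2 + (c1 * s * a1 + c2 * s' * a2) ^+ 2 by lra.
ring.
Qed.

(** Each l_j stands for the derivative of the transport from the j-th density to the normal one, so
    that rho(a_j) l_j is the value of that density. By [bl_pythagoras] and c1 + c2 + c3 = 2 the
    Gaussian factors match exactly; the only loss is the weighted arithmetic-geometric inequality
    for 1, l3 / l1 and l3 / l2. *)
Lemma bl_pointwise a1 a2 a3 l1 l2 l3 : 0 < l1 -> 0 < l2 -> 0 < l3 ->
  (rho a1 * l1) `^ c1 * (rho a2 * l2) `^ c2 * (rho a3 * l3) `^ c3 *
    expR (c3 * (1 - c3) / 2 * (a3 - bl_comb a1 a2) ^+ 2) / (l1 * l2) <=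
  rho (c1 * s * a1 + c2 * s' * a2) * rho ((1 - c3) * bl_comb a1 a2 + c3 * a3) *
  ((1 - c3) + (1 - c1) * (l3 / l1) + (1 - c2) * (l3 / l2)).
Proof.
move=> l10 l20 l30.
have sum2 := bl_sum.
have amgm : 1 `^ (1 - c3) * (l3 / l1) `^ (1 - c1) * (l3 / l2) `^ (1 - c2) <=
    (1 - c3) * 1 + (1 - c1) * (l3 / l1) + (1 - c2) * (l3 / l2).
  by apply: weighted_amgm3; rewrite ?divr_gt0 ?subr_ge0//; lra.
rewrite powR1 mul1r mulr1 in amgm.
apply: le_trans (ler_wpM2l _ amgm); last by rewrite mulr_ge0// ltW// rho_gt0.
rewrite le_eqVlt; apply/orP; left; apply/eqP.
have pE (a l w : R) : 0 < l -> (rho a * l) `^ w =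
    expR (w * (ln (normal_peak 1) - a ^+ 2 / 2 + ln l)).
  move=> l0; rewrite /powR gt_eqF ?mulr_gt0 ?rho_gt0//.
  by rewrite lnM ?posrE ?rho_gt0// rhoE expRK.
rewrite !pE// !rhoE.
have -> : (l1 * l2)^-1 = expR (- ln l1 - ln l2).
  by rewrite expRD !expRN !lnK ?posrE// invfM.
rewrite /powR !gt_eqF ?divr_gt0// !ln_div ?posrE// -!expRD; congr expR.
have py := bl_pythagoras a1 a2 a3.
set L := ln (normal_peak 1).
have -> : c3 * (1 - c3) / 2 * (a3 - bl_comb a1 a2) ^+ 2 =
  (c1 * a1 ^+ 2 + c2 * a2 ^+ 2 + c3 * a3 ^+ 2 -
  ((1 - c3) * bl_comb a1 a2 + c3 * a3) ^+ 2 - (c1 * s * a1 + c2 * s' * a2) ^+ 2) / 2.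
  by rewrite py; field.
have -> : c3 = 2 - c1 - c2 by lra.
by field.
Qed.


(** Under [bl_parameters] the exponential is at least 1, with equality exactly where the three
    transports are compatible. Kept inside the integrand, it survives the passage to the limit. *)
Definition bl_integrand F G H x y : R :=
  F x `^ c1 * G y `^ c2 * H (bl_comb x y) `^ c3 *
  expR (c3 * (1 - c3) / 2 * (transport H rho (bl_comb x y) -
    bl_comb (transport F rho x) (transport G rho y)) ^+ 2).

Lemma bl_integrand_ge0 F G H x y : 0 <= bl_integrand F G H x y.
Proof. by rewrite !mulr_ge0 ?powR_ge0 ?expR_ge0. Qed.

(** The function is continuous on ]0, 1[ and equal to the default 0 of [xget] outside, because
    [dist rho] takes its values in ]0, 1[. *)
Lemma measurable_quantile_rho : measurable_fun [set: R] (quantile (rho : R -> R)).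
Proof.
have pr := @pdensity_normal R; have [dr _ r0] := pr.
have -> : [set: R] = `]0, 1[ `|` ~` `]0, 1[ by rewrite setUv.
apply/measurable_funU => //; first exact: measurableC.
split.
  apply: open_continuous_measurable_fun; first exact: interval_open.
  move=> y; rewrite inE/= in_itv/= => y01.
  apply: differentiable_continuous; apply/derivable1_diffP.
  by have := quantile_is_derive pr y01 => -[].
apply: (@eq_measurable_fun _ _ (measurableTypeR R) (measurableTypeR R) _ (fun=> 0));
  last exact: measurable_cst.
move=> y; rewrite inE/= in_itv/= => y01; rewrite /quantile/=.
case: xgetP => // x _ /= xy; exfalso; apply: y01; rewrite -xy.
exact: dist_gt0_lt1.
Qed.

Lemma measurable_transport_rho F : density F ->
  measurable_fun [set: R] (transport F rho).
Proof.
move=> dF; apply: (measurableT_comp measurable_quantile_rho).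
by apply: continuous_measurable_fun; exact: dist_continuous.
Qed.

Lemma measurable_bl_comb (f g : R * R -> R) :
  measurable_fun [set: R * R] f -> measurable_fun [set: R * R] g ->
  measurable_fun [set: R * R] (fun z => bl_comb (f z) (g z)).
Proof.
move=> mf mg; apply: measurable_funM => //; apply: measurable_funB;
  exact: measurable_funM.
Qed.

Lemma measurable_bl_powers (F G H : R -> R) : measurable_fun [set: R] F ->
  measurable_fun [set: R] G -> measurable_fun [set: R] H ->
  measurable_fun [set: R * R] (fun z : R * R =>
    F z.1 `^ c1 * G z.2 `^ c2 * H (bl_comb z.1 z.2) `^ c3).
Proof.
move=> mF mG mH; have m1 := @measurable_fst _ _ (measurableTypeR R) (measurableTypeR R).
have m2 := @measurable_snd _ _ (measurableTypeR R) (measurableTypeR R).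
have mc := measurable_bl_comb m1 m2.
have mp c : measurable_fun [set: R] (@powR R ^~ c) by exact: measurable_powR.
apply: measurable_funM; first apply: measurable_funM.
- exact: (measurableT_comp (mp c1) (measurableT_comp mF m1)).
- exact: (measurableT_comp (mp c2) (measurableT_comp mG m2)).
- exact: (measurableT_comp (mp c3) (measurableT_comp mH mc)).
Qed.

Lemma measurable_bl_integrand F G H : density F -> density G -> density H ->
  measurable_fun [set: R * R] (fun z : R * R => bl_integrand F G H z.1 z.2).
Proof.
move=> dF dG dH; have [mF _ _] := dF; have [mG _ _] := dG; have [mH _ _] := dH.
have m1 := @measurable_fst _ _ (measurableTypeR R) (measurableTypeR R).
have m2 := @measurable_snd _ _ (measurableTypeR R) (measurableTypeR R).
have mc := measurable_bl_comb m1 m2.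
have mp c : measurable_fun [set: R] (@powR R ^~ c) by exact: measurable_powR.
have mtF := measurableT_comp (measurable_transport_rho dF) m1.
have mtG := measurableT_comp (measurable_transport_rho dG) m2.
have mtH := measurableT_comp (measurable_transport_rho dH) mc.
apply: measurable_funM; first apply: measurable_funM; first apply: measurable_funM.
- exact: (measurableT_comp (mp c1) (measurableT_comp mF m1)).
- exact: (measurableT_comp (mp c2) (measurableT_comp mG m2)).
- exact: (measurableT_comp (mp c3) (measurableT_comp mH mc)).
- apply: measurableT_comp => //; apply: measurable_funM => //.
  apply: measurable_funX; apply: measurable_funB => //.
  exact: measurable_bl_comb.
Qed.

Lemma continuous_powR (f : R -> R) c : continuous f -> (forall x, 0 < f x) ->
  continuous (fun x => f x `^ c).
Proof.
move=> cf f0 x.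
rewrite (_ : (fun _ => _) = (fun x => expR (c * ln (f x)))); last first.
  by apply/funext => y; rewrite /powR gt_eqF.
apply: continuous_comp; last exact: continuous_expR.
apply: cvgM; first exact: cvg_cst.
by apply: continuous_comp; [exact: cf|exact: continuous_ln].
Qed.

(** Continuity along a curve (f x, g x) is what the substitutions use: one variable moves while the
    other is frozen. *)
Lemma continuous_bl_integrand F G H (f g : R -> R) :
  pdensity F -> pdensity G -> pdensity H -> continuous f -> continuous g ->
  continuous (fun x => bl_integrand F G H (f x) (g x)).
Proof.
move=> pF pG pH cf cg x; have pr := @pdensity_normal R.
have cc (f1 g1 : R -> R) : continuous f1 -> continuous g1 ->
    continuous (fun x => bl_comb (f1 x) (g1 x)).
  move=> cf1 cg1 y; apply: cvgM; last exact: cvg_cst.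
  by apply: cvgB; apply: cvgM; try exact: cvg_cst; [exact: cf1|exact: cg1].
have ccomp (f1 g1 : R -> R) : continuous f1 -> continuous g1 -> continuous (f1 \o g1).
  by move=> cf1 cg1 y; apply: continuous_comp; [exact: cg1|exact: cf1].
have [_ cF F0] := pF; have [_ cG G0] := pG; have [_ cH H0] := pH.
have tF := ccomp _ _ (transport_continuous pF pr) cf.
have tG := ccomp _ _ (transport_continuous pG pr) cg.
have tH := ccomp _ _ (transport_continuous pH pr) (cc _ _ cf cg).
apply: cvgM; first apply: cvgM; first apply: cvgM.
- by apply: (@continuous_powR (F \o f)) => [|y]; [exact: (ccomp F f)|exact: F0].
- by apply: (@continuous_powR (G \o g)) => [|y]; [exact: (ccomp G g)|exact: G0].
- apply: (@continuous_powR (H \o (fun x => bl_comb (f x) (g x)))) => [|y].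
    by apply: (ccomp H) => //; exact: cc.
  exact: H0.
- apply: (ccomp expR (fun x => _)) => [|{}x]; first exact: continuous_expR.
  apply: cvgM; first exact: cvg_cst.
  apply: (ccomp (fun x => x ^+ 2) (fun x => _)) => [|{}x]; first exact: exprn_continuous.
  by apply: cvgB; [exact: tH|exact: (cc _ _ tF tG)].
Qed.

End brascamp_lieb.

Lemma ge0_le_integral_iter (R : realType) (f g : R * R -> R) :
  measurable_fun [set: R * R] f -> measurable_fun [set: R * R] g ->
  (forall z, 0 <= f z) -> (forall z, 0 <= g z) ->
  (forall x, \int[@lebesgue_measure R]_y (f (x, y))%:E <=
     \int[@lebesgue_measure R]_y (g (x, y))%:E)%E ->
  (\int[@lebesgue_measure R]_x \int[@lebesgue_measure R]_y (f (x, y))%:E <=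
   \int[@lebesgue_measure R]_x \int[@lebesgue_measure R]_y (g (x, y))%:E)%E.
Proof.
move=> mf mg f0 g0 fg.
have mf' : measurable_fun [set: R * R] (EFin \o f) by exact/measurable_EFinP.
have mg' : measurable_fun [set: R * R] (EFin \o g) by exact/measurable_EFinP.
have f0' z : (0 <= (EFin \o f) z)%E by rewrite lee_fin.
have g0' z : (0 <= (EFin \o g) z)%E by rewrite lee_fin.
apply: ge0_le_integral; first exact: measurableT.
- by move=> x _; apply: integral_ge0 => y _; rewrite lee_fin.
- exact: (@measurable_fun_fubini_tonelli_F _ _ _ _ _ (@lebesgue_measure R) _ mf' f0').
- exact: (@measurable_fun_fubini_tonelli_F _ _ _ _ _ (@lebesgue_measure R) _ mg' g0').
- by move=> x _; exact: fg.
Qed.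

Lemma continuous_normal_ratio (R : realType) (F : R -> R) : pdensity F ->
  continuous (fun a : R => rho a / F (transport rho F a) : R).
Proof.
move=> pF a; have [_ cF F0] := pF; have pr := @pdensity_normal R.
apply: cvgM; first by have [_ + _] := pr; exact.
apply: cvgV; first by rewrite gt_eqF.
apply: continuous_comp; last exact: cF.
exact: transport_continuous.
Qed.

Section brascamp_lieb_continuous.
Context {R : realType}.
Notation mu := (@lebesgue_measure R).
Variables (c1 c2 c3 s s' D : R).
Hypothesis blP : bl_parameters c1 c2 c3 s s' D.
Variables F G H : R -> R.
Hypotheses (pF : pdensity F) (pG : pdensity G) (pH : pdensity H).

Let pr := @pdensity_normal R.
Let comb := bl_comb s s' D.
Let T1 := transport rho F.
Let T2 := transport rho G.
Let th := transport H rho.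
Let phi := bl_integrand c1 c2 c3 s s' D F G H.
Let dT1 (a : R) : R := rho a / F (T1 a).
Let dT2 (a : R) : R := rho a / G (T2 a).
Let X a1 a2 := comb (T1 a1) (T2 a2).
(** The right-hand side of [bl_pointwise] at the normal coordinates a1, a2 and [th (X a1 a2)], with
    the inverses of l1 and l2 written as the derivatives [dT1] and [dT2] of the inverse
    transports. *)
Let psi a1 a2 :=
  rho (c1 * s * a1 + c2 * s' * a2) *
  (rho ((1 - c3) * comb a1 a2 + c3 * th (X a1 a2)) *
  ((1 - c3) + (1 - c1) * ((H (X a1 a2) / rho (th (X a1 a2))) * dT1 a1) +
   (1 - c2) * ((H (X a1 a2) / rho (th (X a1 a2))) * dT2 a2))).

Let F0 x : 0 < F x. Proof. by case: pF. Qed.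
Let G0 x : 0 < G x. Proof. by case: pG. Qed.
Let H0 x : 0 < H x. Proof. by case: pH. Qed.

Let phi_le a1 a2 : phi (T1 a1) (T2 a2) * dT2 a2 * dT1 a1 <= psi a1 a2.
Proof.
pose l1 := F (T1 a1) / rho a1; pose l2 := G (T2 a2) / rho a2.
pose l3 := H (X a1 a2) / rho (th (X a1 a2)).
have l10 : 0 < l1 by rewrite divr_gt0// rho_gt0.
have l20 : 0 < l2 by rewrite divr_gt0// rho_gt0.
have l30 : 0 < l3 by rewrite divr_gt0// rho_gt0.
have := @bl_pointwise R c1 c2 c3 s s' D blP a1 a2 (th (X a1 a2)) l1 l2 l3 l10 l20 l30.
have E1 : dT1 a1 = l1^-1 by rewrite invf_div.
have E2 : dT2 a2 = l2^-1 by rewrite invf_div.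
have rK (a y : R) : rho a * (y / rho a) = y.
  by rewrite mulrC divfK// gt_eqF// rho_gt0.
rewrite /psi -/l3 E1 E2 !rK -[in leRHS]mulrA => h.
apply: le_trans h; rewrite le_eqVlt; apply/orP; left; apply/eqP.
rewrite /phi /bl_integrand -/th -/comb -/(X a1 a2).
rewrite /T1 /T2 !transportK//.
by rewrite -[LHS]mulrA -invfM (mulrC l2).
Qed.

Let cont_dT (F' : R -> R) := @continuous_normal_ratio R F'.

Let dT10 a : 0 < dT1 a. Proof. by rewrite divr_gt0// rho_gt0. Qed.
Let dT20 a : 0 < dT2 a. Proof. by rewrite divr_gt0// rho_gt0. Qed.
Let phi0 x y : 0 <= phi x y. Proof. exact: bl_integrand_ge0. Qed.
Let psi0 x y : 0 <= psi x y.
Proof.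
apply: le_trans (phi_le _ _).
exact: (mulr_ge0 (mulr_ge0 (phi0 _ _) (ltW (dT20 _))) (ltW (dT10 _))).
Qed.

Let mc (f : R -> R) : continuous f -> measurable_fun [set: R] f.
Proof. exact: continuous_measurable_fun. Qed.

Let m1 := @measurable_fst _ _ (measurableTypeR R) (measurableTypeR R).
Let m2 := @measurable_snd _ _ (measurableTypeR R) (measurableTypeR R).

Lemma measurable_bl_psi : measurable_fun [set: R * R] (fun z : R * R => psi z.1 z.2).
Proof.
have [dr cr _] := pr; have [mr _ _] := dr; have [[mH _ _] _ _] := pH.
have mT1 := measurableT_comp (mc (transport_continuous pr pF)) m1.
have mT2 := measurableT_comp (mc (transport_continuous pr pG)) m2.
have mX := @measurable_bl_comb R s s' D _ _ mT1 mT2.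
have mth := measurableT_comp (measurable_transport_rho (let: And3 d _ _ := pH in d)) mX.
have md1 := measurableT_comp (mc (cont_dT pF)) m1.
have md2 := measurableT_comp (mc (cont_dT pG)) m2.
have ml : measurable_fun [set: R * R] (fun z : R * R => H (X z.1 z.2) / rho (th (X z.1 z.2))).
  apply: measurable_funM; first exact: (measurableT_comp mH mX).
  have mrV : measurable_fun [set: R] (fun a : R => (rho a)^-1).
    by apply: mc => a; apply: cvgV; [rewrite gt_eqF// rho_gt0|exact: cr].
  exact: (measurableT_comp mrV mth).
apply: measurable_funM; last apply: measurable_funM.
- apply: measurableT_comp => //.
  by apply: measurable_funD; apply: measurable_funM => //.
- apply: measurableT_comp => //; apply: measurable_funD; apply: measurable_funM => //.
  exact: measurable_bl_comb.
- apply: measurable_funD; first apply: measurable_funD => //.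
  + by apply: measurable_funM => //; apply: measurable_funM.
  + by apply: measurable_funM => //; apply: measurable_funM.
Qed.

Lemma integral_phi_le :
  (\int[mu]_x \int[mu]_y (phi x y)%:E <= \int[mu]_x \int[mu]_y (psi x y)%:E)%E.
Proof.
have [dF cF _] := pF; have [dG cG _] := pG; have [dH cH _] := pH.
have mphi := measurable_bl_integrand c1 c2 c3 s s' D dF dG dH.
have mphi2 : measurable_fun [set: R * R] (fun z : R * R => phi z.1 (T2 z.2) * dT2 z.2).
  apply: measurable_funM; last exact: (measurableT_comp (mc (cont_dT pG)) m2).
  have mp : measurable_fun [set: R * R] (fun z : R * R => (z.1, T2 z.2)).
    apply/measurable_fun_pairP; split; first exact: m1.
    exact: (measurableT_comp (mc (transport_continuous pr pG)) m2).
  exact: (measurableT_comp mphi mp).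
have phi20 z : 0 <= phi z.1 (T2 z.2) * dT2 z.2 by rewrite mulr_ge0// ltW.
(* The variable of [G] is replaced first, in the inner integral; exchanging the integrals then makes
   the variable of [F] the inner one. The inverse transports supply the surjectivity for
   [substitution_ge]. *)
apply: (@le_trans _ _ (\int[mu]_x \int[mu]_y (phi x (T2 y) * dT2 y)%:E)%E).
  apply: (ge0_le_integral_iter mphi mphi2) => // x /=.
  apply: substitution_ge => //.
  - by move=> a; exact: transport_is_derive.
  - exact: cont_dT.
  - by move=> a; exact: ltW.
  - exact: transport_lt.
  - apply: (@continuous_bl_integrand R c1 c2 c3 s s' D F G H (fun=> x) id) => //.
      by move=> y; exact: cvg_cst.
    by move=> y; exact: cvg_id.
  - by move=> y; exists (transport G rho y); exact: transportK.
have sw (f : R * R -> R) : measurable_fun [set: R * R] f -> (forall z, 0 <= f z) ->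
    (\int[mu]_x \int[mu]_y (f (x, y))%:E = \int[mu]_y \int[mu]_x (f (x, y))%:E)%E.
  move=> mf f0; apply: (@fubini_tonelli _ _ _ _ _ mu mu (EFin \o f)).
    exact/measurable_EFinP.
  by move=> z; rewrite lee_fin.
rewrite (sw _ mphi2 phi20) (sw _ measurable_bl_psi (fun z => psi0 z.1 z.2)).
have msw (f : R * R -> R) : measurable_fun [set: R * R] f ->
    measurable_fun [set: R * R] (fun z : R * R => f (z.2, z.1)).
  have mp : measurable_fun [set: R * R] (fun z : R * R => (z.2, z.1)).
    by apply/measurable_fun_pairP; split; [exact: m2|exact: m1].
  by move=> mf; exact: (measurableT_comp mf mp).
apply: (ge0_le_integral_iter (msw _ mphi2) (msw _ measurable_bl_psi)) => [z|z|a2].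
- exact: phi20.
- exact: psi0.
rewrite /=.
apply: (@le_trans _ _ (\int[mu]_a1 (phi (T1 a1) (T2 a2) * dT2 a2 * dT1 a1)%:E)%E).
  apply: (@substitution_ge R T1 dT1 (fun x => phi x (T2 a2) * dT2 a2)).
  - by move=> a; exact: transport_is_derive.
  - exact: cont_dT.
  - by move=> a; exact: ltW.
  - exact: transport_lt.
  - move=> x; apply: cvgM; last exact: cvg_cst.
    apply: (@continuous_bl_integrand R c1 c2 c3 s s' D F G H id (fun=> T2 a2)) => //.
      by move=> y; exact: cvg_id.
    by move=> y; exact: cvg_cst.
  - by move=> x; rewrite mulr_ge0// ltW.
  - by move=> x; exists (transport F rho x); exact: transportK.
apply: ge0_le_integral => //.
- move=> a1 _; rewrite lee_fin.
  exact: (mulr_ge0 (mulr_ge0 (phi0 _ _) (ltW (dT20 _))) (ltW (dT10 _))).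
- apply/measurable_EFinP; apply: measurable_funM; last exact: (mc (cont_dT pF)).
  have := measurable_fun_pair1 a2 mphi2 => h.
  exact: (measurableT_comp h (mc (transport_continuous pr pF))).
- by apply/measurable_EFinP; exact: (measurable_fun_pair1 a2 measurable_bl_psi).
- by move=> a1 _; rewrite lee_fin.
Qed.

Let c30 : 0 < c3. Proof. by case: blP => -[]. Qed.
Let c1s0 : 0 < c1 * s.
Proof. by case: blP => -[? _ _] [? _ _] _ _ _; rewrite mulr_gt0. Qed.
Let c2s'0 : 0 < c2 * s'.
Proof. by case: blP => -[_ ? _] [_ ? _] _ _ _; rewrite mulr_gt0. Qed.
Let s0 : 0 < s. Proof. by case: blP => _ []. Qed.
Let s'0 : 0 < s'. Proof. by case: blP => _ []. Qed.
Let D0 : 0 < D. Proof. by case: blP => _ []. Qed.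
Let c11 : c1 <= 1. Proof. by case: blP => _ _ []. Qed.
Let c21 : c2 <= 1. Proof. by case: blP => _ _ []. Qed.
Let c31 : c3 <= 1. Proof. by case: blP => _ _ []. Qed.
Let Es : c1 * s ^+ 2 + c2 * s' ^+ 2 = 1. Proof. by case: blP. Qed.
Let E1 : c2 * c3 * s' ^+ 2 = 1 - c1. Proof. by case: blP => _ _ _ _ []. Qed.
Let E2 : c1 * c3 * s ^+ 2 = 1 - c2. Proof. by case: blP => _ _ _ _ []. Qed.

(** Coordinates in which c1 s a1 + c2 s' a2, the second component of sum_j c_j a_j u_j, becomes [b],
    and [comb] becomes t / D. *)
Let a1 (b t : R) : R := s * b + c2 * s' * t.
Let a2 (b t : R) : R := s' * b + - (c1 * s) * t.
Let l3 b t : R := H (X (a1 b t) (a2 b t)) / rho (th (X (a1 b t) (a2 b t))).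
(** The first component of sum_j c_j a_j u_j, the third coordinate being a3 = [th] of the point. The
    map (b, t) -> (b, A b t) is triangular. *)
Let A (b t : R) : R := (1 - c3) * (t / D) + c3 * th (X (a1 b t) (a2 b t)).
Let A' (b t : R) : R := D^-1 * ((1 - c3) + (1 - c1) * (l3 b t * dT1 (a1 b t)) +
   (1 - c2) * (l3 b t * dT2 (a2 b t))).

Let psiE b t : psi (a1 b t) (a2 b t) = (rho b * D) * (rho (A b t) * A' b t).
Proof.
have combE : comb (a1 b t) (a2 b t) = t / D.
  rewrite /comb /bl_comb /a1 /a2; congr (_ / _).
  by rewrite -[RHS]mul1r -Es; ring.
have sumE : c1 * s * a1 b t + c2 * s' * a2 b t = b.
  by rewrite /a1 /a2 -[RHS]mul1r -Es; ring.
rewrite /psi sumE combE -/(A b t) -[RHS]mulrA; congr (_ * _).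
by rewrite /A' [RHS]mulrCA mulVKf// gt_eqF.
Qed.

(** The relations c2 c3 s'^2 = 1 - c1 and c1 c3 s^2 = 1 - c2 turn the coefficients of the chain rule
    into the weights of the arithmetic mean in [psi]. *)
Let is_derive_A b t : is_derive t (1 : R) (A b) (A' b t).
Proof.
have aff (k e x : R) : is_derive x (1 : R) (fun x => e + k * x) k.
  have h := is_deriveD (is_derive_cst e x 1) (is_deriveZ k (is_derive_id x 1)).
  by apply: (is_derive_eq h); rewrite add0r scaler1.
have d1 : is_derive t (1 : R) (fun t => T1 (a1 b t)) (dT1 (a1 b t) * (c2 * s')).
  exact: (is_derive1_comp (f := T1) (g := a1 b) (transport_is_derive _ pr pF) (aff _ _ _)).
have d2 : is_derive t (1 : R) (fun t => T2 (a2 b t)) (dT2 (a2 b t) * - (c1 * s)).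
  exact: (is_derive1_comp (f := T2) (g := a2 b) (transport_is_derive _ pr pG) (aff _ _ _)).
have dX : is_derive t (1 : R) (fun t => X (a1 b t) (a2 b t))
    (s' / D * (dT1 (a1 b t) * (c2 * s')) - s / D * (dT2 (a2 b t) * - (c1 * s))).
  have h := is_deriveB (is_deriveZ (s' / D) d1) (is_deriveZ (s / D) d2).
  suff -> : (fun t => X (a1 b t) (a2 b t)) =
    (s' / D) \*: (fun t => T1 (a1 b t)) - (s / D) \*: (fun t => T2 (a2 b t)) by [].
  apply/funext => x; rewrite /X /comb /bl_comb !fctE /GRing.scale/=.
  by rewrite mulrBl (mulrAC s') (mulrAC s).
have dth : is_derive t (1 : R) (fun t => th (X (a1 b t) (a2 b t))) (l3 b t *
    (s' / D * (dT1 (a1 b t) * (c2 * s')) - s / D * (dT2 (a2 b t) * - (c1 * s)))).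
  exact: (is_derive1_comp (f := th) (transport_is_derive _ pH pr) dX).
have h := is_deriveD (aff ((1 - c3) / D) 0 t) (is_deriveZ c3 dth).
have -> : A b = (fun x => 0 + (1 - c3) / D * x) + c3 \*: (fun t => th (X (a1 b t) (a2 b t))).
  by apply/funext => x; rewrite /A !fctE/= add0r -mulrA (mulrC x).
apply: (is_derive_eq h).
rewrite /A' -E1 -E2 /GRing.scale/=; field.
by rewrite gt_eqF.
Qed.

Let cont_A' b : continuous (A' b).
Proof.
have cc (f g : R -> R) : continuous f -> continuous g -> continuous (f \o g).
  by move=> cf cg x; apply: continuous_comp; [exact: cg|exact: cf].
have ca (k e : R) : continuous (fun t : R => e + k * t).
  move=> t; apply: cvgD; first exact: cvg_cst.
  by apply: cvgM; [exact: cvg_cst|exact: cvg_id].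
have c1a := ca (c2 * s') (s * b); have c2a := ca (- (c1 * s)) (s' * b).
have cX : continuous (fun t => X (a1 b t) (a2 b t)).
  move=> t; apply: cvgM; last exact: cvg_cst.
  apply: cvgB; apply: cvgM; try exact: cvg_cst.
  - exact: (cc _ _ (transport_continuous pr pF) c1a).
  - exact: (cc _ _ (transport_continuous pr pG) c2a).
have cl3 : continuous (l3 b).
  move=> t; apply: cvgM.
    by have [_ cH _] := pH; exact: (cc _ _ cH cX).
  apply: cvgV; first by rewrite gt_eqF// rho_gt0.
  have [_ cr _] := pr.
  exact: (cc _ _ cr (cc _ _ (transport_continuous pH pr) cX)).
move=> t; apply: cvgM; first exact: cvg_cst.
apply: cvgD; first apply: cvgD; first exact: cvg_cst.
- apply: cvgM; first exact: cvg_cst.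
  by apply: cvgM; [exact: cl3|exact: (cc _ _ (cont_dT pF) c1a)].
- apply: cvgM; first exact: cvg_cst.
  by apply: cvgM; [exact: cl3|exact: (cc _ _ (cont_dT pG) c2a)].
Qed.

Let A_lt b : {homo A b : x y / x < y}.
Proof.
have T1lt := transport_lt pr pF; have T2lt := transport_lt pr pG.
move=> x y xy; apply: ler_ltD.
  by rewrite ler_wpM2l ?subr_ge0// ler_pM2r ?invr_gt0// ltW.
rewrite ltr_pM2l//; apply: (transport_lt pH pr).
rewrite ltr_pM2r ?invr_gt0//; apply: ltrB.
  by rewrite ltr_pM2l//; apply: T1lt; rewrite ltrD2l ltr_pM2l.
by rewrite ltr_pM2l//; apply: T2lt; rewrite ltrD2l !mulNr ltrN2 ltr_pM2l.
Qed.

Let A'_ge0 b t : 0 <= A' b t.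
Proof.
have l30 : 0 <= l3 b t by rewrite divr_ge0// ltW// rho_gt0.
have e1 := mulr_ge0 l30 (ltW (dT10 (a1 b t))).
have e2 := mulr_ge0 l30 (ltW (dT20 (a2 b t))).
apply: mulr_ge0; first by rewrite invr_ge0 ltW.
have k1 : 0 <= 1 - c1 by rewrite subr_ge0.
have k2 : 0 <= 1 - c2 by rewrite subr_ge0.
have k3 : 0 <= 1 - c3 by rewrite subr_ge0.
exact: (addr_ge0 (addr_ge0 k3 (mulr_ge0 k1 e1)) (mulr_ge0 k2 e2)).
Qed.

Let rD0 b : 0 <= rho b * D.
Proof. by rewrite mulr_ge0// ltW// rho_gt0. Qed.

(** By [psiE] the integrand is [rho b * D] times rho(A) A', so the substitution u = A b t bounds the
    integral by the mass of the normal density. *)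
Let inner b : (\int[mu]_t (psi (a1 b t) (a2 b t))%:E <= (rho b * D)%:E)%E.
Proof.
have [[_ _ r1] cr _] := pr.
under eq_integral do rewrite psiE EFinM.
have g0 t : 0 <= rho (A b t) * A' b t.
  by apply: mulr_ge0 => //; rewrite ltW// rho_gt0.
rewrite ge0_integralZl_EFin; [|by []| | |by []].
- rewrite -[leRHS]mule1; apply: lee_wpmul2l; first by rewrite lee_fin.
  rewrite -[leRHS]r1.
  apply: substitution_le => [t|t|t|x y|t|t].
  + exact: is_derive_A.
  + exact: cont_A'.
  + exact: A'_ge0.
  + exact: A_lt.
  + exact: cr.
  + by rewrite ltW// rho_gt0.
- by move=> t _; rewrite lee_fin.
- apply/measurable_EFinP; apply: measurable_funM; last exact: (mc (@cont_A' b)).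
  apply: measurableT_comp; first exact: measurable_normal_pdf.
  exact: (mc (is_derive_continuous (is_derive_A b))).
Qed.

Lemma integral_psi : (\int[mu]_x \int[mu]_y (psi x y)%:E <= D%:E)%E.
Proof.
have [[mr _ r1] _ _] := pr.
have mpsi : measurable_fun [set: R * R] (fun z : R * R => (psi z.1 z.2)%:E).
  by apply/measurable_EFinP; exact: measurable_bl_psi.
have mpsi' : measurable_fun [set: R * R] (fun z : R * R => psi (a1 z.1 z.2) (a2 z.1 z.2)).
  have ml : measurable_fun [set: R * R] (fun z : R * R => (a1 z.1 z.2, a2 z.1 z.2)).
    by apply/measurable_fun_pairP; split; apply: measurable_funD;
      apply: measurable_funM.
  exact: (measurableT_comp measurable_bl_psi ml).
have := @ge0_integral_linear2 R s (c2 * s') s' (- (c1 * s)) (fun z => (psi z.1 z.2)%:E).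
(* The passage from (b, t) to the normal coordinates has determinant -1, so it contributes no
   Jacobian factor. *)
have -> : s * - (c1 * s) - c2 * s' * s' = -1 by rewrite -Es; ring.
rewrite normrN1 mul1e oppr_eq0 (gt_eqF c1s0) oppr_eq0 oner_eq0.
move=> /(_ isT isT mpsi) ->; last by move=> z; rewrite lee_fin.
apply: (@le_trans _ _ (\int[mu]_b (rho b * D)%:E)%E).
  apply: ge0_le_integral; first exact: measurableT.
  - by move=> b _; apply: integral_ge0 => t _; rewrite lee_fin.
  - have mpsi'' : measurable_fun [set: R * R]
        (EFin \o (fun z : R * R => psi (a1 z.1 z.2) (a2 z.1 z.2))).
      exact/measurable_EFinP.
    apply: (@measurable_fun_fubini_tonelli_F _ _ _ _ _ mu _ mpsi'').
    by move=> z; rewrite lee_fin.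
  - by apply/measurable_EFinP; apply: measurable_funM.
  - by move=> b _; exact: inner.
under eq_integral do rewrite EFinM.
rewrite ge0_integralZr; [|by []| | |by rewrite lee_fin ltW].
- by rewrite r1 mul1e.
- exact/measurable_EFinP.
- by move=> b _; rewrite lee_fin ltW// rho_gt0.
Qed.

Lemma bl_pdensity : (\int[mu]_x \int[mu]_y (phi x y)%:E <= D%:E)%E.
Proof. exact: le_trans integral_phi_le integral_psi. Qed.

End brascamp_lieb_continuous.

(** * The inequality for arbitrary densities *)

Section measure_lemmas.
Local Open Scope ereal_scope.

(** The alternative [f x = 0] covers the points where a density vanishes: the limit integrand is 0
    there, while the transports of the approximations may fail to converge to those of the limit. *)
Lemma fatou_ae_le d (T : measurableType d) (R : realType)
    (nu : {measure set T -> \bar R}) (f : T -> \bar R) (fn : (T -> \bar R)^nat) M :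
  measurable_fun setT f -> (forall n, measurable_fun setT (fn n)) ->
  (forall x, 0 <= f x) -> (forall n x, 0 <= fn n x) ->
  {ae nu, forall x, f x = 0 \/ fn n x @[n --> \oo] --> f x} ->
  (forall n, \int[nu]_x fn n x <= M) ->
  \int[nu]_x f x <= M.
Proof.
move=> mf mfn f0 fn0 aef fnM.
have l0 x : 0 <= limn_einf (fn ^~ x).
  rewrite limn_einf_lim; apply: lime_ge; first exact: is_cvg_einfs.
  by near=> n; apply: le_ereal_inf_tmp => _ [k _ <-].
apply: (@le_trans _ _ (\int[nu]_x limn_einf (fn ^~ x))).
  apply: ae_ge0_le_integral => //.
    apply: (measurableT_comp (f := -%E)) => //.
    by apply: measurable_fun_limn_esup => n; exact: measurableT_comp.
  by apply: filterS aef => x [->|/cvg_limn_einf_sup[-> _]] _.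
apply: le_trans (fatou nu measurableT mfn _) _ => [n x _//|].
rewrite limn_einf_lim; apply: lime_le; first exact: is_cvg_einfs.
near=> n; apply: le_trans (fnM n).
by apply: ereal_inf_lbound; exists n => /=.
Unshelve. all: end_near. Qed.

Definition mu2 {R : realType} :
  {measure set (measurableTypeR R * measurableTypeR R) -> \bar R} :=
  (@lebesgue_measure R \x @lebesgue_measure R).

#[global] Instance mu2_filter (R : realType) : Filter (almost_everywhere (@mu2 R)).
Proof. exact: ae_filter_ringOfSetsType. Qed.

#[global] Instance lebesgue_filter (R : realType) :
  Filter (almost_everywhere (@lebesgue_measure R)).
Proof. exact: ae_filter_ringOfSetsType. Qed.

Lemma integral_mu2 (R : realType) (f : R * R -> \bar R) :
  measurable_fun [set: R * R] f -> (forall z, 0 <= f z) ->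
  \int[mu2]_z f z = \int[@lebesgue_measure R]_x \int[@lebesgue_measure R]_y f (x, y).
Proof. by move=> mf f0; exact: fubini_tonelli1. Qed.

Lemma ae_fst (R : realType) (P : R -> Prop) :
  {ae @lebesgue_measure R, forall x, P x} ->
  {ae mu2, forall z : R * R, P z.1}.
Proof.
move=> [N [mN N0 PN]]; exists (N `*` [set: R]); split.
- exact: measurableX.
- transitivity (lebesgue_measure N * @lebesgue_measure R setT);
    [exact: product_measure1E|by rewrite N0 mul0e].
- by move=> z /= nP; split => //; exact: PN.
Qed.

Lemma ae_snd (R : realType) (P : R -> Prop) :
  {ae @lebesgue_measure R, forall x, P x} ->
  {ae mu2, forall z : R * R, P z.2}.
Proof.
move=> [N [mN N0 PN]]; exists ([set: R] `*` N); split.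
- exact: measurableX.
- transitivity (@lebesgue_measure R setT * lebesgue_measure N);
    [exact: product_measure1E|by rewrite N0 mule0].
- by move=> z /= nP; split => //; exact: PN.
Qed.

(** As [b] is nonzero, every vertical section of the exceptional set is the preimage of a null set
    under an invertible affine map. *)
Lemma ae_linear (R : realType) (P : R -> Prop) (a b : R) : b != 0%R ->
  {ae @lebesgue_measure R, forall x, P x} ->
  {ae mu2,
     forall z : R * R, P (a * z.1 + b * z.2)%R}.
Proof.
move=> b0 [N [mN N0 PN]].
pose l (z : R * R) := (a * z.1 + b * z.2)%R.
have ml : measurable_fun [set: R * R] l.
  by apply: measurable_funD; apply: measurable_funM.
exists (l @^-1` N); split.
- by rewrite -[X in measurable X]setTI; exact: ml.
- rewrite /mu2/= /product_measure1; apply: integral0_eq => x _ /=.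
  have -> : xsection (l @^-1` N) x =
      (fun y : measurableTypeR R => (b * y + a * x)%R : measurableTypeR R) @^-1` N.
    by apply/seteqP; split => y; rewrite /xsection/= inE/= /l/= addrC.
  have := @lebesgue_measure_affine R b (a * x) N b0 mN.
  rewrite N0 /pushforward => /esym/eqP.
  by rewrite mule_eq0 eqe normr_eq0 (negbTE b0)/= => /eqP.
- by move=> z /= nP; exact: PN.
Qed.

End measure_lemmas.

(** * Smoothing of densities *)

Section smoothing.
Context {R : realType}.
Notation mu := (@lebesgue_measure R).
Implicit Types (F : R -> R) (d x y : R).

(** The mean of [F] over a window of length [d], continuous because [dist F] is, mixed with a little
    of the normal density for positivity. As a difference quotient of [dist F], the mean converges
    to [F] almost everywhere. *)
Definition smooth F d x : R :=
  (1 - d) * ((dist F (x + d) - dist F x) / d) + d * rho x.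

(** Fubini for the function [F t] on the strip y < t <= y + d. *)
Lemma integral_dist_increment F d (E : set R) : density F -> 0 < d -> measurable E ->
  (\int[mu]_(y in E) (dist F (y + d) - dist F y)%:E =
   \int[mu]_t ((F t)%:E * mu (E `&` `[(t - d)%R, t[)))%E.
Proof.
move=> dF d0 mE; have [mF F0 _] := dF.
pose k (z : R * R) : \bar R := ((F z.2)%:E * ((\1_E z.1)%:E * (\1_(`]0, d]) (z.2 - z.1))%:E))%E.
have mk : measurable_fun [set: R * R] k.
  apply: emeasurable_funM.
    apply/measurable_EFinP; exact: (measurableT_comp mF measurable_snd).
  apply: emeasurable_funM; apply/measurable_EFinP.
    exact: (measurableT_comp (@measurable_indic _ (measurableTypeR R) _ _ _ mE) measurable_fst).
  have ms : measurable_fun [set: R * R] (fun z : R * R => z.2 - z.1).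
    by apply: measurable_funB; [exact: measurable_snd|exact: measurable_fst].
  exact: (measurableT_comp (@measurable_indic _ (measurableTypeR R) _ _ _ (measurable_itv `]0, d])) ms).
have k0 z : (0 <= k z)%E by rewrite /k !mule_ge0// lee_fin.
have L : (\int[mu]_(y in E) (dist F (y + d) - dist F y)%:E =
    \int[mu]_y \int[mu]_t k (y, t))%E.
  rewrite integral_mkcond; apply: eq_integral => y _.
  rewrite /patch /k/= /indic; case: (y \in E) => /=; last first.
    by rewrite integral0_eq// => t _; rewrite mul0e mule0.
  rewrite -dist_sub ?lerDl ?(ltW d0)// integral_mkcond; apply: eq_integral => t _.
  rewrite mul1e /patch !mem_setE !in_itv/= subr_gt0 lerBlDl.
  by case: ifP => _; rewrite ?mule1 ?mule0.
rewrite L (@fubini_tonelli _ _ _ _ _ mu mu k mk k0).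
apply: eq_integral => t _; rewrite /k/=.
rewrite ge0_integralZl//=; last 2 first.
- apply: emeasurable_funM; apply/measurable_EFinP; first exact: measurable_indic.
  have ms : measurable_fun [set: R] (fun y : R => t - y) by exact: measurable_funB.
  exact: (measurableT_comp (@measurable_indic _ (measurableTypeR R) _ _ _ (measurable_itv `]0, d])) ms).
- by rewrite lee_fin.
congr (_ * _)%E.
rewrite -[RHS]mul1e -integral_cst; last exact: measurableI.
rewrite [RHS]integral_mkcond; apply: eq_integral => y _.
rewrite -EFinM /patch in_setI /indic !mem_setE !in_itv/=.
rewrite subr_gt0 lerBlDl -lerBlDr (andbC (y < t)).
case: (y \in E) => /=; last by rewrite mul0r.
by case: ifP; rewrite mul1r.
Qed.


Lemma mu_co d t : 0 < d -> mu `[(t - d)%R, t[ = d%:E.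
Proof.
move=> d0; rewrite lebesgue_measure_itv/= lte_fin gtrBl d0.
by rewrite -EFinD opprB addrC subrK.
Qed.

Lemma continuous_shift (f : R -> R) d : continuous f -> continuous (fun x => f (x + d)).
Proof.
move=> cf x; apply: (@continuous_comp _ _ _ (fun x => x + d) f); last exact: cf.
by apply: cvgD; [exact: cvg_id|exact: cvg_cst].
Qed.

Lemma measurable_dist_increment F d : density F ->
  measurable_fun [set: R] (fun y => dist F (y + d) - dist F y).
Proof.
move=> dF; have cF := dist_continuous dF.
apply: continuous_measurable_fun => x; apply: cvgB; last exact: cF.
have cS := @continuous_shift (dist F) d cF; exact: (cS x).
Qed.

Lemma dist_increment_ge0 F d x : density F -> 0 < d -> 0 <= dist F (x + d) - dist F x.
Proof. by move=> dF d0; rewrite subr_ge0; apply: dist_nd => //; rewrite lerDl ltW. Qed.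

Lemma integral_dist_incrementT F d : density F -> 0 < d ->
  (\int[mu]_y (dist F (y + d) - dist F y)%:E = d%:E)%E.
Proof.
move=> dF d0; rewrite integral_dist_increment//.
under eq_integral do rewrite setTI mu_co// muleC.
have [mF F0 F1] := dF.
rewrite ge0_integralZl//.
- by rewrite F1 mule1.
- exact/measurable_EFinP.
- by move=> x _; rewrite lee_fin.
- by rewrite lee_fin ltW.
Qed.

(** A point t contributes [F t] times the length of [t - d, t[ inside the ray: the full length [d]
    for t <= x, and nothing for t > x + d. *)
Lemma integral_dist_increment_ray F d x : density F -> 0 < d ->
  ((d * dist F x)%:E <= \int[mu]_(y in `]-oo, x]) (dist F (y + d) - dist F y)%:E <=
   (d * dist F (x + d))%:E)%E.
Proof.
move=> dF d0; have [mF F0 F1] := dF.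
have mFE : measurable_fun [set: R] (EFin \o F) by exact/measurable_EFinP.
have mh : measurable_fun [set: R] (fun t => mu (`]-oo, x] `&` `[(t - d)%R, t[)).
  have ms : measurable_fun [set: R * R] (fun z : R * R => z.2 - z.1).
    by apply: measurable_funB; [exact: measurable_snd|exact: measurable_fst].
  pose B := fst @^-1` `]-oo, x] `&` (fun z : R * R => z.2 - z.1) @^-1` `]0, d].
  have mB : measurable B.
    apply: measurableI; rewrite -[X in measurable X]setTI.
      by apply: measurable_fst => //; exact: measurable_itv.
    by apply: ms => //; exact: measurable_itv.
  rewrite (_ : (fun _ => _) = (mu \o ysection B)); first exact: measurable_fun_ysection.
  apply/funext => t /=; congr (mu _); apply/seteqP; split => y;
    rewrite /B /ysection/= inE/= !in_itv/= subr_gt0 lerBlDl -lerBlDr andbC;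
    by move=> [-> /andP[-> ->]].
have mdF : measurable_fun [set: R] (fun t => d%:E * (F t)%:E)%E.
  by apply: emeasurable_funM => //; exact: measurable_cst.
have dE y : ((d * dist F y)%:E = \int[mu]_(t in `]-oo, y]) (d%:E * (F t)%:E))%E.
  rewrite ge0_integralZl//.
  - by rewrite -EFin_distE// EFinM.
  - exact: measurable_funTS.
  - by move=> t _; rewrite lee_fin.
  - by rewrite lee_fin ltW.
rewrite integral_dist_increment//; apply/andP; split.
- rewrite dE integral_mkcond; apply: ge0_le_integral => //.
  + by move=> t _; rewrite /patch; case: ifP => // _; rewrite mule_ge0// lee_fin// ltW.
  + by apply/(measurable_restrictT _ (measurable_itv _)); exact: measurable_funTS.
  + by apply: emeasurable_funM.
  + move=> t _; rewrite /patch; case: ifPn => [|_]; last by rewrite mule_ge0// lee_fin.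
    rewrite inE/= in_itv/= => tx.
    rewrite (_ : _ `&` _ = `[(t - d)%R, t[%classic) ?mu_co// 1?muleC//.
    apply/seteqP; split => y [] //=; rewrite !in_itv/= => /andP[h1 h2].
    by split; [rewrite (le_trans _ tx)// ltW|apply/andP].
- rewrite dE [leRHS]integral_mkcond; apply: ge0_le_integral => //.
  + by move=> t _; rewrite mule_ge0// lee_fin.
  + by apply: emeasurable_funM.
  + by apply/(measurable_restrictT _ (measurable_itv _)); exact: measurable_funTS.
  + move=> t _; rewrite /patch; case: ifPn => [_|].
      rewrite muleC; apply: lee_wpmul2r; first by rewrite lee_fin.
      by rewrite -(mu_co t d0); apply: le_measure; rewrite ?inE;
        [exact: measurableI|exact: measurable_itv|exact: subIsetr].
    rewrite notin_setE/= in_itv/= => /negP; rewrite -ltNge => xt.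
    rewrite (_ : _ `&` _ = set0) ?measure0 ?mule0//.
    apply/seteqP; split => y //= []; rewrite !in_itv/= => h1 /andP[h2 h3].
    by lra.
Qed.

Lemma smooth_pdensity F d : density F -> 0 < d -> d <= 1 -> pdensity (smooth F d).
Proof.
move=> dF d0 d1; have [[mr r0 r1] cr rp] := @pdensity_normal R.
have i0 x := dist_increment_ge0 x dF d0.
have mi := measurable_dist_increment d dF.
have s0 x : 0 < smooth F d x.
  by rewrite ltr_wpDl// ?mulr_gt0// mulr_ge0 ?subr_ge0// divr_ge0// ltW.
have cF := dist_continuous dF.
have cs : continuous (smooth F d).
  move=> x; apply: cvgD; apply: cvgM; try exact: cvg_cst; last exact: cr.
  apply: cvgM; last exact: cvg_cst.
  have cS := @continuous_shift (dist F) d cF.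
  by apply: cvgB; [exact: (cS x)|exact: cF].
split => //; split.
- exact: continuous_measurable_fun.
- by move=> x; exact: ltW.
- have k0 : 0 <= (1 - d) / d by rewrite divr_ge0 ?subr_ge0// ltW.
  transitivity (\int[mu]_x (((1 - d) / d)%:E * (dist F (x + d) - dist F x)%:E +
      d%:E * (rho x)%:E))%E.
    by apply: eq_integral => x _; rewrite /smooth -!EFinM -EFinD; congr EFin;
      rewrite mulrA mulrAC.
  rewrite ge0_integralD; [|by []| | | |].
  + rewrite ge0_integralZl_EFin; [|by []| | |by []].
    * rewrite ge0_integralZl_EFin; [|by []| | |exact: ltW].
      - rewrite integral_dist_incrementT// r1 mule1 -EFinM -EFinD divfK ?gt_eqF//.
        by rewrite subrK.
      - by move=> x _; rewrite lee_fin.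
      - exact/measurable_EFinP.
    * by move=> x _; rewrite lee_fin.
    * exact/measurable_EFinP.
  + by move=> x _; rewrite mule_ge0// lee_fin.
  + by apply: emeasurable_funM; [exact: measurable_cst|exact/measurable_EFinP].
  + by move=> x _; rewrite mule_ge0// lee_fin// ltW.
  + by apply: emeasurable_funM; [exact: measurable_cst|exact/measurable_EFinP].
Qed.

(** Averaging moves mass to the left, by at most [d]; the normal part adds a mass between 0 and
    [d]. *)
Lemma smooth_dist_bounds F d x : density F -> 0 < d <= 1 ->
  (1 - d) * dist F x <= dist (smooth F d) x <= dist F (x + d) + d.
Proof.
move=> dF /andP[d0 d1]; have pr := @pdensity_normal R; have [[mr r0 r1] cr rp] := pr.
have dr : density (rho : R -> R) by case: pr.
have i0 y := dist_increment_ge0 y dF d0.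
have mi := measurable_dist_increment d dF.
have k0 : 0 <= (1 - d) / d by rewrite divr_ge0 ?subr_ge0// ltW.
have [ds _ _] := smooth_pdensity dF d0 d1.
have E : ((dist (smooth F d) x)%:E = ((1 - d) / d)%:E *
    (\int[mu]_(y in `]-oo, x]) (dist F (y + d) - dist F y)%:E) + (d * dist rho x)%:E)%E.
  rewrite EFin_distE//.
  transitivity (\int[mu]_(y in `]-oo, x]) (((1 - d) / d)%:E * (dist F (y + d) - dist F y)%:E +
      d%:E * (rho y)%:E))%E.
    by apply: eq_integral => y _; rewrite /smooth -!EFinM -EFinD; congr EFin;
      rewrite mulrA mulrAC.
  rewrite ge0_integralD; [|exact: measurable_itv| | | |].
  + rewrite ge0_integralZl_EFin; [|exact: measurable_itv| | |by []].
    * rewrite ge0_integralZl_EFin; [|exact: measurable_itv| | |exact: ltW].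
      - by rewrite (EFinM d (dist rho x)) EFin_distE.
      - by move=> y _; rewrite lee_fin.
      - by apply: measurable_funTS; exact/measurable_EFinP.
    * by move=> y _; rewrite lee_fin.
    * by apply: measurable_funTS; exact/measurable_EFinP.
  + by move=> y _; rewrite mule_ge0// lee_fin.
  + apply: measurable_funTS.
    by apply: emeasurable_funM; [exact: measurable_cst|exact/measurable_EFinP].
  + by move=> y _; rewrite mule_ge0// lee_fin// ltW.
  + apply: measurable_funTS.
    by apply: emeasurable_funM; [exact: measurable_cst|exact/measurable_EFinP].
have /andP[l u] := integral_dist_increment_ray x dF d0.
have k0E : (0 <= ((1 - d) / d)%:E)%E by rewrite lee_fin.
have kd y : (1 - d) / d * (d * y) = (1 - d) * y by rewrite mulrA divfK// gt_eqF.
rewrite -!lee_fin E; apply/andP; split.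
- apply: (@le_trans _ _ (((1 - d) / d)%:E * (d * dist F x)%:E)%E).
    by rewrite -EFinM kd.
  apply: (le_trans (lee_wpmul2l k0E l)); rewrite leeDl// lee_fin.
  by rewrite mulr_ge0 ?dist_ge0// ltW.
- rewrite EFinD; apply: leeD.
    apply: (le_trans (lee_wpmul2l k0E u)).
    rewrite -EFinM kd lee_fin ler_piMl ?dist_ge0//.
    by rewrite lerBlDr lerDl ltW.
  by rewrite lee_fin ler_piMr ?dist_le1// ltW.
Qed.

Lemma smooth_dist_cvg F (d_ : R^nat) x : density F ->
  (forall n, 0 < d_ n <= 1) -> d_ n @[n --> \oo] --> 0 ->
  dist (smooth F (d_ n)) x @[n --> \oo] --> dist F x.
Proof.
move=> dF d01 dn0; have cF := dist_continuous dF.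
apply: (@squeeze_cvgr _ _ _ _ (fun n => (1 - d_ n) * dist F x)
  (fun n => dist F (x + d_ n) + d_ n)).
- by near=> n; exact: smooth_dist_bounds.
- rewrite -[X in _ --> X]mul1r -[X in X * _]subr0; apply: cvgM; last exact: cvg_cst.
  by apply: cvgB; first exact: cvg_cst.
- rewrite -[X in _ --> X]addr0; apply: cvgD => //.
  apply: continuous_cvg; last first.
    by rewrite -[X in _ --> X]addr0; apply: cvgD => //; exact: cvg_cst.
  exact: cF.
Unshelve. all: end_near. Qed.

Lemma increment_cvg F (u : R^nat) x :
  derivable (dist F) x 1 /\ (dist F)^`()%classic x = F x ->
  (forall n, u n != 0) -> u n @[n --> \oo] --> 0 ->
  (dist F (x + u n) - dist F x) / u n @[n --> \oo] --> F x.
Proof.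
move=> [dx <-] u0 un0.
have : h^-1 *: (dist F (h *: 1 + x) - dist F x) @[h --> 0^'] --> (dist F)^`()%classic x.
  by rewrite derive1E.
move=> /cvgr_dnbhsP /(_ u)-/(_ (conj u0 un0)).
suff -> : (fun n => (u n)^-1 *: (dist F (u n *: 1 + x) - dist F x)) =
  (fun n => (dist F (x + u n) - dist F x) / u n) by [].
by apply/funext => n; rewrite /GRing.scale/= mulr1 mulrC (addrC x).
Qed.

Lemma smooth_cvg F (d_ : R^nat) x : density F ->
  derivable (dist F) x 1 /\ (dist F)^`()%classic x = F x ->
  (forall n, 0 < d_ n <= 1) -> d_ n @[n --> \oo] --> 0 ->
  smooth F (d_ n) x @[n --> \oo] --> F x.
Proof.
move=> dF gx d01 dn0.
have h : 1 * F x + 0 * rho x = F x by rewrite mul1r mul0r addr0.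
rewrite -h; apply: cvgD; apply: cvgM => //; last exact: cvg_cst.
- rewrite -[X in _ --> X]subr0; apply: cvgB => //; exact: cvg_cst.
- apply: increment_cvg => // n.
  by have /andP[d0 _] := d01 n; rewrite gt_eqF.
Qed.

(** If [dist F x] were 0, it would be 0 on the left of [x]; if it were 1, it would be 1 on the
    right. The difference quotients from that side would vanish, and with them [F x]. *)
Lemma good_dist_gt0_lt1 F x : density F ->
  derivable (dist F) x 1 /\ (dist F)^`()%classic x = F x ->
  0 < F x -> 0 < dist F x < 1.
Proof.
move=> dF gx Fx0.
have h0 (u : R^nat) : (forall n, u n != 0) -> u n @[n --> \oo] --> 0 ->
    (forall n, dist F (x + u n) = dist F x) -> False.
  move=> u0 un0 hu; have := increment_cvg gx u0 un0.
  under eq_fun do rewrite hu subrr mul0r.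
  move=> /(cvg_unique (@norm_hausdorff _ _)) /(_ (cvg_cst _)) E.
  by rewrite E ltxx in Fx0.
have hu0 : (fun n => n.+1%:R^-1 : R) @ \oo --> 0 by exact: cvg_harmonic.
rewrite !lt_neqAle dist_ge0// dist_le1// !andbT; apply/andP; split; apply/eqP => E.
- apply: (h0 (fun n => - n.+1%:R^-1)) => [n||n].
  + by rewrite oppr_eq0 invr_eq0 pnatr_eq0.
  + by rewrite -oppr0; apply: cvgN.
  + apply/eqP; rewrite eq_le dist_nd//= ?gerDl ?oppr_le0// -E.
    exact: dist_ge0.
- apply: (h0 (fun n => n.+1%:R^-1)) => [n||n].
  + by rewrite invr_eq0 pnatr_eq0.
  + exact: hu0.
  + apply/eqP; rewrite eq_le E dist_le1//=.
    by rewrite -[leLHS]E; apply: dist_nd => //; rewrite lerDl.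
Qed.

End smoothing.

(** * Limits of the smoothed densities and the loss in the inequality *)

Section brascamp_lieb_density.
Context {R : realType}.
Notation mu := (@lebesgue_measure R).
Variables (c1 c2 c3 s s' D : R).
Hypothesis blP : bl_parameters c1 c2 c3 s s' D.
Variables F G H : R -> R.
Hypotheses (dF : density F) (dG : density G) (dH : density H).

Let comb := bl_comb s s' D.
Let phi (z : R * R) := bl_integrand c1 c2 c3 s s' D F G H z.1 z.2.

Let D0 : 0 < D. Proof. by case: blP => _ []. Qed.

Lemma bl_combE x y : comb x y = s' / D * x + - (s / D) * y.
Proof. by rewrite /comb /bl_comb; field; rewrite gt_eqF. Qed.

Let good (K : R -> R) x := derivable (dist K) x 1 /\ (dist K)^`()%classic x = K x.

Lemma ae_bl_good : {ae mu2, forall z : R * R,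
  [/\ good F z.1, good G z.2 & good H (comb z.1 z.2)]}.
Proof.
have sD : - (s / D) != 0.
  by case: blP => _ [s0 _ _] _ _ _; rewrite oppr_eq0 gt_eqF// divr_gt0.
have h1 := ae_fst (dist_ae_derive dF); have h2 := ae_snd (dist_ae_derive dG).
have h3 := ae_linear (s' / D) sD (dist_ae_derive dH).
apply: filterS3 h1 h2 h3 => z k1 k2 k3; split => //.
by rewrite bl_combE.
Qed.

(** The level must be strictly between 0 and 1: at the endpoints [quantile rho] takes its default
    value and is discontinuous. *)
Lemma transport_rho_cvg (K : R -> R) (d_ : R^nat) x : density K -> 0 < dist K x < 1 ->
  (forall n, 0 < d_ n <= 1) -> d_ n @[n --> \oo] --> 0 ->
  transport (smooth K (d_ n)) rho x @[n --> \oo] --> transport K rho x.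
Proof.
move=> dK K01 d01 dn0; have := @quantile_is_derive R rho _ (@pdensity_normal R) K01.
case=> /derivable1_diffP /differentiable_continuous cQ _.
by apply: continuous_cvg; [exact: cQ|exact: smooth_dist_cvg].
Qed.

Lemma powR_cvg (u : R^nat) (l c : R) : 0 < l -> (forall n, 0 < u n) ->
  u n @[n --> \oo] --> l -> u n `^ c @[n --> \oo] --> l `^ c.
Proof.
move=> l0 u0 ul; have E x : 0 < x -> x `^ c = expR (c * ln x) by move=> x0; rewrite /powR (gt_eqF x0).
rewrite (E _ l0); under eq_fun do rewrite E//.
apply: continuous_cvg; first exact: continuous_expR.
apply: cvgM; first exact: cvg_cst.
by apply: continuous_cvg; first exact: continuous_ln.
Qed.

Lemma bl_integrand_cvg (d_ : R^nat) (z : R * R) :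
  (forall n, 0 < d_ n <= 1) -> d_ n @[n --> \oo] --> 0 ->
  [/\ good F z.1, good G z.2 & good H (comb z.1 z.2)] ->
  [/\ 0 < F z.1, 0 < G z.2 & 0 < H (comb z.1 z.2)] ->
  bl_integrand c1 c2 c3 s s' D (smooth F (d_ n)) (smooth G (d_ n)) (smooth H (d_ n))
    z.1 z.2 @[n --> \oo] --> phi z.
Proof.
move=> d01 dn0 [gF gG gH] [F0 G0 H0].
have sm0 K n x : density K -> 0 < smooth K (d_ n) x.
  by move=> dK; have /andP[h1 h2] := d01 n; have [_ _] := smooth_pdensity dK h1 h2; exact.
apply: cvgM; first apply: cvgM; first apply: cvgM.
- by apply: powR_cvg => // [n|]; [exact: sm0|exact: smooth_cvg].
- by apply: powR_cvg => // [n|]; [exact: sm0|exact: smooth_cvg].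
- by apply: powR_cvg => // [n|]; [exact: sm0|exact: smooth_cvg].
apply: continuous_cvg; first exact: continuous_expR.
apply: cvgM; first exact: cvg_cst.
have t1 := transport_rho_cvg dF (good_dist_gt0_lt1 dF gF F0) d01 dn0.
have t2 := transport_rho_cvg dG (good_dist_gt0_lt1 dG gG G0) d01 dn0.
have t3 := transport_rho_cvg dH (good_dist_gt0_lt1 dH gH H0) d01 dn0.
apply: (continuous_cvg _ (h := fun x : R => x ^+ 2)); first exact: exprn_continuous.
apply: cvgB => //; apply: cvgM; last exact: cvg_cst.
by apply: cvgB; apply: cvgM => //; exact: cvg_cst.
Qed.

Let mphi : measurable_fun [set: R * R] (EFin \o phi).
Proof. by apply/measurable_EFinP; exact: measurable_bl_integrand. Qed.

Lemma bl_integral_prod : (\int[mu2]_z (phi z)%:E <= D%:E)%E.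
Proof.
pose d_ (n : nat) : R := n.+1%:R^-1.
have d01 n : 0 < d_ n <= 1.
  by rewrite invr_gt0 ltr0n/= invf_le1// ler1n.
have dn0 : d_ n @[n --> \oo] --> 0 by exact: cvg_harmonic.
have pS K n : density K -> pdensity (smooth K (d_ n)).
  by move=> dK; have /andP[h1 h2] := d01 n; exact: smooth_pdensity.
have mS n : measurable_fun [set: R * R] (fun z : R * R =>
    (bl_integrand c1 c2 c3 s s' D (smooth F (d_ n)) (smooth G (d_ n)) (smooth H (d_ n))
    z.1 z.2)%:E).
  apply/measurable_EFinP; apply: measurable_bl_integrand;
    by have [] := pS _ n dF; have [] := pS _ n dG; have [] := pS _ n dH.
apply: (@fatou_ae_le _ _ _ mu2 (EFin \o phi) (fun n (z : R * R) =>
    (bl_integrand c1 c2 c3 s s' D (smooth F (d_ n)) (smooth G (d_ n)) (smooth H (d_ n))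
    z.1 z.2)%:E)) => //.
- by move=> z; rewrite lee_fin; exact: bl_integrand_ge0.
- by move=> n z; rewrite lee_fin; exact: bl_integrand_ge0.
- have [[c10 c20 c30] _ _ _ _] := blP.
  have [_ F0 _] := dF; have [_ G0 _] := dG; have [_ H0 _] := dH.
  apply: filterS ae_bl_good => z gz.
  (* The exponents being positive, a vanishing density makes the limit integrand 0 whatever the
     transports are. Otherwise, at good points, all three levels lie in ]0, 1[. *)
  have [Fz|Fz] := eqVneq (F z.1) 0.
    by left; rewrite /= /phi /bl_integrand Fz powR0 ?gt_eqF// !mul0r.
  have [Gz|Gz] := eqVneq (G z.2) 0.
    by left; rewrite /= /phi /bl_integrand Gz powR0 ?gt_eqF// mulr0 !mul0r.
  have [Hz|Hz] := eqVneq (H (comb z.1 z.2)) 0.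
    by left; rewrite /= /phi /bl_integrand -/comb Hz powR0 ?gt_eqF// mulr0 !mul0r.
  right; apply: cvg_EFin; first by near=> n.
  apply: bl_integrand_cvg => //.
  by rewrite !lt_neqAle !(eq_sym 0) Fz Gz Hz F0 G0 H0.
- move=> n; rewrite (integral_mu2 (mS n)); last first.
    by move=> z; rewrite lee_fin; exact: bl_integrand_ge0.
  by apply: bl_pdensity => //; exact: pS.
Unshelve. all: end_near. Qed.

Let J (z : R * R) := F z.1 `^ c1 * G z.2 `^ c2 * H (comb z.1 z.2) `^ c3.

Let mJ : measurable_fun [set: R * R] J.
Proof.
by have [[mF _ _] [mG _ _] [mH _ _]] := And3 dF dG dH; exact: measurable_bl_powers.
Qed.

Let J_ge0 z : 0 <= J z.
Proof. by rewrite /J !mulr_ge0// powR_ge0. Qed.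

Let gap z := c3 * (1 - c3) / 2 * (transport H rho (comb z.1 z.2) -
    comb (transport F rho z.1) (transport G rho z.2)) ^+ 2.

Let gap_ge0 z : 0 <= gap z.
Proof.
have [[_ _ c30] _ [_ _ c31] _ _] := blP.
by rewrite /gap mulr_ge0 ?sqr_ge0// divr_ge0// mulr_ge0 ?subr_ge0// ltW.
Qed.

Let J_le z : J z <= phi z.
Proof.
rewrite /phi /bl_integrand -/comb -/(J z) ler_peMr//.
by rewrite -/(gap z) -[leLHS]expR0 ler_expR.
Qed.

Lemma bl_inequality : (\int[mu2]_z (J z)%:E <= D%:E)%E.
Proof.
apply: le_trans bl_integral_prod; apply: ge0_le_integral => //.
- by move=> z _; rewrite lee_fin.
- by apply/measurable_EFinP; exact: mJ.
- by move=> z _; rewrite lee_fin.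
Qed.

(* In the equality case the exponential gain of [bl_integrand] is lost. *)
Lemma bl_equality : (D%:E <= \int[mu2]_z (J z)%:E)%E ->
  {ae mu2, forall z : R * R, 0 < F z.1 -> 0 < G z.2 -> 0 < H (comb z.1 z.2) ->
    transport H rho (comb z.1 z.2) = comb (transport F rho z.1) (transport G rho z.2)}.
Proof.
move=> DJ; have mp : measurable_fun [set: R * R] phi by exact: measurable_bl_integrand.
have md : measurable_fun [set: R * R] (fun z => (phi z - J z)%:E).
  by apply/measurable_EFinP; exact: measurable_funB.
have JE : (\int[mu2]_z (J z)%:E = D%:E)%E.
  by apply/eqP; rewrite eq_le DJ bl_inequality.
have : (\int[mu2]_z `|(phi z - J z)%:E| = 0)%E.
  have : (\int[mu2]_z (J z)%:E + \int[mu2]_z (phi z - J z)%:E <= D%:E)%E.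
    rewrite -ge0_integralD//.
    - by under eq_integral do rewrite -EFinD subrKC; exact: bl_integral_prod.
    - by move=> z _; rewrite lee_fin.
    - exact/measurable_EFinP.
    - by move=> z _; rewrite lee_fin subr_ge0.
  rewrite JE -[leRHS]adde0 leeD2lE// => h.
  under eq_integral do rewrite abse_EFin ger0_norm ?subr_ge0//.
  apply/eqP; rewrite eq_le h; apply: integral_ge0 => z _.
  by rewrite lee_fin subr_ge0.
move=> /((ae_eq_integral_abs mu2 measurableT md).1).
apply: filterS => z /(_ I)/= [/eqP]; rewrite subr_eq0 => /eqP E F0 G0 H0.
have J0 : 0 < J z by rewrite /J !mulr_gt0// powR_gt0.
have /expR_inj/eqP : expR (gap z) = expR 0.
  by apply: (mulfI (lt0r_neq0 J0)); rewrite expR0 mulr1.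
have [[_ _ c30] [s0 s'0 _] [_ _ c31] _ [E3 _ _]] := blP.
have [[c10 c20 _] _ _ _ _] := blP.
have c3' : 0 < 1 - c3 by rewrite -E3 !mulr_gt0// exprn_gt0.
rewrite /gap mulf_eq0 gt_eqF ?divr_gt0 ?mulr_gt0//= expf_eq0/= subr_eq0.
by move=> /eqP.
Qed.

End brascamp_lieb_density.

(** * Equality forces Gaussian densities *)

Section upper_quantile.
Context {R : realType}.
Notation mu := (@lebesgue_measure R).
Variables (K : R -> R).
Hypothesis dK : density K.

Let pr := @pdensity_normal R.

Let rho01 (a : R) : 0 < dist rho a < 1.
Proof. by have [dr _ r0] := pr; exact: dist_gt0_lt1. Qed.

(** Where [K] vanishes on an interval a level set of [dist K] is not a single point. Its right end
    is chosen, because [K] is positive on sets of positive measure immediately to the right of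
    it. *)
Definition upper_quantile (a : R) := sup [set x | dist K x <= dist rho a].

Lemma upper_quantile_has_sup a : has_sup [set x | dist K x <= dist rho a].
Proof.
have /andP[a0 a1] := rho01 a; split.
  by have [x h] := dist_near0 dK a0; exists x => /=; exact: ltW.
have [y] := dist_near1 dK (ltac:(by rewrite subr_gt0) : 0 < 1 - dist rho a).
rewrite opprB subrKC => ay; exists y => x /= xa.
by rewrite leNgt; apply/negP => /ltW /(dist_nd dK) yx; move: (lt_le_trans ay yx); rewrite ltNge xa.
Qed.

Lemma upper_quantile_lt a x : upper_quantile a < x -> dist rho a < dist K x.
Proof.
move=> ux; rewrite ltNge; apply/negP => h.
by have := ub_le_sup (upper_quantile_has_sup a).2 h; rewrite leNgt ux.
Qed.

Lemma dist_upper_quantile a : dist K (upper_quantile a) = dist rho a.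
Proof.
have hs := upper_quantile_has_sup a.
apply/eqP; rewrite eq_le; apply/andP; split.
  rewrite leNgt; apply/negP => h.
  have cK : continuous (dist K) by exact: dist_continuous.
  have /cvgrPdist_lt := cK (upper_quantile a).
  move=> /(_ (dist K (upper_quantile a) - dist rho a)); rewrite subr_gt0 => /(_ h).
  move=> /nbhs_ballP[e /= e0 he].
  have [x /= xa ux] := sup_adherent e0 hs.
  have xu : x <= upper_quantile a by exact: (ub_le_sup hs.2 xa).
  have := he x; rewrite /ball/= ger0_norm ?subr_ge0// => /(_ ltac:(rewrite ltrBlDr -ltrBlDl; exact: ux)).
  by rewrite ger0_norm ?subr_ge0 ?dist_nd//; lra.
have [x xa] := dist_ivt dK (rho01 a).
rewrite -xa; apply: dist_nd => //; apply: (ub_le_sup hs.2).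
by rewrite /= xa.
Qed.

(** Past the upper quantile [dist K] exceeds its level, so [K] cannot vanish almost everywhere on an
    interval that starts there. *)
Lemma upper_quantile_near a e : 0 < e ->
  (0 < mu (`]upper_quantile a, (upper_quantile a + e)%R] `&` [set x | (0 < K x)%R]))%E.
Proof.
move=> e0; have [mK K0 _] := dK.
set E := `]_, _]%classic.
have mE : measurable E by exact: measurable_itv.
have mP : measurable [set x | 0 < K x].
  rewrite (_ : [set x | _] = [set: R] `&` K @^-1` `]0, +oo[%classic).
    exact: (mK measurableT _ (measurable_itv _)).
  by apply/seteqP; split => x /=; rewrite in_itv/= andbT; [split|case].
rewrite lt_neqAle measure_ge0 andbT eq_sym; apply/eqP => m0.
have : (\int[mu]_(x in E) (K x)%:E = 0)%E.
  rewrite (@ge0_negligible_integral _ _ _ mu E (E `&` [set x | 0 < K x])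
    (fun x => (K x)%:E) (measurableI _ _ mE mP)) //.
  - rewrite integral0_eq// => x [Ex /= h].
    apply/eqP; rewrite eqe eq_le K0 andbT leNgt; apply/negP => Kx.
    by apply: h.
  - by apply: measurable_funTS; exact/measurable_EFinP.
  - by move=> x _; rewrite lee_fin.
rewrite dist_sub ?lerDl ?(ltW e0)// => -[/eqP]; rewrite subr_eq0 dist_upper_quantile.
by apply/negP; rewrite gt_eqF// upper_quantile_lt// ltrDl.
Qed.

End upper_quantile.

Section equality.
Context {R : realType}.
Notation mu := (@lebesgue_measure R).
Variables (c1 c2 c3 s s' D : R).
Hypothesis blP : bl_parameters c1 c2 c3 s s' D.
Variables F G H : R -> R.
Hypotheses (dF : density F) (dG : density G) (dH : density H).

Let comb := bl_comb s s' D.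

Hypothesis posH : {ae mu2, forall z : R * R,
  0 < F z.1 -> 0 < G z.2 -> 0 < H (comb z.1 z.2)}.
Hypothesis eqJ : (D%:E <= \int[mu2]_z
  (F z.1 `^ c1 * G z.2 `^ c2 * H (comb z.1 z.2) `^ c3)%:E)%E.

Let pr := @pdensity_normal R.

(** The relation between the transports holds almost everywhere on {F > 0} x {G > 0}. Composed with
    [dist rho] it involves only functions continuous at the point in question, so it extends to the
    pair of upper quantiles as a limit of points where it holds. *)
Lemma dist_comb_upper_quantile a b :
  dist H (comb (upper_quantile F a) (upper_quantile G b)) = dist rho (comb a b).
Proof.
have [dr cr r0] := pr.
have aeP : {ae mu2, forall z : R * R, 0 < F z.1 -> 0 < G z.2 ->
    dist H (comb z.1 z.2) = dist rho (comb (transport F rho z.1) (transport G rho z.2))}.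
  apply: filterS3 (bl_equality blP dF dG dH eqJ) posH (ae_bl_good blP dF dG dH).
  move=> z h1 h2 [g1 g2 g3] Fz Gz; have Hz := h2 Fz Gz.
  rewrite /comb -(h1 Fz Gz Hz) /transport dist_quantile//.
  exact: (good_dist_gt0_lt1 dH g3).
(* Such points exist because [F] and [G] are positive on sets of positive measure just to the right
   of the upper quantiles, and the product of two such sets is not null. *)
have pts n : exists z : R * R, [/\ upper_quantile F a < z.1 <= upper_quantile F a + n.+1%:R^-1,
    upper_quantile G b < z.2 <= upper_quantile G b + n.+1%:R^-1 &
    dist H (comb z.1 z.2) = dist rho (comb (transport F rho z.1) (transport G rho z.2))].
  have e0 : 0 < n.+1%:R^-1 :> R by rewrite invr_gt0.
  have mA := upper_quantile_near dF a e0; have mB := upper_quantile_near dG b e0.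
  apply: contrapT => hn; case: aeP => N [mN N0 NP].
  set A := (X in (0 < mu X)%E) in mA; set B := (X in (0 < mu X)%E) in mB.
  have meas (K : R -> R) u v : density K ->
      measurable (`]u, v] `&` [set x | (0 < K x)%R]).
    move=> [mK _ _]; apply: measurableI => //.
    rewrite (_ : [set x | _] = [set: R] `&` K @^-1` `]0, +oo[%classic).
      exact: (mK measurableT _ (measurable_itv _)).
    by apply/seteqP; split => x /=; rewrite in_itv/= andbT; [split|case].
  have : (mu2 (A `*` B) <= mu2 N)%E.
    apply: le_measure; rewrite ?inE; [|exact: mN|].
      by apply: measurableX; exact: meas.
    move=> z [[h1 h2] [h3 h4]]; apply: NP => /= /(_ h2 h4) h; apply: hn.
    by exists z; split => //; move: h1 h3; rewrite /= !in_itv.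
  have -> : mu2 (A `*` B) = (mu A * mu B)%E.
    by apply: product_measure1E; exact: meas.
  have -> : mu2 N = 0%E by [].
  by rewrite leNgt mule_gt0.
pose z n := sval (cid (pts n)).
have z1 n : upper_quantile F a < (z n).1 <= upper_quantile F a + n.+1%:R^-1.
  by have [] := svalP (cid (pts n)).
have z2 n : upper_quantile G b < (z n).2 <= upper_quantile G b + n.+1%:R^-1.
  by have [] := svalP (cid (pts n)).
have zE n : dist H (comb (z n).1 (z n).2) =
    dist rho (comb (transport F rho (z n).1) (transport G rho (z n).2)).
  have [_ _ h] := svalP (cid (pts n)); exact: h.
have sq (u : R^nat) l : (forall n, l < u n <= l + n.+1%:R^-1) -> u n @[n --> \oo] --> l.
  move=> hu; apply: (@squeeze_cvgr _ _ _ _ (fun=> l) (fun n => l + n.+1%:R^-1)).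
  - by near=> n; have /andP[/ltW -> ->] := hu n.
  - exact: cvg_cst.
  - rewrite -[X in _ --> X]addr0; apply: cvgD; first exact: cvg_cst.
    exact: cvg_harmonic.
have cz1 := sq _ _ z1; have cz2 := sq _ _ z2.
have ccomb (u v : R^nat) (k l : R) : u n @[n --> \oo] --> k -> v n @[n --> \oo] --> l ->
    comb (u n) (v n) @[n --> \oo] --> comb k l.
  move=> cu cv; apply: cvgM; last exact: cvg_cst.
  by apply: cvgB; apply: cvgM => //; exact: cvg_cst.
have ct (K : R -> R) (u : R^nat) c : density K -> u n @[n --> \oo] --> upper_quantile K c ->
    transport K rho (u n) @[n --> \oo] --> c.
  move=> dK cu; have c01 : 0 < dist rho c < 1 by exact: dist_gt0_lt1.
  rewrite -[X in _ --> X](quantile_dist c pr).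
  have [/derivable1_diffP /differentiable_continuous cQ _] := quantile_is_derive pr c01.
  have cd : dist K (u n) @[n --> \oo] --> dist rho c.
    rewrite -(dist_upper_quantile dK).
    by apply: continuous_cvg => //; exact: dist_continuous.
  exact: (continuous_cvg _ cQ cd).
have l1 : dist H (comb (z n).1 (z n).2) @[n --> \oo] -->
    dist H (comb (upper_quantile F a) (upper_quantile G b)).
  by apply: continuous_cvg; [exact: dist_continuous|exact: ccomb].
have l2 : dist H (comb (z n).1 (z n).2) @[n --> \oo] --> dist rho (comb a b).
  under eq_fun do rewrite zE.
  apply: continuous_cvg; first exact: dist_continuous.
  by apply: ccomb; exact: ct.
exact: (cvg_unique _ l1 l2).
Unshelve. all: end_near. Qed.

(** After rescaling by s' and s, [comb] becomes a difference divided by [D]. As [dist rho] is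
    strictly increasing and [dist H] nondecreasing, the rescaled quantiles preserve the strict order
    of differences, which is the premise of [order_pexider]. *)
Lemma bl_equality_gaussian : exists k e1 e2 : R, [/\ 0 < k,
  forall x, dist F x = dist rho (k * (x - e1)) &
  forall x, dist G x = dist rho (k * (x - e2))].
Proof.
have [dr _ r0] := pr; have [_ [s0 s'0 D0] _ _ _] := blP.
have [|k [e1 [e2 [k0 fE gE]]]] := @order_pexider R
  (fun x => s' * upper_quantile F (x / s')) (fun y => s * upper_quantile G (y / s)).
  move=> x y x' y' xy.
  have cE (u v : R) : comb (u / s') (v / s) = (u - v) / D.
    by rewrite /comb /bl_comb !(mulrC _ (_ / _)) !divfK// gt_eqF.
  have : dist rho (comb (x / s') (y / s)) < dist rho (comb (x' / s') (y' / s)).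
    by apply: dist_lt => //; rewrite !cE ltr_pM2r ?invr_gt0.
  rewrite -!dist_comb_upper_quantile => h.
  rewrite ltNge; apply/negP => h2; move: h; apply/negP; rewrite -leNgt.
  by apply: (dist_nd dH); rewrite ler_pM2r ?invr_gt0.
(* The upper quantiles are a -> k a + e1 / s' and a -> k a + e2 / s; evaluating them at the level
   whose quantile is [x] inverts these maps. *)
exists k^-1, (e1 / s'), (e2 / s); split => [|x|x]; first by rewrite invr_gt0.
- rewrite -(dist_upper_quantile dF); congr dist.
  have h t : s' * upper_quantile F t = k * (s' * t) + e1.
    by rewrite -fE; congr (_ * upper_quantile F _); field; rewrite gt_eqF.
  apply: (mulfI (lt0r_neq0 s'0)); rewrite h.
  by field; rewrite !gt_eqF.
- rewrite -(dist_upper_quantile dG); congr dist.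
  have h t : s * upper_quantile G t = k * (s * t) + e2.
    by rewrite -gE; congr (_ * upper_quantile G _); field; rewrite gt_eqF.
  apply: (mulfI (lt0r_neq0 s0)); rewrite h.
  by field; rewrite !gt_eqF.
Qed.

End equality.

Lemma dist_gaussian_ae (R : realType) (F : R -> R) k e : density F -> 0 < k ->
  (forall x, dist F x = dist rho (k * (x - e))) ->
  {ae @lebesgue_measure R, forall x, F x = k * rho (k * (x - e))}.
Proof.
move=> dF k0 FE; have [dr cr _] := @pdensity_normal R.
apply: filterS (dist_ae_derive dF) => x [_ <-].
rewrite (_ : dist F = dist rho \o (fun x => k * (x - e))); last exact/funext.
rewrite derive1E.
have h1 : is_derive x (1 : R) (fun x : R => k * (x - e)) k.
  have h := is_deriveZ k (is_deriveB (is_derive_id x (1 : R)) (is_derive_cst e x 1)).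
  by apply: (is_derive_eq h); rewrite subr0 /GRing.scale/= mulr1.
have h2 := dist_is_derive dr (cr (k * (x - e))).
by have [_ ->] := is_derive1_comp (g := fun x : R => k * (x - e)) h2 h1; rewrite mulrC.
Qed.

(** * Functions in Lebesgue spaces of the Gaussian measure *)

Section gamma.
Context {R : realType}.
Notation mu := (@lebesgue_measure R).
Local Open Scope ereal_scope.
Import HBNNSimple.

Lemma gammaE (A : set (measurableTypeR R)) :
  gamma R A = \int[mu]_(x in A) (rho x)%:E.
Proof. by []. Qed.

Let integral_gamma_nnsfun (f : {nnsfun measurableTypeR R >-> R}) :
  \int[gamma R]_x (f x)%:E = \int[mu]_x ((f x)%:E * (rho x)%:E).
Proof.
have mr : measurable_fun [set: R] (EFin \o (rho : R -> R)).
  by apply/measurable_EFinP; exact: measurable_normal_pdf.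
transitivity (\sum_(k \in range f) (k%:E * gamma R (f @^-1` [set k]))).
  under eq_integral do rewrite fimfunE -fsumEFin//.
  rewrite ge0_integral_fsum//; last 2 first.
    by move=> r; exact/measurable_EFinP/measurableT_comp.
    by move=> n x _; rewrite EFinM nnfun_muleindic_ge0.
  apply: eq_fsbigr => r _.
  by rewrite integralZl_indic_nnsfun// integral_indic// setIT.
under [RHS]eq_integral.
  move=> x _; rewrite fimfunE -fsumEFin// ge0_mule_fsuml; last first.
    by move=> r; rewrite EFinM nnfun_muleindic_ge0.
  over.
rewrite ge0_integral_fsum//; last 2 first.
- move=> r; apply: emeasurable_funM => //.
  exact/measurable_EFinP/measurableT_comp.
- move=> r x _; apply: mule_ge0; last by rewrite lee_fin normal_pdf_ge0.
  by rewrite EFinM nnfun_muleindic_ge0.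
apply: eq_fsbigr => r rf.
have r0 : (0 <= r)%R by move: rf; rewrite inE/= => -[x _ <-].
rewrite gammaE -ge0_integralZl_EFin//; first last.
- exact: measurable_funTS.
- by move=> x _; rewrite lee_fin normal_pdf_ge0.
rewrite integral_mkcond; apply: eq_integral => x _; rewrite /patch /indic.
by case: ifP => _; rewrite ?mulr1 ?mulr0 ?mul0e.
Qed.

Lemma ge0_integral_gamma (f : R -> \bar R) :
  measurable_fun [set: R] f -> (forall x, 0 <= f x) ->
  \int[gamma R]_x f x = \int[mu]_x (f x * (rho x)%:E).
Proof.
move=> mf f0.
pose f_ := @nnsfun_approx _ (measurableTypeR R) _ _ measurableT _ mf.
have mr : measurable_fun [set: R] (EFin \o (rho : R -> R)).
  by apply/measurable_EFinP; exact: measurable_normal_pdf.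
have ndf x m n : (m <= n)%N -> (f_ m x)%:E <= (f_ n x)%:E.
  move=> mn; rewrite lee_fin; move: x; apply/lefP.
  exact: (@nd_nnsfun_approx _ (measurableTypeR R) _ _ measurableT _ mf _ _ mn).
have mfn n : measurable_fun [set: measurableTypeR R] (fun x => (f_ n x)%:E).
  exact/measurable_EFinP/measurable_funTS.
transitivity (lim (\int[gamma R]_x (f_ n x)%:E @[n --> \oo])).
  rewrite -monotone_convergence//=.
  - apply: eq_integral => x _; apply/esym/cvg_lim => //=.
    exact: cvg_nnsfun_approx.
  - by move=> n x _; rewrite lee_fin.
  - by move=> x _ m n mn; exact: ndf.
rewrite [RHS](_ : _ = lim (\int[mu]_x ((f_ n x)%:E * (rho x)%:E) @[n --> \oo])).
  by apply: congr_lim; apply/funext => n /=; exact: integral_gamma_nnsfun.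
rewrite -monotone_convergence//=.
- apply: eq_integral => x _; apply/esym/cvg_lim => //=.
  apply: cvgeZr => //; exact: cvg_nnsfun_approx.
- by move=> n; exact: emeasurable_funM.
- by move=> n x _; rewrite mule_ge0// lee_fin// normal_pdf_ge0.
- move=> x _ m n mn; apply: lee_wpmul2r; first by rewrite lee_fin normal_pdf_ge0.
  exact: ndf.
Qed.

Lemma gamma_eq0 (A : set (measurableTypeR R)) : measurable A ->
  gamma R A = 0 <-> mu A = 0.
Proof.
move=> mA; split; last first.
  by move=> A0; exact: (null_content_dominatesP _ _).1 (@normal_prob_dominates R 0 1) A mA A0.
rewrite gammaE; have mr : measurable_fun A (EFin \o (rho : R -> R)).
  by apply: measurable_funTS; apply/measurable_EFinP; exact: measurable_normal_pdf.
under eq_integral => x _.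
  rewrite -[rho x]ger0_norm ?normal_pdf_ge0// -abse_EFin; over.
move=> /((ae_eq_integral_abs mu mA mr).1)[N [mN N0 NP]].
apply/eqP; rewrite eq_le measure_ge0 andbT -N0.
apply: le_measure; rewrite ?inE//; apply: subset_trans NP => x Ax /= /(_ Ax).
by apply/eqP; rewrite eqe gt_eqF// rho_gt0.
Qed.

Lemma ae_gammaP (P : R -> Prop) :
  {ae gamma R, forall x, P x} <-> {ae mu, forall x, P x}.
Proof.
by split=> -[N [mN N0 NP]]; exists N; split => //; exact/gamma_eq0.
Qed.

End gamma.
#[global] Instance gamma_filter (R : realType) : Filter (almost_everywhere (gamma R)).
Proof. exact: ae_filter_ringOfSetsType. Qed.

(** * The product as a trilinear form on the plane *)

Section bl_product.
Context {R : realType}.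
Notation mu := (@lebesgue_measure R).
Variables c1 c2 c3 s s' D : R.
Hypothesis blP : bl_parameters c1 c2 c3 s s' D.

(** The scalar products of (x, y) with u1 and, for [bl_right], with u2. The cosines are expressed
    through the parameters, which makes the identities below polynomial. *)
Definition bl_left x y := c2 * D * s' * x + s * y.
Definition bl_right x y := - (c1 * D * s) * x + s' * y.

Let c10 : 0 < c1. Proof. by case: blP => -[]. Qed.
Let c20 : 0 < c2. Proof. by case: blP => -[]. Qed.
Let c30 : 0 < c3. Proof. by case: blP => -[]. Qed.
Let s0 : 0 < s. Proof. by case: blP => _ []. Qed.
Let s'0 : 0 < s'. Proof. by case: blP => _ []. Qed.
Let D0 : 0 < D. Proof. by case: blP => _ []. Qed.

Lemma bl_comb_left_right x y : bl_comb s s' D (bl_left x y) (bl_right x y) = x.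
Proof.
have [_ _ _ Es _] := blP; rewrite /bl_comb /bl_left /bl_right.
rewrite (_ : _ - _ = D * (c1 * s ^+ 2 + c2 * s' ^+ 2) * x); last by ring.
by rewrite Es mulr1 mulrAC divff ?mul1r// gt_eqF.
Qed.

Lemma bl_left_right_sqr x y :
  c1 * bl_left x y ^+ 2 + c2 * bl_right x y ^+ 2 + c3 * x ^+ 2 = x ^+ 2 + y ^+ 2.
Proof.
have [_ _ _ Es [E3 _ _]] := blP.
have -> : c1 * bl_left x y ^+ 2 + c2 * bl_right x y ^+ 2 + c3 * x ^+ 2 =
  (c1 * c2 * D ^+ 2 * (c1 * s ^+ 2 + c2 * s' ^+ 2) + c3) * x ^+ 2 +
  (c1 * s ^+ 2 + c2 * s' ^+ 2) * y ^+ 2.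
  by rewrite /bl_left /bl_right; ring.
by rewrite Es E3; ring.
Qed.

Lemma rho_powR (x c : R) : rho x `^ c = expR (c * (ln (normal_peak 1) - x ^+ 2 / 2)).
Proof. by rewrite /powR gt_eqF ?rho_gt0// rhoE expRK. Qed.

(** The decomposition of the identity, evaluated at (x, y), splits the Gaussian weight of the plane
    into powers of the three normal weights; these are then absorbed into [bl_weight]. *)
Lemma rho_left_right x y :
  rho (bl_left x y) `^ c1 * rho (bl_right x y) `^ c2 * rho x `^ c3 = rho x * rho y.
Proof.
rewrite !rho_powR !rhoE -!expRD; congr expR.
have h := bl_left_right_sqr x y; have h2 := bl_sum blP.
set L := ln _.
rewrite (_ : L - x ^+ 2 / 2 + (L - y ^+ 2 / 2) =
  (c1 + c2 + c3) * L - (x ^+ 2 + y ^+ 2) / 2); last by rewrite h2; lra.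
by rewrite -h; lra.
Qed.

Lemma bl_det : c2 * D * s' * s' - s * - (c1 * D * s) = D.
Proof.
have [_ _ _ Es _] := blP.
rewrite (_ : _ - _ = D * (c1 * s ^+ 2 + c2 * s' ^+ 2)); last by ring.
by rewrite Es mulr1.
Qed.

Let m1 := @measurable_fst _ _ (measurableTypeR R) (measurableTypeR R).
Let m2 := @measurable_snd _ _ (measurableTypeR R) (measurableTypeR R).

Let measurable_linear2 (a b : R) :
  measurable_fun [set: R * R] (fun z : R * R => a * z.1 + b * z.2).
Proof. by apply: measurable_funD; apply: measurable_funM. Qed.

Section fixed_functions.
Variables f g : R -> R.
Hypotheses (mf : measurable_fun [set: R] f) (mg : measurable_fun [set: R] g).
Hypotheses (f0 : forall x, 0 <= f x) (g0 : forall x, 0 <= g x).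

Definition bl_product x :=
  (\int[gamma R]_y (f (bl_left x y) * g (bl_right x y))%:E)%E.

Lemma measurable_bl_factors : measurable_fun [set: R * R]
  (fun z : R * R => f (bl_left z.1 z.2) * g (bl_right z.1 z.2)).
Proof.
apply: measurable_funM.
- exact: (measurableT_comp mf (measurable_linear2 _ _)).
- exact: (measurableT_comp mg (measurable_linear2 _ _)).
Qed.

Lemma measurable_bl_factors_at x : measurable_fun [set: R]
  (fun y : R => (f (bl_left x y) * g (bl_right x y))%:E).
Proof.
apply/measurable_EFinP; have := measurableT_comp measurable_bl_factors
  (@pair1_measurable _ _ (measurableTypeR R) (measurableTypeR R) x).
exact.
Qed.

Lemma bl_product_ge0 x : (0 <= bl_product x)%E.
Proof. by apply: integral_ge0 => y _; rewrite lee_fin mulr_ge0. Qed.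

Lemma bl_productE x :
  bl_product x = (\int[mu]_y (f (bl_left x y) * g (bl_right x y) * rho y)%:E)%E.
Proof.
rewrite /bl_product ge0_integral_gamma; first by [].
- exact: measurable_bl_factors_at.
- by move=> y; rewrite lee_fin mulr_ge0.
Qed.

Let measurable_bl_density : measurable_fun [set: R * R]
  (fun z : R * R => f (bl_left z.1 z.2) * g (bl_right z.1 z.2) * rho z.2).
Proof.
apply: measurable_funM; first exact: measurable_bl_factors.
exact: (measurableT_comp (@measurable_normal_pdf R 0 1) m2).
Qed.

Lemma measurable_bl_product : measurable_fun [set: R] bl_product.
Proof.
rewrite (_ : bl_product = fun x => (\int[mu]_y (f (bl_left x y) * g (bl_right x y) * rho y)%:E)%E).
  apply: (@measurable_fun_fubini_tonelli_F _ _ _ _ _ mu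
    (fun z : R * R => (f (bl_left z.1 z.2) * g (bl_right z.1 z.2) * rho z.2)%:E)).
    exact/measurable_EFinP.
  by move=> z; rewrite lee_fin mulr_ge0 ?mulr_ge0// normal_pdf_ge0.
by apply/funext => x; exact: bl_productE.
Qed.

End fixed_functions.

(** With c = 1 / p and [A] the integral of f^p against the Gaussian measure, this is the Lebesgue
    density of the normalized measure f^p dgamma / A. *)
Definition bl_weight (c A : R) (f : R -> R) t := f t `^ c^-1 * rho t / A.

Lemma bl_weight_ge0 (c A : R) f t : 0 < A -> 0 <= bl_weight c A f t.
Proof.
by move=> A0; apply: divr_ge0; [rewrite mulr_ge0 ?powR_ge0 ?normal_pdf_ge0|exact: ltW].
Qed.

Lemma measurable_bl_weight (c A : R) (f : R -> R) : measurable_fun [set: R] f ->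
  measurable_fun [set: R] (bl_weight c A f).
Proof.
move=> mf; apply: measurable_funM => //; apply: measurable_funM.
  have mp : measurable_fun [set: R] (@powR R ^~ c^-1) by exact: measurable_powR.
  exact: (measurableT_comp mp mf).
exact: measurable_normal_pdf.
Qed.

Lemma bl_weight_powR (c A : R) (f : R -> R) t : 0 < c -> 0 < A -> 0 <= f t ->
  bl_weight c A f t `^ c = f t * rho t `^ c / A `^ c.
Proof.
move=> c0 A0 ft; rewrite /bl_weight !powRM ?mulr_ge0 ?powR_ge0 ?normal_pdf_ge0 ?invr_ge0 ?(ltW A0)//.
rewrite -powRrM mulVf ?gt_eqF// powRr1//; congr (_ * _).
by rewrite -powR_inv1 ?(ltW A0)// -powRrM mulN1r powRN.
Qed.

(** The change of variables (x, y) -> (z.u1, z.u2) has determinant [D], and x is recovered as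
    [bl_comb] of the new variables. *)
Lemma bl_product_trilinear (f g h : R -> R) (A B C : R) :
  measurable_fun [set: R] f -> measurable_fun [set: R] g -> measurable_fun [set: R] h ->
  (forall x, 0 <= f x) -> (forall x, 0 <= g x) -> (forall x, 0 <= h x) ->
  0 < A -> 0 < B -> 0 < C ->
  (D%:E * \int[gamma R]_x ((h x)%:E * bl_product f g x) =
   (A `^ c1 * B `^ c2 * C `^ c3)%:E * \int[mu2]_z
     (bl_weight c1 A f z.1 `^ c1 * bl_weight c2 B g z.2 `^ c2 *
      bl_weight c3 C h (bl_comb s s' D z.1 z.2) `^ c3)%:E)%E.
Proof.
move=> mf mg mh f0 g0 h0 A0 B0 C0.
pose J (z : R * R) := (bl_weight c1 A f z.1 `^ c1 * bl_weight c2 B g z.2 `^ c2 *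
  bl_weight c3 C h (bl_comb s s' D z.1 z.2) `^ c3)%:E.
rewrite -/(J _).
set M := _ * _ * _.
have M0 : 0 < M by rewrite !mulr_gt0// powR_gt0.
have J0 z : (0 <= (J z))%E by rewrite /J lee_fin !mulr_ge0// powR_ge0.
have mJE : measurable_fun [set: R * R] J.
  by apply/measurable_EFinP; apply: measurable_bl_powers; exact: measurable_bl_weight.
have mV := measurable_bl_product mf mg f0 g0.
have V0 := bl_product_ge0 f0 g0.
have mhE : measurable_fun [set: R] (EFin \o h) by exact/measurable_EFinP.
have hV0 x : (0 <= (h x)%:E * bl_product f g x)%E by rewrite mule_ge0// lee_fin.
rewrite (ge0_integral_gamma (emeasurable_funM mhE mV) hV0).
rewrite (integral_mu2 mJE J0).
rewrite (@ge0_integral_linear2 R (c2 * D * s') s (- (c1 * D * s)) s' J _ _ mJE J0); last 2 first.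
- by rewrite gt_eqF.
- by rewrite bl_det gt_eqF.
rewrite bl_det (gtr0_norm D0) muleCA; congr (_ * _)%E.
have mF : measurable_fun [set: R * R] (fun z => J (bl_left z.1 z.2, bl_right z.1 z.2)).
  apply: (measurableT_comp mJE); apply: measurable_fun_pair => /=; exact: measurable_linear2.
rewrite -ge0_integralZl_EFin; [|by []| |..|exact: ltW]; last 2 first.
- by move=> x _; apply: integral_ge0 => y _; exact: J0.
- apply: (@measurable_fun_fubini_tonelli_F _ _ _ _ _ mu _ mF) => z; exact: J0.
apply: eq_integral => x _.
have mJx : measurable_fun [set: R] (fun y => J (bl_left x y, bl_right x y)).
  by have := measurableT_comp mF (@pair1_measurable _ _ (measurableTypeR R) (measurableTypeR R) x).
rewrite -[RHS]ge0_integralZl_EFin; [|by []|by move=> y _; exact: J0|exact: mJx|exact: ltW].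
rewrite (bl_productE mf mg f0 g0) muleAC -EFinM -ge0_integralZl_EFin; last 4 first.
- by [].
- by move=> y _; rewrite lee_fin !mulr_ge0// normal_pdf_ge0.
- apply/measurable_EFinP.
  have := measurableT_comp (measurable_funM (measurable_bl_factors mf mg)
    (measurableT_comp (@measurable_normal_pdf R 0 1) m2))
    (@pair1_measurable _ _ (measurableTypeR R) (measurableTypeR R) x).
  by apply.
- by rewrite mulr_ge0// normal_pdf_ge0.
apply: eq_integral => y _; rewrite /J /= -EFinM -EFinM bl_comb_left_right; congr (_%:E).
rewrite !bl_weight_powR// /M.
have [a0 b0 c0] : [/\ A `^ c1 != 0, B `^ c2 != 0 & C `^ c3 != 0].
  by rewrite !gt_eqF ?powR_gt0.
have e := rho_left_right x y.
transitivity (h x * f (bl_left x y) * g (bl_right x y) * (rho x * rho y)); first by ring.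
rewrite -e -/(bl_left x y) -/(bl_right x y).
move: (A `^ c1) (B `^ c2) (C `^ c3) a0 b0 c0 => u v w u0 v0 w0.
move: (rho _ `^ c1) (rho _ `^ c2) (rho _ `^ c3) (f _) (g _) (h _) => r1 r2 r3 k1 k2 k3.
by field; rewrite u0 v0 w0.
Qed.

End bl_product.

(** * The bound in L^q by duality *)

Section bl_product_norm.
Context {R : realType}.
Notation mu := (@lebesgue_measure R).
Variables c1 c2 c3 s s' D : R.
Hypothesis blP : bl_parameters c1 c2 c3 s s' D.

Let c10 : 0 < c1. Proof. by case: blP => -[]. Qed.
Let c20 : 0 < c2. Proof. by case: blP => -[]. Qed.
Let c30 : 0 < c3. Proof. by case: blP => -[]. Qed.
Let D0 : 0 < D. Proof. by case: blP => _ []. Qed.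
Let c31 : c3 < 1.
Proof.
by have [_ _ _ _ [E3 _ _]] := blP; rewrite -subr_gt0 -E3 !mulr_gt0// exprn_gt0.
Qed.

Lemma density_bl_weight (c A : R) (f : R -> R) : measurable_fun [set: R] f ->
  0 < A -> (\int[gamma R]_x (f x `^ c^-1)%:E = A%:E)%E -> density (bl_weight c A f).
Proof.
move=> mf A0 fA; split.
- exact: measurable_bl_weight.
- by move=> t; exact: bl_weight_ge0.
have mp : measurable_fun [set: R] (fun t => f t `^ c^-1).
  have mp : measurable_fun [set: R] (@powR R ^~ c^-1) by exact: measurable_powR.
  exact: (measurableT_comp mp mf).
have p0 t : (0 <= (f t `^ c^-1)%:E)%E by rewrite lee_fin powR_ge0.
move: fA; have mpE := (measurable_EFinP _ _).2 mp; rewrite (ge0_integral_gamma mpE p0) => fA.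
transitivity (\int[mu]_x (A^-1%:E * ((f x `^ c^-1)%:E * (rho x)%:E)))%E.
  by apply: eq_integral => x _; rewrite -!EFinM mulrC.
rewrite ge0_integralZl_EFin; last 4 first.
- by [].
- by move=> x _; rewrite mule_ge0// lee_fin normal_pdf_ge0.
- by apply: emeasurable_funM => //; apply/measurable_EFinP; exact: measurable_normal_pdf.
- by rewrite invr_ge0 ltW.
by rewrite fA -EFinM mulVf// gt_eqF.
Qed.

Variables (f g : R -> R) (A B : R).
Hypotheses (mf : measurable_fun [set: R] f) (mg : measurable_fun [set: R] g).
Hypotheses (f0 : forall x, 0 <= f x) (g0 : forall x, 0 <= g x).
Hypotheses (A0 : 0 < A) (B0 : 0 < B).
Hypothesis fA : (\int[gamma R]_x (f x `^ c1^-1)%:E = A%:E)%E.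
Hypothesis gB : (\int[gamma R]_x (g x `^ c2^-1)%:E = B%:E)%E.

Let V := bl_product c1 c2 s s' D f g.
Let M := A `^ c1 * B `^ c2.
Let q := (1 - c3)^-1.

Let M0 : 0 < M. Proof. by rewrite mulr_gt0// powR_gt0. Qed.
Let V0 x : (0 <= V x)%E. Proof. exact: bl_product_ge0. Qed.
Let mV : measurable_fun [set: R] V. Proof. exact: measurable_bl_product. Qed.

Lemma bl_product_dual (h : R -> R) (C : R) : measurable_fun [set: R] h ->
  (forall x, 0 <= h x) -> 0 < C -> (\int[gamma R]_x (h x `^ c3^-1)%:E = C%:E)%E ->
  (\int[gamma R]_x ((h x)%:E * V x) <= (M * C `^ c3)%:E)%E.
Proof.
move=> mh h0 C0 hC.
have dF := density_bl_weight mf A0 fA; have dG := density_bl_weight mg B0 gB.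
have dH := density_bl_weight mh C0 hC.
rewrite -(@lee_pmul2l _ D%:E) ?lte_fin//.
rewrite (bl_product_trilinear blP mf mg mh f0 g0 h0 A0 B0 C0) [leRHS]muleC.
by rewrite lee_pmul2l ?lte_fin// ?bl_inequality// ?mulr_gt0 ?powR_gt0.
Qed.

(** Testing against the power q - 1 of the function itself presupposes a finite q-th moment. The
    truncations have one, being bounded on a probability space. *)
Let t n x := fine (mine (V x) n%:R%:E).

Let tE n x : (t n x)%:E = mine (V x) n%:R%:E.
Proof.
rewrite /t fineK// ge0_fin_numE ?le_min ?V0 ?lee_fin ?ler0n//.
by rewrite gt_min ltry orbT.
Qed.

Let t0 n x : 0 <= t n x.
Proof. by rewrite -lee_fin tE le_min V0 lee_fin ler0n. Qed.

Let tn n x : t n x <= n%:R.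
Proof. by rewrite -lee_fin tE ge_min lexx orbT. Qed.

Let tV n x : ((t n x)%:E <= V x)%E.
Proof. by rewrite tE ge_min lexx. Qed.

Let mt n : measurable_fun [set: R] (t n).
Proof.
apply/measurable_EFinP; rewrite (_ : EFin \o _ = fun x => mine (V x) n%:R%:E).
  exact: measurable_mine.
by apply/funext => x /=; rewrite tE.
Qed.

Let q1 : 1 < q.
Proof. by rewrite /q invf_gt1 ?subr_gt0// gtrBl. Qed.

Let mtq n c : measurable_fun [set: R] (fun x => t n x `^ c).
Proof.
have mp : measurable_fun [set: R] (@powR R ^~ c) by exact: measurable_powR.
exact: (measurableT_comp mp (mt n)).
Qed.

Let bound n : (\int[gamma R]_x (t n x `^ q)%:E <= (M `^ q)%:E)%E.
Proof.
have fin : (\int[gamma R]_x (t n x `^ q)%:E)%E \is a fin_num.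
  rewrite ge0_fin_numE; last by apply: integral_ge0 => x _; rewrite lee_fin powR_ge0.
  have : (\int[gamma R]_x (t n x `^ q)%:E <= \int[gamma R]_x (cst (n%:R `^ q)%:E x))%E.
    apply: ge0_le_integral => //.
    - by move=> x _; rewrite lee_fin powR_ge0.
    - by apply/measurable_EFinP; exact: mtq.
    - by move=> x _; rewrite lee_fin ge0_ler_powR ?nnegrE ?(ltW (lt_trans _ q1))//.
  move=> /le_lt_trans; apply; rewrite integral_cst//.
  rewrite [X in (_ * X)%E](_ : _ = 1%E) ?mule1 ?ltry//.
  by have := @probability_setT _ _ _ (gamma R); apply.
have CE := fineK fin; set C := fine _ in CE.
have : 0 <= C by apply: fine_ge0; apply: integral_ge0 => x _; rewrite lee_fin powR_ge0.
rewrite -CE le_eqVlt => /predU1P[<-|C0]; first by rewrite lee_fin powR_ge0.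
(* From q = 1 / (1 - c3) follows (q - 1) / c3 = q, so h^(1 / c3) is the q-th power of the
   truncation. *)
pose h x := t n x `^ (q - 1).
have hC : (\int[gamma R]_x (h x `^ c3^-1)%:E = C%:E)%E.
  rewrite CE; apply: eq_integral => x _; rewrite /h -powRrM; congr (_ `^ _)%:E.
  by rewrite /q; field; rewrite ?subr_eq0 !gt_eqF.
have hle : (C%:E <= \int[gamma R]_x ((h x)%:E * V x))%E.
  rewrite CE; apply: ge0_le_integral => //.
  - by move=> x _; rewrite lee_fin powR_ge0.
  - by apply/measurable_EFinP; exact: mtq.
  - by apply: emeasurable_funM => //; apply/measurable_EFinP; exact: mtq.
  - move=> x _; rewrite -mulr_powRB1 ?(lt_trans ltr01 q1)// mulrC EFinM.
    by apply: lee_wpmul2l => //; rewrite lee_fin powR_ge0.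
have := le_trans hle (bl_product_dual (mtq n (q - 1)) (fun x => powR_ge0 _ _) C0 hC).
rewrite !lee_fin => CM.
(* The bound C <= M C^c3 is divided by C^c3, which is where [C] must be nonzero; the remaining
   exponent 1 - c3 is 1 / q. *)
have CM' : C `^ (1 - c3) <= M.
  rewrite powRB ?(gt_eqF C0) ?implybT// powRr1 ?(ltW C0)//.
  by rewrite ler_pdivrMr ?powR_gt0.
rewrite [leLHS](_ : C = (C `^ (1 - c3)) `^ q); last first.
  by rewrite -powRrM mulfV ?powRr1 ?(ltW C0)// gt_eqF// subr_gt0.
by rewrite ge0_ler_powR ?nnegrE ?powR_ge0 ?(ltW M0)// ltW// (lt_trans ltr01 q1).
Qed.

Lemma bl_product_power_le : (\int[gamma R]_x (V x `^ q) <= (M `^ q)%:E)%E.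
Proof.
have q0 : 0 < q by exact: lt_trans ltr01 q1.
apply: (@fatou_ae_le _ _ _ (gamma R) _ (fun n x => (t n x `^ q)%:E)).
- exact: (measurableT_comp (measurable_poweR _) mV).
- by move=> n; apply/measurable_EFinP; exact: mtq.
- by move=> x; exact: poweR_ge0.
- by move=> n x; rewrite lee_fin powR_ge0.
- apply: aeW => x; right.
  have := V0 x; case E : (V x) => [v| |//] v0.
    apply: cvg_near_cst; near=> n.
    rewrite /t E min_l//= lee_fin; near: n; exact: nbhs_infty_ger.
  rewrite poweRyr ?gt_eqF//.
  rewrite (_ : (fun n => _) = fun n => (n%:R `^ q)%:E); last first.
    by apply/funext => n; rewrite /t E min_r ?leey.
  apply/cvgeyPge => y; near=> n; rewrite lee_fin.
  have n1 : 1 <= n%:R :> R by near: n; exact: nbhs_infty_ger.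
  apply: (@le_trans _ _ n%:R); first by near: n; exact: nbhs_infty_ger.
  by rewrite -[leLHS]powRr1 ?ler0n// ler_powR// ltW.
- exact: bound.
Unshelve. all: end_near. Qed.

End bl_product_norm.

Section ge0_integral_ae.
Context d (T : measurableType d) (R : realType).
Variables (nu : {measure set T -> \bar R}) (f : T -> \bar R).
Hypotheses (mf : measurable_fun [set: T] f) (f0 : forall x, (0 <= f x)%E).

Lemma ge0_integral_eq0_ae : (\int[nu]_x f x = 0)%E -> {ae nu, forall x, f x = 0%E}.
Proof.
move=> If; have [N [mN N0 NP]] : ae_eq nu [set: T] f (cst 0%E).
  apply/(ae_eq_integral_abs nu measurableT mf); rewrite -[RHS]If.
  by apply: eq_integral => x _; rewrite gee0_abs.
by exists N; split => //; apply: subset_trans NP => x /= nfx /(_ I).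
Qed.

Lemma ge0_integral_lty_ae : (\int[nu]_x f x < +oo)%E ->
  {ae nu, forall x, f x \is a fin_num}.
Proof.
move=> If; have fi : nu.-integrable [set: T] f.
  apply/integrableP; split => //; apply: le_lt_trans If.
  by under eq_integral do rewrite gee0_abs//.
have [N [mN N0 NP]] := integrable_ae measurableT fi.
by exists N; split => //; apply: subset_trans NP => x /= nfx /(_ I).
Qed.

End ge0_integral_ae.

(** * Gaussian densities and equality for nonnegative functions *)

Section gaussian_density.
Context {R : realType}.
Notation mu := (@lebesgue_measure R).

(** For positive [k], the normal density with mean [e] and standard deviation 1 / k. *)
Definition gaussian (k e x : R) := k * rho (k * (x - e)).

Lemma gaussian_ge0 k e x : 0 < k -> 0 <= gaussian k e x.
Proof. by move=> k0; rewrite mulr_ge0 ?normal_pdf_ge0// ltW. Qed.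

Lemma gaussian_powR (k e x c : R) : 0 < k ->
  gaussian k e x `^ c = k `^ c * rho (k * x - k * e) `^ c.
Proof.
move=> k0; rewrite /gaussian powRM; [by rewrite mulrBr|exact: ltW|exact: normal_pdf_ge0].
Qed.

Lemma measurable_gaussian k e : measurable_fun [set: R] (gaussian k e).
Proof.
apply: measurable_funM => //.
apply: (measurableT_comp (@measurable_normal_pdf R 0 1)).
by apply: measurable_funM => //; exact: measurable_funB.
Qed.

Let affine_integral (k b : R) (f : R -> \bar R) : 0 < k ->
  measurable_fun [set: R] f -> (forall x, (0 <= f x)%E) ->
  (\int[mu]_x f x = \int[mu]_x (k%:E * f (k * x + b)%R))%E.
Proof.
move=> k0 mf f0; rewrite (ge0_integral_affine b (lt0r_neq0 k0) mf f0) gtr0_norm//.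
rewrite ge0_integralZl_EFin; [by []|by []|by move=> x _; exact: f0| |exact: ltW].
exact: (measurableT_comp mf (measurable_affine k b)).
Qed.

Lemma integral_gaussian k e : 0 < k -> (\int[mu]_x (gaussian k e x)%:E = 1)%E.
Proof.
move=> k0; have [[mr r0 r1] _ _] := @pdensity_normal R.
have mrE : measurable_fun [set: R] (EFin \o rho : R -> \bar R) by exact/measurable_EFinP.
have r0E (x : R) : (0 <= (EFin \o rho) x)%E by rewrite lee_fin.
rewrite -[RHS]r1 (affine_integral (- (k * e)) k0 mrE r0E).
by apply: eq_integral => x _; rewrite -EFinM /gaussian mulrBr.
Qed.

Lemma ge0_integral_affine2 (k b1 b2 : R) (f : R * R -> \bar R) : 0 < k ->
  measurable_fun [set: R * R] f -> (forall z, (0 <= f z)%E) ->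
  (\int[mu]_x \int[mu]_y f (x, y) =
   \int[mu]_x \int[mu]_y ((k ^+ 2)%:E * f (k * x + b1, k * y + b2)%R))%E.
Proof.
move=> k0 mf f0.
have mfx x : measurable_fun [set: R] (fun y => f (x, y)).
  by have := measurableT_comp mf (@pair1_measurable _ _ (measurableTypeR R) (measurableTypeR R) x).
have mF := @measurable_fun_fubini_tonelli_F _ _ _ _ _ mu _ mf f0.
rewrite (affine_integral b1 k0 mF); last by move=> x; apply: integral_ge0 => y _; exact: f0.
apply: eq_integral => x _; rewrite /fubini_F (affine_integral b2 k0 (mfx _)); last by move=> y; exact: f0.
rewrite -ge0_integralZl_EFin; [|by []| | |exact: ltW].
- by apply: eq_integral => y _; rewrite muleA -EFinM expr2.
- by move=> y _; rewrite mule_ge0// lee_fin ltW.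
- apply: emeasurable_funM => //.
  exact: (measurableT_comp (mfx _) (measurable_affine k b2)).
Qed.

End gaussian_density.

Section bl_product_equality.
Context {R : realType}.
Notation mu := (@lebesgue_measure R).
Variables c1 c2 c3 s s' D : R.
Hypothesis blP : bl_parameters c1 c2 c3 s s' D.

Let c10 : 0 < c1. Proof. by case: blP => -[]. Qed.
Let c20 : 0 < c2. Proof. by case: blP => -[]. Qed.
Let c30 : 0 < c3. Proof. by case: blP => -[]. Qed.
Let s'0 : 0 < s'. Proof. by case: blP => _ []. Qed.
Let D0 : 0 < D. Proof. by case: blP => _ []. Qed.
Let c31 : c3 < 1.
Proof.
by have [_ _ _ _ [E3 _ _]] := blP; rewrite -subr_gt0 -E3 !mulr_gt0// exprn_gt0.
Qed.

(** With a common scale and centres matched by [bl_comb], a translation and a dilation lead back to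
    the normal density; k^(c1 + c2 + c3) = k^2 is the Jacobian. There [rho_left_right] makes the
    integrand a product density. *)
Lemma integral_mu2_gaussian k e1 e2 : 0 < k ->
  (\int[mu2]_z (gaussian k e1 z.1 `^ c1 * gaussian k e2 z.2 `^ c2 *
     gaussian k (bl_comb s s' D e1 e2) (bl_comb s s' D z.1 z.2) `^ c3)%:E = D%:E)%E.
Proof.
move=> k0; have mJ (F G H : R -> R) : measurable_fun [set: R] F -> measurable_fun [set: R] G ->
    measurable_fun [set: R] H -> measurable_fun [set: R * R] (fun z : R * R =>
    (F z.1 `^ c1 * G z.2 `^ c2 * H (bl_comb s s' D z.1 z.2) `^ c3)%:E).
  by move=> mF mG mH; apply/measurable_EFinP; exact: measurable_bl_powers.
have J0 (F G H : R -> R) (z : R * R) :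
    (0 <= (F z.1 `^ c1 * G z.2 `^ c2 * H (bl_comb s s' D z.1 z.2) `^ c3)%:E)%E.
  by rewrite lee_fin !mulr_ge0// powR_ge0.
have mg e := @measurable_gaussian R k e.
have mr := @measurable_normal_pdf R 0 1.
rewrite (integral_mu2 (mJ _ _ _ (mg e1) (mg e2) (mg _)) (J0 _ _ _)).
transitivity (\int[mu]_x \int[mu]_y
    (rho x `^ c1 * rho y `^ c2 * rho (bl_comb s s' D x y) `^ c3)%:E)%E.
  rewrite [RHS](ge0_integral_affine2 (- (k * e1)) (- (k * e2)) k0 (mJ _ _ _ mr mr mr) (J0 _ _ _)).
  apply: eq_integral => x _; apply: eq_integral => y _; rewrite -EFinM; congr _%:E.
  change (gaussian k e1 x `^ c1 * gaussian k e2 y `^ c2 *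
    gaussian k (bl_comb s s' D e1 e2) (bl_comb s s' D x y) `^ c3 =
    k ^+ 2 * (rho (k * x - k * e1) `^ c1 * rho (k * y - k * e2) `^ c2 *
    rho (bl_comb s s' D (k * x - k * e1) (k * y - k * e2)) `^ c3)).
  rewrite !(gaussian_powR _ _ _ k0).
  have -> : k ^+ 2 = k `^ c1 * k `^ c2 * k `^ c3.
    by rewrite -!powRD ?(gt_eqF k0) ?implybT// (bl_sum blP) powR_mulrn// ltW.
  have -> : k * bl_comb s s' D x y - k * bl_comb s s' D e1 e2 =
      bl_comb s s' D (k * x - k * e1) (k * y - k * e2).
    by rewrite /bl_comb; field; rewrite gt_eqF.
  move: (k `^ c1) (k `^ c2) (k `^ c3) (rho _ `^ c1) (rho _ `^ c2) (rho _ `^ c3).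
  by move=> u1 u2 u3 w1 w2 w3; ring.
rewrite (@ge0_integral_linear2 R (c2 * D * s') s (- (c1 * D * s)) s' _ _ _
  (mJ _ _ _ mr mr mr) (J0 _ _ _)); last 2 first.
- by rewrite gt_eqF.
- by rewrite (bl_det blP) gt_eqF.
rewrite (bl_det blP) (gtr0_norm D0) -[RHS]mule1; congr (_ * _)%E.
transitivity (\int[mu]_x \int[mu]_y ((rho x)%:E * (rho y)%:E))%E.
  apply: eq_integral => x _; apply: eq_integral => y _; rewrite -EFinM.
  rewrite -(rho_left_right blP x y).
  change ((rho (bl_left c2 s s' D x y) `^ c1 * rho (bl_right c1 s s' D x y) `^ c2 *
    rho (bl_comb s s' D (bl_left c2 s s' D x y) (bl_right c1 s s' D x y)) `^ c3)%:E =
    (rho (bl_left c2 s s' D x y) `^ c1 * rho (bl_right c1 s s' D x y) `^ c2 *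
    rho x `^ c3)%:E).
  by rewrite (bl_comb_left_right blP).
have [[_ r0 r1] _ _] := @pdensity_normal R.
have mrE : measurable_fun [set: R] (EFin \o rho : R -> \bar R) by exact/measurable_EFinP.
rewrite -[RHS]r1; apply: eq_integral => x _.
rewrite ge0_integralZl_EFin; [by rewrite r1 mule1|by []|by move=> y _; rewrite lee_fin|exact: mrE|exact: r0].
Qed.

Let bl_weight_eq0 (c C : R) (f : R -> R) t : 0 < C -> bl_weight c C f t = 0 -> f t = 0.
Proof.
move=> C0 /eqP; rewrite /bl_weight mulf_eq0 invr_eq0 (gt_eqF C0) orbF.
by rewrite mulf_eq0 (gt_eqF (rho_gt0 t)) orbF => /eqP/powR_eq0_eq0.
Qed.

(** The trilinear identity is taken with all constants equal to 1, as normalization does not affect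
    vanishing. Its left side is 0, so the nonnegative integrand on the plane is 0 almost
    everywhere. *)
Lemma bl_product_eq0_ae (f g h : R -> R) : measurable_fun [set: R] f ->
  measurable_fun [set: R] g -> measurable_fun [set: R] h ->
  (forall x, 0 <= f x) -> (forall x, 0 <= g x) -> (forall x, 0 <= h x) ->
  {ae gamma R, forall x, h x = 0 \/ bl_product c1 c2 s s' D f g x = 0%E} ->
  {ae mu2, forall z : R * R,
    [\/ f z.1 = 0, g z.2 = 0 | h (bl_comb s s' D z.1 z.2) = 0]}.
Proof.
move=> mf mg mh f0 g0 h0 hV0.
have := bl_product_trilinear blP mf mg mh f0 g0 h0 ltr01 ltr01 ltr01.
rewrite [X in (_ * X)%E = _](_ : _ = 0%E); last first.
  rewrite -[RHS](@integral0 _ _ _ (gamma R) [set: R]).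
  apply: ge0_ae_eq_integral; first by [].
  - apply: emeasurable_funM; first exact/measurable_EFinP.
    exact: measurable_bl_product.
  - by [].
  - by move=> x _; rewrite mule_ge0 ?lee_fin//; exact: bl_product_ge0.
  - by [].
  - by apply: filterS hV0 => x [->|->] _; rewrite ?mul0e ?mule0.
rewrite !powR1 !mul1r mule0 mul1e => /esym.
have mJ := measurable_bl_powers c1 c2 c3 s s' D (measurable_bl_weight c1 1 mf)
  (measurable_bl_weight c2 1 mg) (measurable_bl_weight c3 1 mh).
move=> J0; have := @ge0_integral_eq0_ae _ _ _ mu2 _ ((measurable_EFinP _ _).2 mJ) _ J0.
have J0' (z : R * R) : (0 <= (bl_weight c1 1 f z.1 `^ c1 * bl_weight c2 1 g z.2 `^ c2 *
    bl_weight c3 1 h (bl_comb s s' D z.1 z.2) `^ c3)%:E)%E.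
  by rewrite lee_fin !mulr_ge0// powR_ge0.
move=> /(_ J0'); apply: filterS => z /eqP; rewrite eqe.
rewrite mulf_eq0 => /orP[|/eqP/powR_eq0_eq0/(bl_weight_eq0 ltr01)->]; last by constructor 3.
rewrite mulf_eq0 => /orP[] /eqP/powR_eq0_eq0/(bl_weight_eq0 ltr01)->.
- by constructor 1.
- by constructor 2.
Qed.

Variables (f g : R -> R) (A B : R).
Hypotheses (mf : measurable_fun [set: R] f) (mg : measurable_fun [set: R] g).
Hypotheses (f0 : forall x, 0 <= f x) (g0 : forall x, 0 <= g x).
Hypotheses (A0 : 0 < A) (B0 : 0 < B).
Hypothesis fA : (\int[gamma R]_x (f x `^ c1^-1)%:E = A%:E)%E.
Hypothesis gB : (\int[gamma R]_x (g x `^ c2^-1)%:E = B%:E)%E.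

Let V := bl_product c1 c2 s s' D f g.
Let M := A `^ c1 * B `^ c2.
Let q := (1 - c3)^-1.

Let M0 : 0 < M. Proof. by rewrite mulr_gt0// powR_gt0. Qed.
Let V0 x : (0 <= V x)%E. Proof. exact: bl_product_ge0. Qed.
Let mV : measurable_fun [set: R] V. Proof. exact: measurable_bl_product. Qed.
Let q1 : 1 < q.
Proof. by rewrite /q invf_gt1 ?subr_gt0// gtrBl. Qed.
Let q0 : 0 < q. Proof. exact: lt_trans ltr01 q1. Qed.

Let mVq : measurable_fun [set: R] (fun x => (V x `^ q)%E).
Proof. exact: (measurableT_comp (measurable_poweR _) mV). Qed.

Let v x := fine (V x).
Let v0 x : 0 <= v x. Proof. exact: fine_ge0. Qed.
Let mv : measurable_fun [set: R] v. Proof. exact: (measurableT_comp (fine_measurable _) mV). Qed.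

Lemma bl_product_fin_num_ae : {ae gamma R, forall x, (v x)%:E = V x}.
Proof.
have : (\int[gamma R]_x (V x `^ q) < +oo)%E.
  exact: le_lt_trans (bl_product_power_le blP mf mg f0 g0 A0 B0 fA gB) (ltry _).
move=> /(@ge0_integral_lty_ae _ (measurableTypeR R) _ (gamma R) _ mVq (fun x => poweR_ge0 _ _)).
apply: filterS => x; rewrite !ge0_fin_numE ?poweR_ge0// => /lty_poweRy h.
by rewrite /v fineK// ge0_fin_numE// h// gt_eqF.
Qed.

Let mvq c : measurable_fun [set: R] (fun x => v x `^ c).
Proof.
have mp : measurable_fun [set: R] (@powR R ^~ c) by exact: measurable_powR.
exact: (measurableT_comp mp mv).
Qed.

Let integral_vq : (\int[gamma R]_x (V x `^ q) = \int[gamma R]_x (v x `^ q)%:E)%E.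
Proof.
apply: ge0_ae_eq_integral => //.
- by apply/measurable_EFinP; exact: mvq.
- by move=> x _; exact: poweR_ge0.
- by move=> x _; rewrite lee_fin powR_ge0.
- by apply: filterS bl_product_fin_num_ae => x <-.
Qed.

Let integral_hV (h : R -> R) : measurable_fun [set: R] h -> (forall x, 0 <= h x) ->
  (\int[gamma R]_x ((h x)%:E * V x) = \int[gamma R]_x (h x * v x)%:E)%E.
Proof.
move=> mh h0; apply: ge0_ae_eq_integral => //.
- by apply: emeasurable_funM => //; exact/measurable_EFinP.
- by apply/measurable_EFinP; exact: measurable_funM.
- by move=> x _; rewrite mule_ge0// lee_fin.
- by move=> x _; rewrite lee_fin mulr_ge0.
- by apply: filterS bl_product_fin_num_ae => x <-.
Qed.

(** The test function [h] = v^(q - 1) is the extremal one for duality, so equality of norms becomes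
    equality in the Brascamp-Lieb inequality for the three weights. *)
Lemma bl_product_equality_gaussian : (\int[gamma R]_x (V x `^ q) = (M `^ q)%:E)%E ->
  exists k e1 e2, [/\ 0 < k,
    {ae mu, forall x, bl_weight c1 A f x = gaussian k e1 x} &
    {ae mu, forall x, bl_weight c2 B g x = gaussian k e2 x}].
Proof.
rewrite integral_vq => VM.
have dF := density_bl_weight mf A0 fA; have dG := density_bl_weight mg B0 gB.
set C := M `^ q in VM; have C0 : 0 < C by exact: powR_gt0.
pose h x := v x `^ (q - 1).
have mh : measurable_fun [set: R] h by exact: mvq.
have h0 x : 0 <= h x by exact: powR_ge0.
have hC : (\int[gamma R]_x (h x `^ c3^-1)%:E = C%:E)%E.
  rewrite -VM; apply: eq_integral => x _; rewrite /h -powRrM; congr (_ `^ _)%:E.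
  by rewrite /q; field; rewrite ?subr_eq0 !gt_eqF.
have dH := density_bl_weight mh C0 hC.
have CE : M * C `^ c3 = C.
  rewrite /C -powRrM -[X in X * _]powRr1 ?(ltW M0)// -powRD; last first.
    by rewrite (gt_eqF M0) implybT.
  by congr (_ `^ _); rewrite /q; field; rewrite subr_eq0 gt_eqF.
have hVE : (\int[gamma R]_x ((h x)%:E * V x) = C%:E)%E.
  rewrite integral_hV// -VM; apply: eq_integral => x _.
  by rewrite /h mulrC mulr_powRB1.
have := bl_product_trilinear blP mf mg mh f0 g0 h0 A0 B0 C0.
rewrite -/V hVE -/M CE muleC => /eqP; rewrite eq_le => /andP[+ _].
rewrite lee_pmul2l// ?lte_fin// => DJ.
have [|k [e1 [e2 [k0 FE GE]]]] := bl_equality_gaussian blP dF dG dH _ DJ.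
  (* The integral of the indicator of [Z] times [V] is 0, hence almost no z with f(z.1) and g(z.2)
     nonzero has its [bl_comb] in [Z]. This is the positivity of the third density. *)
  pose Z : set R := v @^-1` [set 0].
  have mZ : measurable Z by rewrite -[Z]setTI; exact: mv.
  have mIZ : measurable_fun [set: R] (\1_Z : R -> R) by exact: measurable_indic.
  have IZ0 x : 0 <= \1_Z x :> R by rewrite indicE ler0n.
  have ZV : {ae gamma R, forall x, \1_Z x = 0 :> R \/ V x = 0%E}.
    apply: filterS bl_product_fin_num_ae => x; rewrite indicE.
    have [|_] := boolP (x \in Z); last by left.
    by rewrite inE /Z/= => -> <-; right.
  apply: filterS (bl_product_eq0_ae mf mg mIZ f0 g0 IZ0 ZV) => z Jz Fz Gz.
  have f_neq0 : f z.1 <> 0.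
    by move=> fz; move: Fz; rewrite /bl_weight fz powR0 ?mul0r ?ltxx// invr_eq0 gt_eqF.
  have g_neq0 : g z.2 <> 0.
    by move=> gz; move: Gz; rewrite /bl_weight gz powR0 ?mul0r ?ltxx// invr_eq0 gt_eqF.
  have vz : 0 < v (bl_comb s s' D z.1 z.2).
    case: Jz => // /eqP; rewrite indicE pnatr_eq0 eqb0 => /negP nZ.
    by rewrite lt_neqAle v0 andbT; apply/eqP => vz; apply: nZ; rewrite inE.
  by rewrite divr_gt0// mulr_gt0 ?rho_gt0// !powR_gt0.
exists k, e1, e2; split => //; exact: dist_gaussian_ae.
Qed.

(** Only the lower bound is new. Testing with an explicit [h] gives the integral of h v the value
    [M]; integrating Young's inequality then yields M <= al w + M c3, where w is the q-th moment of
    v, and this amounts to M^q <= w. *)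
Lemma bl_product_gaussian k e1 e2 : 0 < k ->
  {ae mu, forall x, bl_weight c1 A f x = gaussian k e1 x} ->
  {ae mu, forall x, bl_weight c2 B g x = gaussian k e2 x} ->
  (\int[gamma R]_x (V x `^ q) = (M `^ q)%:E)%E.
Proof.
move=> k0 FE GE.
have VM := bl_product_power_le blP mf mg f0 g0 A0 B0 fA gB.
apply/eqP; rewrite eq_le VM/= -/V -/q.
move: VM; rewrite -/V -/M -/q integral_vq.
have fin : (\int[gamma R]_x (v x `^ q)%:E)%E \is a fin_num ->
    exists2 w, 0 <= w & (\int[gamma R]_x (v x `^ q)%:E = w%:E)%E.
  move=> h; exists (fine (\int[gamma R]_x (v x `^ q)%:E)%E); last by rewrite fineK.
  by apply: fine_ge0; apply: integral_ge0 => x _; rewrite lee_fin powR_ge0.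
move=> VM; have [|w w0 wE] := fin.
  rewrite ge0_fin_numE; first exact: le_lt_trans VM (ltry _).
  by apply: integral_ge0 => x _; rewrite lee_fin powR_ge0.
pose e3 := bl_comb s s' D e1 e2.
(* Chosen so that [bl_weight c3 1 h] is [gaussian k e3], which saturates the trilinear form together
   with the weights of [f] and [g]. *)
pose h x := (gaussian k e3 x / rho x) `^ c3.
have q0' (x : R) : 0 <= gaussian k e3 x / rho x.
  by rewrite divr_ge0 ?gaussian_ge0// normal_pdf_ge0.
have hE x : h x `^ c3^-1 = gaussian k e3 x / rho x.
  by rewrite /h -powRrM mulfV ?gt_eqF// powRr1.
have h0 x : 0 <= h x by exact: powR_ge0.
have mh : measurable_fun [set: R] h.
  have mp : measurable_fun [set: R] (@powR R ^~ c3) by exact: measurable_powR.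
  have mg3 : measurable_fun [set: R] (fun x : R => gaussian k e3 x / rho x).
    rewrite (_ : (fun x => _) = fun x =>
      gaussian k e3 x * expR (- (ln (normal_peak 1) - x ^+ 2 / 2))); last first.
      by apply/funext => x; rewrite rhoE expRN.
    apply: measurable_funM; first exact: measurable_gaussian.
    apply: (measurableT_comp (@measurable_expR R)); apply: measurableT_comp => //.
    by apply: measurable_funB => //; apply: measurable_funM.
  exact: (measurableT_comp mp mg3).
have hw x : bl_weight c3 1 h x = gaussian k e3 x.
  by rewrite /bl_weight hE divr1 mulfVK// gt_eqF// rho_gt0.
have hC : (\int[gamma R]_x (h x `^ c3^-1)%:E = 1)%E.
  rewrite -(integral_gaussian e3 k0) (@ge0_integral_gamma R (fun x => (h x `^ c3^-1)%:E)).
  - apply: eq_integral => x _; rewrite -EFinM hE mulfVK//.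
    by rewrite gt_eqF// rho_gt0.
  - have mp : measurable_fun [set: R] (@powR R ^~ c3^-1) by exact: measurable_powR.
    by apply/measurable_EFinP; exact: (measurableT_comp mp mh).
  - by move=> x; rewrite lee_fin powR_ge0.
have hV : (\int[gamma R]_x (h x * v x)%:E = M%:E)%E.
  rewrite -integral_hV//.
  have := bl_product_trilinear blP mf mg mh f0 g0 h0 A0 B0 ltr01.
  rewrite -/V powR1 mulr1 -/M [X in _ = (_ * X)%E](_ : _ = D%:E).
    move=> E; apply/eqP; rewrite eq_le -(@lee_pmul2l _ D%:E) ?lte_fin//.
    by rewrite -[X in _ && X](@lee_pmul2l _ D%:E) ?lte_fin// E muleC lexx.
  rewrite -[RHS](integral_mu2_gaussian e1 e2 k0).
  apply: ge0_ae_eq_integral; first by [].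
  - apply/measurable_EFinP; apply: measurable_bl_powers; exact: measurable_bl_weight.
  - apply/measurable_EFinP; apply: measurable_bl_powers; exact: measurable_gaussian.
  - by move=> z _; rewrite lee_fin !mulr_ge0// powR_ge0.
  - by move=> z _; rewrite lee_fin !mulr_ge0// powR_ge0.
  - by apply: filterS2 (ae_fst FE) (ae_snd GE) => z -> -> _; rewrite hw.
(* Young's inequality for v / M and h with exponents q and 1 / c3 is multiplied by [M], and M (v /
   M)^q / q = M^(1 - q) (1 - c3) v^q. *)
pose al := M `^ (1 - q) * (1 - c3).
have al0 : 0 <= al by rewrite mulr_ge0 ?powR_ge0// subr_ge0 ltW.
have young x : h x * v x <= al * v x `^ q + M * c3 * h x `^ c3^-1.
  have vM0 : 0 <= v x / M by rewrite divr_ge0// ltW.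
  have c3i : 0 < c3^-1 by rewrite invr_gt0.
  have qq : q^-1 + c3^-1^-1 = 1 by rewrite /q !invrK subrK.
  have := conjugate_powR vM0 (h0 x) q0 c3i qq.
  rewrite powRM ?invr_ge0 ?(ltW M0)// -(ler_pM2l M0).
  rewrite (_ : M * (v x / M * h x) = h x * v x); last by field; rewrite gt_eqF.
  move=> /le_trans; apply; rewrite le_eqVlt; apply/orP; left; apply/eqP.
  have qi : q^-1 = 1 - c3 by rewrite /q invrK.
  rewrite mulrDr qi [c3^-1^-1]invrK; congr (_ + _); last by ring.
  rewrite /al -[M^-1]powR_inv1 ?(ltW M0)// -powRrM mulN1r.
  rewrite powRD ?(gt_eqF M0) ?implybT// powRr1 ?(ltW M0)//; ring.
rewrite wE lee_fin.
have : (M%:E <= (al * w + M * c3)%:E)%E.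
  have mh3 : measurable_fun [set: R] (fun x => h x `^ c3^-1).
    have mp : measurable_fun [set: R] (@powR R ^~ c3^-1) by exact: measurable_powR.
    exact: (measurableT_comp mp mh).
  have M30 : 0 <= M * c3 by rewrite mulr_ge0// ltW.
  apply: (@le_trans _ _ (\int[gamma R]_x (al%:E * (v x `^ q)%:E +
      (M * c3)%:E * (h x `^ c3^-1)%:E))%E).
    rewrite -hV; apply: ge0_le_integral; first by [].
    - by move=> x _; rewrite lee_fin mulr_ge0.
    - by apply/measurable_EFinP; exact: measurable_funM.
    - by apply: emeasurable_funD; apply: emeasurable_funM => //; apply/measurable_EFinP; [exact: mvq|exact: mh3].
    - by move=> x _; rewrite -!EFinM -EFinD lee_fin.
  rewrite ge0_integralD; [|by []| | | |]; last 4 first.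
  - by move=> x _; rewrite mule_ge0// lee_fin ?powR_ge0.
  - by apply: emeasurable_funM => //; apply/measurable_EFinP; exact: mvq.
  - by move=> x _; rewrite mule_ge0// lee_fin ?powR_ge0.
  - by apply: emeasurable_funM => //; apply/measurable_EFinP; exact: mh3.
  rewrite ge0_integralZl_EFin; [|by []|by move=> x _; rewrite lee_fin powR_ge0|
    by apply/measurable_EFinP; exact: mvq|exact: al0].
  rewrite ge0_integralZl_EFin; [|by []|by move=> x _; rewrite lee_fin powR_ge0|
    by apply/measurable_EFinP; exact: mh3|exact: M30].
  by rewrite wE hC mule1 -EFinM -EFinD.
rewrite lee_fin -lerBlDr -{1}[M]mulr1 -mulrBr => h1.
have h2 : M <= M `^ (1 - q) * w.
  rewrite -(@ler_pM2r _ (1 - c3)) ?subr_gt0//; apply: le_trans h1 _.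
  by rewrite /al mulrAC.
move: h2; rewrite powRB ?(gt_eqF M0) ?implybT// powRr1 ?(ltW M0)//.
rewrite mulrAC ler_pdivlMr ?powR_gt0// -{1}[M]mulr1 -mulrA ler_pM2l// mul1r.
by [].
Qed.
End bl_product_equality.

(** * Signs of the extremizers *)

Section ae_lebesgue.
Context {R : realType}.
Notation mu := (@lebesgue_measure R).

Lemma ae_affine (k b : R) (P : R -> Prop) : k != 0 ->
  {ae mu, forall x, P x} -> {ae mu, forall x, P (k * x + b)}.
Proof.
move=> k0 [N [mN N0 PN]].
exists ((fun x => k * x + b) @^-1` N); split.
- by rewrite -[X in measurable X]setTI; exact: measurable_affine.
- apply/eqP; move: N0; rewrite (lebesgue_measure_affine b k0 mN) => /eqP.
  by rewrite mule_eq0 eqe normr_eq0 (negbTE k0).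
- by move=> x /= nP; exact: PN.
Qed.

Lemma ae_lebesgue_ex (P : R -> Prop) : {ae mu, forall x, P x} -> exists x, P x.
Proof.
move=> [N [mN N0 PN]]; apply: contrapT => nP.
have : (mu `[0%R, 1%R] <= mu N)%E.
  apply: le_measure; rewrite ?inE// => x _; apply: PN => /= Px.
  by apply: nP; exists x.
by rewrite N0 lebesgue_measure_itv/= lte01 sube0 leNgt lte01.
Qed.

Lemma ae_mu2_slices (P : R * R -> Prop) : {ae mu2, forall z, P z} ->
  {ae mu, forall x, {ae mu, forall y, P (x, y)}}.
Proof.
move=> [N [mN N0 PN]].
have mI : measurable_fun [set: R * R] (fun z => (\1_N z : R)%:E).
  by apply/measurable_EFinP; exact: measurable_indic.
have I0 (z : R * R) : (0 <= (\1_N z : R)%:E)%E by rewrite lee_fin indicE ler0n.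
have : (\int[mu2]_z (\1_N z : R)%:E = 0)%E by rewrite integral_indic// setIT.
rewrite (integral_mu2 mI I0) => /ge0_integral_eq0_ae.
move=> /(_ (@measurable_fun_fubini_tonelli_F _ _ _ _ _ mu _ mI I0)).
have F0 (x : R) : (0 <= \int[mu]_y (\1_N (x, y) : R)%:E)%E by exact: integral_ge0.
move=> /(_ F0); apply: filterS => x /ge0_integral_eq0_ae.
have mIx : measurable_fun [set: R] (fun y => (\1_N (x, y) : R)%:E).
  by have := measurableT_comp mI (@pair1_measurable _ _ (measurableTypeR R) (measurableTypeR R) x).
move=> /(_ mIx (fun y => I0 (x, y))); apply: filterS => y /eqP.
rewrite eqe indicE pnatr_eq0 eqb0 => /negP nN.
by apply: contrapT => nP; apply: nN; rewrite inE; exact: PN.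
Qed.

(** Exchanging the two variables gives a single point [x] such that P (x + t) <-> P x for almost
    every t; [P] then agrees almost everywhere with the truth value of [P x]. *)
Lemma translation_invariant_ae_constant (P : set R) : measurable P ->
  (forall t, {ae mu, forall x, P (x + t) <-> P x}) ->
  {ae mu, forall x, P x} \/ {ae mu, forall x, ~ P x}.
Proof.
move=> mP invP.
pose f (z : R * R) : \bar R := `|\1_P (z.1 + z.2) - \1_P z.1 : R|%:E.
have mI : measurable_fun [set: R] (\1_P : R -> R) by exact: measurable_indic.
have m1 := @measurable_fst _ _ (measurableTypeR R) (measurableTypeR R).
have m2 := @measurable_snd _ _ (measurableTypeR R) (measurableTypeR R).
have mf : measurable_fun [set: R * R] f.
  apply/measurable_EFinP; apply: measurableT_comp => //; apply: measurable_funB.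
    exact: (measurableT_comp mI (measurable_funD m1 m2)).
  exact: (measurableT_comp mI m1).
have f0 z : (0 <= f z)%E by rewrite lee_fin.
have : (\int[mu]_x \int[mu]_t f (x, t) = 0)%E.
  transitivity (\int[mu]_t \int[mu]_x f (x, t))%E; first exact: fubini_tonelli.
  apply: integral0_eq => t _; rewrite -[RHS](@integral0 _ _ _ mu [set: R]).
  apply: ge0_ae_eq_integral; first by [].
  - by have := measurableT_comp mf (@pair2_measurable _ _ (measurableTypeR R) (measurableTypeR R) t).
  - by [].
  - by move=> x _; exact: f0.
  - by [].
  - apply: filterS (invP t) => x Px _; rewrite /f/=.
    suff -> : \1_P (x + t) = \1_P x :> R by rewrite subrr normr0.
    rewrite !indicE (_ : (x + t \in P) = (x \in P))//.
    by apply/idP/idP; rewrite !inE => /Px.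
move=> /ge0_integral_eq0_ae.
move=> /(_ (@measurable_fun_fubini_tonelli_F _ _ _ _ _ mu _ mf f0)).
have F0 (x : R) : (0 <= \int[mu]_y f (x, y))%E by exact: integral_ge0.
move=> /(_ F0) /ae_lebesgue_ex[x] /ge0_integral_eq0_ae.
have mfx : measurable_fun [set: R] (fun t => f (x, t)).
  by have := measurableT_comp mf (@pair1_measurable _ _ (measurableTypeR R) (measurableTypeR R) x).
move=> /(_ mfx (fun t => f0 (x, t))) h.
have {}h : {ae mu, forall t, P t <-> P x}.
  apply: filterS (ae_affine (- x) (oner_neq0 R) h) => t /eqP; rewrite /f /= eqe normr_eq0.
  rewrite (_ : x + (1 * t - x) = t); last by ring.
  rewrite subr_eq0 !indicE eqr_nat => /eqP e.
  have {}e : (t \in P) = (x \in P) by move: e; case: (t \in P); case: (x \in P).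
  by split=> Px; apply/set_mem; [rewrite -e|rewrite e]; rewrite inE.
have [Px|nPx] := pselect (P x); [left|right]; apply: filterS h => t [h1 h2].
- exact: h2.
- by move=> /h1.
Qed.

(* The sets [Q], [P], [P'] stand for the places where the product, the first
   and the second function are positive. Comparing two values of [x] shows that
   each translation preserves or complements [P']; halving the translation
   excludes the second possibility. *)
Lemma sign_rule_ae_constant (Q P : R -> Prop) (P' : set R) (a b : R) :
  a != 0 -> b != 0 -> measurable P' ->
  {ae mu, forall x, {ae mu, forall y, Q (a * x + b * y) <-> (P x <-> P' y)}} ->
  {ae mu, forall y, P' y} \/ {ae mu, forall y, ~ P' y}.
Proof.
move=> a0 b0 mP' QPP'.
apply: translation_invariant_ae_constant => // t.
have half u : {ae mu, forall y, P' (y + u) <-> P' y} \/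
              {ae mu, forall y, P' (y + u) <-> ~ P' y}.
  (* The rule holds at [x] and at [x + b / a * u] for one and the same [x]: the second point moves
     the argument of [Q] exactly as replacing y by y + u does. *)
  have [x [h1 h2]] := ae_lebesgue_ex (@filterI _ _ (lebesgue_filter R) _ _ QPP'
    (ae_affine (b / a * u) (oner_neq0 R) QPP')).
  rewrite mul1r in h2.
  have {}h1 := ae_affine u (oner_neq0 R) h1.
  have h : {ae mu, forall y, (P x <-> P' (y + u)) <->
      (P (x + b / a * u) <-> P' y)}.
    apply: filterS2 h1 h2 => y; rewrite !mul1r.
    rewrite (_ : a * (x + b / a * u) + b * y = a * x + b * (y + u)); first by tauto.
    by field.
  have [Px|nPx] := pselect (P x); have [Px'|nPx'] := pselect (P (x + b / a * u)).
  - by left; apply: filterS h => y; tauto.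
  - by right; apply: filterS h => y; tauto.
  - by right; apply: filterS h => y; have := pselect (P' (y + u)); tauto.
  - left; apply: filterS h => y.
    by have := pselect (P' (y + u)); have := pselect (P' y); tauto.
have tE y : 1 * y + t / 2 + t / 2 = y + t by field.
case: (half (t / 2)) => h; have h' := ae_affine (t / 2) (oner_neq0 R) h;
  apply: filterS2 h h' => y; rewrite tE mul1r => h1 h2.
- by tauto.
- by have := pselect (P' y); tauto.
Qed.

(** Once [P'] is almost everywhere a constant [s], almost every x satisfies Q <-> (P x <-> s) almost
    everywhere. As [Q] does not involve x, two such points have the same truth value of [P]. *)
Lemma ae_constant_sign2 (Q P : R -> Prop) (P' : set R) (a b : R) :
  a != 0 -> b != 0 -> measurable P' ->
  {ae mu, forall x, {ae mu, forall y, Q (a * x + b * y) <-> (P x <-> P' y)}} ->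
  ({ae mu, forall x, P x} \/ {ae mu, forall x, ~ P x}) /\
  ({ae mu, forall y, P' y} \/ {ae mu, forall y, ~ P' y}).
Proof.
move=> a0 b0 mP' h; have cP' := sign_rule_ae_constant a0 b0 mP' h; split => //.
have [s sP'] : exists s : Prop, {ae mu, forall y, P' y <-> s}.
  by case: cP' => h'; [exists True|exists False]; apply: filterS h' => y; tauto.
have QP : {ae mu, forall x, {ae mu, forall z, Q z <-> (P x <-> s)}}.
  apply: filterS h => x hx.
  have {}hx : {ae mu, forall y, Q (b * y + a * x) <-> (P x <-> s)}.
    by apply: filterS2 hx sP' => y; rewrite addrC; tauto.
  have bi : b^-1 != 0 by rewrite invr_eq0.
  apply: filterS (ae_affine (- (b^-1 * (a * x))) bi hx) => z.
  by rewrite mulrBr !mulVKf// subrK.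
have [[x [Px hx]]|nP] := pselect (exists x, P x /\ {ae mu, forall z, Q z <-> (P x <-> s)}).
  left; apply: filterS QP => x' hx'.
  have [z [h1 h2]] := ae_lebesgue_ex (@filterI _ _ (lebesgue_filter R) _ _ hx hx').
  by have := pselect s; have := pselect (P x'); tauto.
by right; apply: filterS QP => x hx Px; apply: nP; exists x.
Qed.

End ae_lebesgue.

Section bl_product_signed.
Context {R : realType}.
Notation mu := (@lebesgue_measure R).
Variables c1 c2 c3 s s' D : R.
Hypothesis blP : bl_parameters c1 c2 c3 s s' D.
Variables f g : R -> R.
Hypotheses (mf : measurable_fun [set: R] f) (mg : measurable_fun [set: R] g).

Let product (f g : R -> R) := bl_product c1 c2 s s' D f g.
Let fp : R -> R := f^\+.
Let fn : R -> R := f^\-.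
Let gp : R -> R := g^\+.
Let gn : R -> R := g^\-.
(** [agree] and [differ] are the integrals of the positive and negative parts of the integrand. The
    signed product is their difference, and the product of the absolute values is their sum. *)
Let agree (x : R) : \bar R := (product fp gp x + product fn gn x)%E.
Let differ (x : R) : \bar R := (product fp gn x + product fn gp x)%E.
Let V := product (Num.norm \o f) (Num.norm \o g).

Let mfp : measurable_fun [set: R] fp. Proof. exact: measurable_funrpos. Qed.
Let mfn : measurable_fun [set: R] fn. Proof. exact: measurable_funrneg. Qed.
Let mgp : measurable_fun [set: R] gp. Proof. exact: measurable_funrpos. Qed.
Let mgn : measurable_fun [set: R] gn. Proof. exact: measurable_funrneg. Qed.
Let fp0 x : 0 <= fp x. Proof. exact: funrpos_ge0. Qed.
Let fn0 x : 0 <= fn x. Proof. exact: funrneg_ge0. Qed.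
Let gp0 x : 0 <= gp x. Proof. exact: funrpos_ge0. Qed.
Let gn0 x : 0 <= gn x. Proof. exact: funrneg_ge0. Qed.

Let integral_sum (f1 g1 f2 g2 : R -> R) x :
  measurable_fun [set: R] f1 -> measurable_fun [set: R] g1 ->
  measurable_fun [set: R] f2 -> measurable_fun [set: R] g2 ->
  (forall x, 0 <= f1 x) -> (forall x, 0 <= g1 x) ->
  (forall x, 0 <= f2 x) -> (forall x, 0 <= g2 x) ->
  (product f1 g1 x + product f2 g2 x = \int[gamma R]_y
    (f1 (bl_left c2 s s' D x y) * g1 (bl_right c1 s s' D x y) +
     f2 (bl_left c2 s s' D x y) * g2 (bl_right c1 s s' D x y))%:E)%E.
Proof.
move=> mf1 mg1 mf2 mg2 f10 g10 f20 g20.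
rewrite -ge0_integralD; first by apply: eq_integral => y _; rewrite EFinD.
- by [].
- by move=> y _; rewrite lee_fin mulr_ge0.
- exact: measurable_bl_factors_at.
- by move=> y _; rewrite lee_fin mulr_ge0.
- exact: measurable_bl_factors_at.
Qed.

Let maxr_mul0 (a b : R) :
  Num.max (a * b) 0 = Num.max a 0 * Num.max b 0 + Num.max (- a) 0 * Num.max (- b) 0.
Proof.
have [a0|a0] := leP 0 a.
  rewrite (max_r (_ : - a <= 0)) ?oppr_le0// mul0r addr0.
  by rewrite [RHS]maxr_pMr// mulr0.
have na0 : 0 <= - a by rewrite oppr_ge0 ltW.
rewrite mul0r add0r (max_l na0).
by rewrite [RHS]maxr_pMr// mulr0 mulrNN.
Qed.

Let maxr_mulN0 (a b : R) :
  Num.max (- (a * b)) 0 = Num.max a 0 * Num.max (- b) 0 + Num.max (- a) 0 * Num.max b 0.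
Proof. by rewrite -mulrN maxr_mul0 opprK. Qed.

Let agree_ge0 x : (0 <= agree x)%E.
Proof. by rewrite adde_ge0//; exact: bl_product_ge0. Qed.

Let differ_ge0 x : (0 <= differ x)%E.
Proof. by rewrite adde_ge0//; exact: bl_product_ge0. Qed.

Let measurable_agree : measurable_fun [set: R] agree.
Proof. by apply: emeasurable_funD; exact: measurable_bl_product. Qed.

Let measurable_differ : measurable_fun [set: R] differ.
Proof. by apply: emeasurable_funD; exact: measurable_bl_product. Qed.

Lemma bl_product_agree_differ x : product f g x = (agree x - differ x)%E.
Proof.
rewrite /product /bl_product integralE /agree /differ !integral_sum//.
congr (_ - _)%E; apply: eq_integral => y _.
- by rewrite funeposE -EFin_max maxr_mul0.
- by rewrite funenegE -EFinN -EFin_max maxr_mulN0.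
Qed.

Lemma bl_product_norm x : V x = (agree x + differ x)%E.
Proof.
rewrite /agree /differ !integral_sum// -ge0_integralD; last 5 first.
- by [].
- by move=> y _; rewrite lee_fin addr_ge0// mulr_ge0.
- by apply/measurable_EFinP; apply: measurable_funD; apply/measurable_EFinP; exact: measurable_bl_factors_at.
- by move=> y _; rewrite lee_fin addr_ge0// mulr_ge0.
- by apply/measurable_EFinP; apply: measurable_funD; apply/measurable_EFinP; exact: measurable_bl_factors_at.
apply: eq_integral => y _; rewrite -EFinD /=; congr _%:E.
have n (h : R -> R) t : `|h t| = h^\+ t + h^\- t.
  by have := congr1 (fun k => k t) (funrposDneg h).
rewrite !n -/fp -/fn -/gp -/gn.
by move: (fp _) (fn _) (gp _) (gn _) => u1 u2 u3 u4; ring.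
Qed.

Lemma measurable_bl_product_signed : measurable_fun [set: R] (product f g).
Proof.
rewrite (_ : product f g = fun x => (agree x - differ x)%E).
  exact: emeasurable_funB.
by apply/funext => x; exact: bl_product_agree_differ.
Qed.

Lemma bl_product_le_norm x : (`|product f g x| <= V x)%E.
Proof.
rewrite bl_product_norm bl_product_agree_differ.
by apply: le_trans (lee_abs_sub _ _) _; rewrite !gee0_abs.
Qed.

(** If |agree - differ| = agree + differ is finite, one of the two terms is 0. With [Q] the set
    where [agree] is nonzero, two of the four products of positive and negative parts vanish almost
    everywhere on [Q] and the other two off it; [bl_product_eq0_ae] turns this into a sign rule on
    the plane. *)
Lemma bl_product_ae_constant_sign :
  {ae gamma R, forall x, (`|product f g x| = V x)%E /\ V x \is a fin_num} ->
  {ae mu, forall x, f x <> 0} -> {ae mu, forall x, g x <> 0} ->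
  ({ae mu, forall x, 0 < f x} \/ {ae mu, forall x, ~ 0 < f x}) /\
  ({ae mu, forall x, 0 < g x} \/ {ae mu, forall x, ~ 0 < g x}).
Proof.
move=> UV f0 g0.
have agree_or_differ : {ae gamma R, forall x, agree x = 0%E \/ differ x = 0%E}.
  apply: filterS UV => x; rewrite bl_product_agree_differ bl_product_norm.
  move=> [e fin]; move: e fin (agree_ge0 x) (differ_ge0 x).
  case: (agree x) (differ x) => [a| |] [b| |]//; rewrite !lee_fin => + _ a0 b0.
  rewrite -EFinB -EFinD abse_EFin => -[]; have [ab|/ltW ab] := leP b a.
    by rewrite ger0_norm ?subr_ge0// => e; right; congr _%:E; lra.
  by rewrite ler0_norm ?subr_le0// => e; left; congr _%:E; lra.
pose Q : set R := agree @^-1` ~` [set 0%E].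
have mQ : measurable Q.
  by rewrite -[Q]setTI; apply: measurable_agree => //; exact: measurableC.
have mIQ : measurable_fun [set: R] (\1_Q : R -> R) by exact: measurable_indic.
have mIC : measurable_fun [set: R] (\1_(~` Q) : R -> R).
  by apply: measurable_indic; exact: measurableC.
have I0 (E : set R) x : 0 <= \1_E x :> R by rewrite indicE ler0n.
have IQ (E : set R) x : \1_E x = 0 :> R -> ~ E x.
  by move=> /eqP; rewrite indicE pnatr_eq0 eqb0 => /negP nE Ex; apply: nE; rewrite inE.
have nIQ (E : set R) x : ~ E x -> \1_E x = 0 :> R.
  by move=> nE; rewrite indicE; case: (boolP (x \in E)) => // /set_mem.
have pd (a b : \bar R) : (0 <= a -> 0 <= b -> a + b = 0 -> a = 0 /\ b = 0)%E.
  by move=> a0 b0 /eqP; rewrite padde_eq0// => /andP[/eqP-> /eqP->].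
have p0 (h1 h2 : R -> R) x : (forall x, 0 <= h1 x) -> (forall x, 0 <= h2 x) ->
    (0 <= product h1 h2 x)%E by move=> *; exact: bl_product_ge0.
have agree0 x : agree x = 0%E -> product fp gp x = 0%E /\ product fn gn x = 0%E.
  by move/pd; apply; exact: p0.
have differ0 x : differ x = 0%E -> product fp gn x = 0%E /\ product fn gp x = 0%E.
  by move/pd; apply; exact: p0.
have onQ : {ae gamma R, forall x, \1_Q x = 0 :> R \/
    product fp gn x = 0%E /\ product fn gp x = 0%E}.
  apply: filterS agree_or_differ => x [a0|/differ0]; last by right.
  by left; apply: nIQ => /(_ a0).
have offQ : {ae gamma R, forall x, \1_(~` Q) x = 0 :> R \/
    product fp gp x = 0%E /\ product fn gn x = 0%E}.
  apply: aeW => x; have [/agree0|Qx] := pselect (agree x = 0%E); first by right.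
  by left; apply: nIQ.
have /(bl_product_eq0_ae blP mfp mgn mIQ fp0 gn0 (I0 Q)) h1 :
    {ae gamma R, forall x, \1_Q x = 0 :> R \/ product fp gn x = 0%E}.
  by apply: filterS onQ => x [|[]]; [left|right].
have /(bl_product_eq0_ae blP mfn mgp mIQ fn0 gp0 (I0 Q)) h2 :
    {ae gamma R, forall x, \1_Q x = 0 :> R \/ product fn gp x = 0%E}.
  by apply: filterS onQ => x [|[]]; [left|right].
have /(bl_product_eq0_ae blP mfp mgp mIC fp0 gp0 (I0 (~` Q))) h3 :
    {ae gamma R, forall x, \1_(~` Q) x = 0 :> R \/ product fp gp x = 0%E}.
  by apply: filterS offQ => x [|[]]; [left|right].
have /(bl_product_eq0_ae blP mfn mgn mIC fn0 gn0 (I0 (~` Q))) h4 :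
    {ae gamma R, forall x, \1_(~` Q) x = 0 :> R \/ product fn gn x = 0%E}.
  by apply: filterS offQ => x [|[]]; [left|right].
have pos (h : R -> R) t : h^\+ t = 0 -> h t <= 0.
  by rewrite /funrpos => h0; rewrite -h0 le_max lexx.
have neg (h : R -> R) t : h^\- t = 0 -> 0 <= h t.
  by rewrite /funrneg => h0; rewrite -oppr_le0 -h0 le_max lexx.
have key : {ae mu2, forall z : R * R,
    Q (bl_comb s s' D z.1 z.2) <-> (0 < f z.1 <-> 0 < g z.2)}.
  have h12 := @filterI _ _ (mu2_filter R) _ _ h1 h2.
  have h34 := @filterI _ _ (mu2_filter R) _ _ h3 h4.
  have fg := @filterI _ _ (mu2_filter R) _ _ (ae_fst f0) (ae_snd g0).
  apply: filterS2 h12 (@filterI _ _ (mu2_filter R) _ _ h34 fg).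
  move=> z [k1 k2] [[k3 k4] [fz gz]].
  set S := z.1 in k1 k2 k3 k4 fz *; set T := z.2 in k1 k2 k3 k4 gz *.
  set x := bl_comb _ _ _ _ _ in k1 k2 k3 k4 *.
  have {}k1 : [\/ f S <= 0, 0 <= g T | ~ Q x].
    by case: k1 => [/pos|/neg|/IQ] ?; [constructor 1|constructor 2|constructor 3].
  have {}k2 : [\/ 0 <= f S, g T <= 0 | ~ Q x].
    by case: k2 => [/neg|/pos|/IQ] ?; [constructor 1|constructor 2|constructor 3].
  have {}k3 : [\/ f S <= 0, g T <= 0 | ~ (~` Q) x].
    by case: k3 => [/pos|/pos|/IQ] ?; [constructor 1|constructor 2|constructor 3].
  have {}k4 : [\/ 0 <= f S, 0 <= g T | ~ (~` Q) x].
    by case: k4 => [/neg|/neg|/IQ] ?; [constructor 1|constructor 2|constructor 3].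
  have QQ : ~ (~` Q) x -> Q x by exact: contrapT.
  case: (ltgtP 0 (f S)) k1 k2 k3 k4 => [fp'|fn'|/esym//]; case: (ltgtP 0 (g T)) => [gp'|gn'|/esym//].
  - by move=> _ _ [//|//|/QQ].
  - by move=> [//|//|nQx] _ _ _; split => [/nQx//|[/(_ isT)]].
  - by move=> _ [//|//|nQx] _ _; split => [/nQx//|[_ /(_ isT)]].
  - by move=> _ _ _ [//|//|/QQ].
have [_ [s0 s'0 D0] _ _ _] := blP.
have a0 : s' / D != 0 by rewrite gt_eqF// divr_gt0.
have b0 : - (s / D) != 0 by rewrite oppr_eq0 gt_eqF// divr_gt0.
have mP' : measurable [set y | 0 < g y].
  rewrite (_ : [set y | _] = [set: R] `&` g @^-1` `]0, +oo[%classic).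
    by apply: mg => //; exact: measurable_itv.
  by apply/seteqP; split => y /=; rewrite in_itv/= andbT // => -[].
apply: (@ae_constant_sign2 R Q (fun x => 0 < f x) _ _ _ a0 b0 mP').
apply: filterS (ae_mu2_slices key) => x; apply: filterS => y.
by rewrite (bl_combE blP).
Qed.

End bl_product_signed.

Section bl_product_ae.
Context {R : realType}.
Notation mu := (@lebesgue_measure R).
Variables c1 c2 c3 s s' D : R.
Hypothesis blP : bl_parameters c1 c2 c3 s s' D.

Let product (f g : R -> R) := bl_product c1 c2 s s' D f g.

(** Equality at every [x], and not only at almost every one, because at fixed [x] both arguments are
    affine in y with nonzero slopes s and s'. *)
Lemma bl_product_ae_eq (f1 g1 f2 g2 : R -> R) x :
  measurable_fun [set: R] f1 -> measurable_fun [set: R] g1 ->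
  measurable_fun [set: R] f2 -> measurable_fun [set: R] g2 ->
  {ae mu, forall t, f1 t = f2 t} -> {ae mu, forall t, g1 t = g2 t} ->
  product f1 g1 x = product f2 g2 x.
Proof.
move=> mf1 mg1 mf2 mg2 f12 g12; have [_ [s0 s'0 _] _ _ _] := blP.
apply: ae_eq_integral; first by [].
- exact: measurable_bl_factors_at.
- exact: measurable_bl_factors_at.
have {}f12 := ae_affine (c2 * D * s' * x) (lt0r_neq0 s0) f12.
have {}g12 := ae_affine (- (c1 * D * s) * x) (lt0r_neq0 s'0) g12.
have /ae_gammaP h : {ae mu, forall y, f1 (bl_left c2 s s' D x y) = f2 (bl_left c2 s s' D x y) /\
    g1 (bl_right c1 s s' D x y) = g2 (bl_right c1 s s' D x y)}.
  apply: filterS2 f12 g12 => y; rewrite (addrC (s * y)) (addrC (s' * y)).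
  by split.
by apply: filterS h => y [-> ->].
Qed.

Lemma bl_product0 (f g : R -> R) x : measurable_fun [set: R] f -> measurable_fun [set: R] g ->
  {ae mu, forall t, f t = 0} \/ {ae mu, forall t, g t = 0} -> product f g x = 0%E.
Proof.
have m0 : measurable_fun [set: R] (cst 0 : R -> R) by exact: measurable_cst.
move=> mf mg [f0|g0].
  transitivity (product (cst 0) g x).
    by apply: bl_product_ae_eq => //; exact: aeW.
  by apply: integral0_eq => y _; rewrite mul0r.
transitivity (product f (cst 0) x).
  by apply: bl_product_ae_eq => //; exact: aeW.
by apply: integral0_eq => y _; rewrite mulr0.
Qed.

Lemma abse_bl_product (f g : R -> R) x :
  measurable_fun [set: R] f -> measurable_fun [set: R] g ->
  {ae mu, forall t, 0 <= f t} \/ {ae mu, forall t, f t <= 0} ->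
  {ae mu, forall t, 0 <= g t} \/ {ae mu, forall t, g t <= 0} ->
  (`|product f g x| = product (Num.norm \o f) (Num.norm \o g) x)%E.
Proof.
move=> mf mg sf sg.
set f' := Num.norm \o f; set g' := Num.norm \o g.
have mf' : measurable_fun [set: R] f' by exact: measurableT_comp.
have mg' : measurable_fun [set: R] g' by exact: measurableT_comp.
have mNf' : measurable_fun [set: R] (\- f') by exact: measurableT_comp.
have mNg' : measurable_fun [set: R] (\- g') by exact: measurableT_comp.
have f'0 t : 0 <= f' t by exact: normr_ge0.
have g'0 t : 0 <= g' t by exact: normr_ge0.
have p0 : (0 <= product f' g' x)%E by exact: bl_product_ge0.
have E (h : R -> R) : {ae mu, forall t, 0 <= h t} \/ {ae mu, forall t, h t <= 0} ->
    {ae mu, forall t, h t = (Num.norm \o h) t} \/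
    {ae mu, forall t, h t = (\- (Num.norm \o h)) t}.
  case=> [h0|h0]; [left|right]; apply: filterS h0 => t ht.
  - by rewrite /= ger0_norm.
  - by rewrite /= ler0_norm// opprK.
have Nl : product (\- f') g' x = (- product f' g' x)%E.
  rewrite /product /bl_product -integral_ge0N; last first.
    by move=> y _; rewrite lee_fin mulr_ge0.
  by apply: eq_integral => y _; rewrite mulNr EFinN.
have Nr : product f' (\- g') x = (- product f' g' x)%E.
  rewrite /product /bl_product -integral_ge0N; last first.
    by move=> y _; rewrite lee_fin mulr_ge0.
  by apply: eq_integral => y _; rewrite mulrN EFinN.
have Nlr : product (\- f') (\- g') x = product f' g' x.
  by apply: eq_integral => y _; rewrite mulrNN.
case: (E f sf) => {}sf; case: (E g sg) => {}sg.
- by rewrite (bl_product_ae_eq x mf mg mf' mg' sf sg) gee0_abs.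
- by rewrite (bl_product_ae_eq x mf mg mf' mNg' sf sg) Nr abseN gee0_abs.
- by rewrite (bl_product_ae_eq x mf mg mNf' mg' sf sg) Nl abseN gee0_abs.
- by rewrite (bl_product_ae_eq x mf mg mNf' mNg' sf sg) Nlr gee0_abs.
Qed.

End bl_product_ae.

(** * Angles and exponents *)

Section trigonometry.
Context {R : realType}.

(** In the decomposition of the identity, u3 does not contribute to the lower diagonal entry [sum1]
    or the off-diagonal entry [orth]. These two relations give the formulas for the cosines; once
    [r] is eliminated, the other relations are rational identities in [p] and [q]. *)
Lemma bl_parameters_angles (p q r c s c' s' : R) : 1 < p -> 1 < r -> p < q ->
  p^-1 + r^-1 = 1 + q^-1 -> 0 < c -> 0 < s -> c' < 0 -> 0 < s' ->
  c ^+ 2 = (p - 1) / (q - 1) -> s ^+ 2 = 1 - c ^+ 2 ->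
  c' ^+ 2 = (r - 1) / (q - 1) -> s' ^+ 2 = 1 - c' ^+ 2 ->
  let D := c * s' - c' * s in
  [/\ bl_parameters p^-1 r^-1 (1 - q^-1) s s' D, c = r^-1 * D * s' & c' = - (p^-1 * D * s)].
Proof.
move=> p1 r1 pq pqr c0 s0 c'0 s'0 cE sE c'E s'E D.
have [p0 q0 r0] : [/\ 0 < p, 0 < q & 0 < r] by split; lra.
have q1 : 0 < q - 1 by lra.
have e0 : 0 < p * q + p - q by have := mulr_gt0 p0 q0; nra.
have rE : r = p * q / (p * q + p - q).
  rewrite -[LHS]invrK; have -> : r^-1 = 1 + q^-1 - p^-1 by rewrite -pqr addrAC subrr add0r.
  by field; rewrite !gt_eqF//; lra.
have D0 : 0 < D by rewrite subr_gt0 (lt_trans (y := 0))// ?nmulr_rlt0// mulr_gt0.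
have orth : p^-1 * c * s = - (r^-1 * c' * s').
  have l0 : 0 <= p^-1 * c * s by rewrite !mulr_ge0 ?invr_ge0 ?ltW.
  have r0' : 0 <= - (r^-1 * c' * s').
    by rewrite oppr_ge0 nmulr_rle0 ?ltW// pmulr_rlt0 ?invr_gt0.
  (* Both sides are nonnegative, the right one because [c'] is negative, so their squares may be
     compared; these are rational in [p] and [q]. *)
  apply/eqP; rewrite -(eqrXn2 (n := 2))// sqrrN !exprMn cE sE c'E s'E cE c'E rE.
  by apply/eqP; field; rewrite !gt_eqF//; lra.
have sum1 : p^-1 * s ^+ 2 + r^-1 * s' ^+ 2 = 1.
  by rewrite sE s'E cE c'E rE; field; rewrite !gt_eqF//; lra.
have cD : c = r^-1 * D * s'.
  transitivity (c * (p^-1 * s ^+ 2 + r^-1 * s' ^+ 2)); first by rewrite sum1 mulr1.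
  transitivity ((p^-1 * c * s) * s + r^-1 * c * s' ^+ 2); first by ring.
  by rewrite orth /D; ring.
have c'D : c' = - (p^-1 * D * s).
  transitivity (c' * (p^-1 * s ^+ 2 + r^-1 * s' ^+ 2)); first by rewrite sum1 mulr1.
  transitivity (c' * p^-1 * s ^+ 2 - (- (r^-1 * c' * s')) * s'); first by ring.
  by rewrite -orth /D; ring.
split=> //; split; [|by []| |by []|split].
- by split; rewrite ?invr_gt0// subr_gt0 invf_lt1// (lt_trans p1).
- split; rewrite ?invf_le1 ?(ltW p1) ?(ltW r1)// gerBl invr_ge0 ltW//.
- have d2 : D ^+ 2 = c ^+ 2 / (r^-1 ^+ 2 * s' ^+ 2).
    by rewrite {1}cD; field; rewrite !gt_eqF.
  have s'E2 : s' ^+ 2 = q ^+ 2 * (p - 1) / ((p * q + p - q) * (q - 1)).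
    by rewrite s'E c'E rE; field; rewrite !gt_eqF//; lra.
  by rewrite d2 s'E2 cE rE; field; rewrite !gt_eqF//; lra.
- by rewrite s'E c'E rE; field; rewrite !gt_eqF//; lra.
- by rewrite sE cE rE; field; rewrite !gt_eqF//; lra.
Qed.

End trigonometry.

(** * Extremizers *)

Section integral_equality.
Context d (T : measurableType d) (R : realType).
Variables (nu : {measure set T -> \bar R}) (f g : T -> \bar R).
Hypotheses (mf : measurable_fun [set: T] f) (mg : measurable_fun [set: T] g).
Hypotheses (f0 : forall x, (0 <= f x)%E) (fg : forall x, (f x <= g x)%E).

Lemma ge0_le_integral_eq_ae : (\int[nu]_x g x < +oo)%E ->
  (\int[nu]_x f x = \int[nu]_x g x)%E ->
  {ae nu, forall x, f x = g x /\ g x \is a fin_num}.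
Proof.
move=> goo fgE; have g0 x : (0 <= g x)%E by exact: le_trans (f0 x) (fg x).
have fin := ge0_integral_lty_ae mg g0 goo.
have int h : measurable_fun [set: T] h -> (forall x, 0 <= h x)%E ->
    (\int[nu]_x h x < +oo)%E -> nu.-integrable [set: T] h.
  move=> mh h0 hoo; apply/integrableP; split => //.
  by under eq_integral do rewrite gee0_abs//.
have foo : (\int[nu]_x f x < +oo)%E by rewrite fgE.
pose e x : \bar R := `|fine (g x) - fine (f x)|%:E.
have me : measurable_fun [set: T] e.
  apply/measurable_EFinP; apply: measurableT_comp => //.
  by apply: measurable_funB; exact: (measurableT_comp (fine_measurable _)).
have e0 x : (0 <= e x)%E by rewrite lee_fin.
have fin_f x : g x \is a fin_num -> f x \is a fin_num.
  by rewrite !ge0_fin_numE//; exact: le_lt_trans.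
have /(ge0_integral_eq0_ae me e0) : (\int[nu]_x e x = 0)%E.
  transitivity (\int[nu]_x (g \- f) x)%E.
    apply: ae_eq_integral => //; first exact: emeasurable_funB.
    apply: filterS fin => x gx _; have fx := fin_f _ gx; rewrite /e /=.
    have := fg x; rewrite -(fineK gx) -(fineK fx) lee_fin => h.
    by rewrite ger0_norm ?subr_ge0.
  rewrite integralB//; [|exact: int|exact: int].
  by rewrite fgE subee// ge0_fin_numE// integral_ge0.
apply: filterS2 fin => x gx /eqP; have fx := fin_f _ gx.
rewrite eqe normr_eq0 subr_eq0 => /eqP h; split => //.
by rewrite -(fineK gx) h fineK.
Qed.

End integral_equality.

Section bl_product_extremal.
Context {R : realType}.
Notation mu := (@lebesgue_measure R).
Variables c1 c2 c3 s s' D : R.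
Hypothesis blP : bl_parameters c1 c2 c3 s s' D.
Variables f g : R -> R.
Hypotheses (mf : measurable_fun [set: R] f) (mg : measurable_fun [set: R] g).

Let f' : R -> R := Num.norm \o f.
Let g' : R -> R := Num.norm \o g.
Let mf' : measurable_fun [set: R] f'. Proof. exact: measurableT_comp. Qed.
Let mg' : measurable_fun [set: R] g'. Proof. exact: measurableT_comp. Qed.
Let f'0 x : 0 <= f' x. Proof. exact: normr_ge0. Qed.
Let g'0 x : 0 <= g' x. Proof. exact: normr_ge0. Qed.

Let U := bl_product c1 c2 s s' D f g.
Let V := bl_product c1 c2 s s' D f' g'.
Let q := (1 - c3)^-1.

Let q0 : 0 < q.
Proof.
have [[c10 c20 _] [_ _ D0] _ _ [E3 _ _]] := blP.
by rewrite /q invr_gt0 -E3 !mulr_gt0// exprn_gt0.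
Qed.

Let V0 x : (0 <= V x)%E. Proof. exact: bl_product_ge0. Qed.

Let UV x : (`|U x| `^ q <= V x `^ q)%E.
Proof.
apply: gt0_ler_poweR; [exact: ltW| | |exact: bl_product_le_norm].
- by rewrite in_itv/= abse_ge0 leey.
- by rewrite in_itv/= V0 leey.
Qed.

Let mU : measurable_fun [set: R] (fun x => (`|U x| `^ q)%E).
Proof.
apply: (measurableT_comp (measurable_poweR _)); apply: measurableT_comp => //.
exact: measurable_bl_product_signed.
Qed.

Let mV : measurable_fun [set: R] (fun x => (V x `^ q)%E).
Proof.
by apply: (measurableT_comp (measurable_poweR _)); exact: measurable_bl_product.
Qed.

Variables A B : R.
Hypotheses (A0 : 0 < A) (B0 : 0 < B).
Hypothesis fA : (\int[gamma R]_x (f' x `^ c1^-1)%:E = A%:E)%E.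
Hypothesis gB : (\int[gamma R]_x (g' x `^ c2^-1)%:E = B%:E)%E.

Let M := A `^ c1 * B `^ c2.

Let IUV : (\int[gamma R]_x (`|U x| `^ q) <= \int[gamma R]_x (V x `^ q))%E.
Proof.
apply: ge0_le_integral; first by [].
- by move=> x _; exact: poweR_ge0.
- exact: mU.
- exact: mV.
- by move=> x _; exact: UV.
Qed.

Lemma bl_product_signed_power_le :
  (\int[gamma R]_x (`|U x| `^ q) <= (M `^ q)%:E)%E.
Proof.
apply: le_trans IUV _.
exact (bl_product_power_le blP mf' mg' f'0 g'0 A0 B0 fA gB).
Qed.

(** Since |U| <= V and the moment of [V] is at most M^q, equality for [U] forces equality for [V]
    and |U| = V almost everywhere. The first makes both weights Gaussian, hence [f] and [g] nonzero
    almost everywhere, which is what the sign argument requires of them. *)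
Lemma bl_product_extremal :
  (\int[gamma R]_x (`|U x| `^ q) = (M `^ q)%:E)%E <->
  [/\ {ae mu, forall x, 0 <= f x} \/ {ae mu, forall x, f x <= 0},
      {ae mu, forall x, 0 <= g x} \/ {ae mu, forall x, g x <= 0} &
      exists k e1 e2, [/\ 0 < k,
        {ae mu, forall x, bl_weight c1 A f' x = gaussian k e1 x} &
        {ae mu, forall x, bl_weight c2 B g' x = gaussian k e2 x}]].
Proof.
have VM := bl_product_power_le blP mf' mg' f'0 g'0 A0 B0 fA gB.
split=> [UM|[sf sg [k [e1 [e2 [k0 FE GE]]]]]]; last first.
  rewrite -(bl_product_gaussian blP mf' mg' f'0 g'0 A0 B0 fA gB k0 FE GE).
  apply: eq_integral => x _; congr (_ `^ _)%E.
  exact: (abse_bl_product blP).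
have VE : (\int[gamma R]_x (V x `^ q) = (M `^ q)%:E)%E.
  by apply/eqP; rewrite eq_le; apply/andP; split; [exact: VM|rewrite -UM; exact: IUV].
have [k [e1 [e2 [k0 FE GE]]]] :=
  bl_product_equality_gaussian blP mf' mg' f'0 g'0 A0 B0 fA gB VE.
have [[c10 c20 _] _ _ _ _] := blP.
have neq0 (h : R -> R) c C e : 0 < c ->
    {ae mu, forall x, bl_weight c C (Num.norm \o h) x = gaussian k e x} ->
    {ae mu, forall x, h x <> 0}.
  move=> c0; apply: filterS => x /eqP + hx.
  have -> : bl_weight c C (Num.norm \o h) x = 0.
    by rewrite /bl_weight /= hx normr0 powR0 ?mul0r// invr_eq0 gt_eqF.
  by rewrite lt_eqF// mulr_gt0// rho_gt0.
have UVq : {ae gamma R, forall x, (`|U x| `^ q)%E = (V x `^ q)%E /\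
    (V x `^ q)%E \is a fin_num}.
  apply: (@ge0_le_integral_eq_ae _ (measurableTypeR R) _ (gamma R) _ _ mU mV _ UV).
  - by move=> x; exact: poweR_ge0.
  - by rewrite [ltLHS]VE ltry.
  - by transitivity (M `^ q)%:E; [exact: UM|exact: esym VE].
have UV' : {ae gamma R, forall x, (`|U x| = V x)%E /\ V x \is a fin_num}.
  apply: filterS UVq => x [E fin]; split.
    have := congr1 (fun t => t `^ q^-1)%E E.
    by rewrite -!poweRrM mulfV ?gt_eqF// !poweRe1// abse_ge0.
  move: fin; rewrite !ge0_fin_numE ?poweR_ge0//; apply: lty_poweRy.
  by rewrite gt_eqF.
have sgn (h : R -> R) : {ae mu, forall x, 0 < h x} \/ {ae mu, forall x, ~ 0 < h x} ->
    {ae mu, forall x, 0 <= h x} \/ {ae mu, forall x, h x <= 0}.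
  by case=> hh; [left|right]; apply: filterS hh => x; [exact: ltW|move/negP; rewrite -leNgt].
have [cf cg] := bl_product_ae_constant_sign blP mf mg UV' (neq0 _ _ _ _ c10 FE)
  (neq0 _ _ _ _ c20 GE).
by split; [exact: sgn|exact: sgn|exists k, e1, e2].
Qed.

End bl_product_extremal.

Section gaussian_power.
Context {R : realType}.
Notation mu := (@lebesgue_measure R).

Lemma ge0_integral_gamma_in (f : R -> R) (E : set (measurableTypeR R)) :
  measurable_fun [set: R] f -> (forall x, 0 <= f x) -> measurable E ->
  (\int[gamma R]_(x in E) (f x)%:E = \int[mu]_(x in E) (f x * rho x)%:E)%E.
Proof.
move=> mf f0 mE; rewrite integral_mkcond [RHS]integral_mkcond.
rewrite (@ge0_integral_gamma R ((fun x => (f x)%:E) \_ E)).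
- apply: eq_integral => x _; rewrite /patch; case: ifP => _; first by rewrite EFinM.
  by rewrite mul0e.
- apply/(measurable_restrictT _ mE).
  by apply: measurable_funTS; exact/measurable_EFinP.
- by move=> x; rewrite /patch; case: ifP => // _; rewrite lee_fin.
Qed.

(** Integrals over all Borel sets determine the density up to a null set; the finite mass [A]
    supplies the integrability. *)
Lemma power_gaussianP (p : R) (f : R -> R) (K lambda a A : R) :
  measurable_fun [set: R] f ->
  (\int[gamma R]_x (`|f x| `^ p)%:E = A%:E)%E ->
  power_has_gaussian_density p f K lambda a <->
  {ae mu, forall x, `|f x| `^ p * rho x = K * expR (- lambda * `|x - a| ^+ 2)}.
Proof.
move=> mf fA.
have mp : measurable_fun [set: R] (fun x => `|f x| `^ p).
  have mpp : measurable_fun [set: R] (@powR R ^~ p) by exact: measurable_powR.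
  by apply: (measurableT_comp mpp); exact: measurableT_comp.
have p0 x : 0 <= `|f x| `^ p by exact: powR_ge0.
have mpr : measurable_fun [set: R] (fun x => (`|f x| `^ p * rho x)%:E).
  by apply/measurable_EFinP; apply: measurable_funM => //; exact: measurable_normal_pdf.
have mK : measurable_fun [set: R] (fun x => (K * expR (- lambda * `|x - a| ^+ 2))%:E).
  apply/measurable_EFinP; apply: measurable_funM => //.
  apply: (measurableT_comp (@measurable_expR R)); apply: measurable_funM => //.
  apply: measurable_funX; apply: measurableT_comp => //.
  exact: measurable_funB.
split=> [h|h E mE].
  have [N [mN N0 NP]] : ae_eq mu [set: R] (fun x => (`|f x| `^ p * rho x)%:E)
      (fun x => (K * expR (- lambda * `|x - a| ^+ 2))%:E).
    apply: integral_ae_eq; first by [].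
    - apply/integrableP; split => //.
      under eq_integral do rewrite abse_EFin ger0_norm ?mulr_ge0 ?normal_pdf_ge0//.
      by rewrite -ge0_integral_gamma_in// fA ltry.
    - exact: mK.
    - by move=> E _ mE; rewrite -ge0_integral_gamma_in// h.
  exists N; split => //; apply: subset_trans NP => x /= nE E; apply: nE.
  by have [] := E I.
rewrite ge0_integral_gamma_in//; apply: ae_eq_integral => //.
- exact: measurable_funTS.
- exact: measurable_funTS.
- by apply: filterS h => x -> _.
Qed.

End gaussian_power.

Section gaussian_power_weight.
Context {R : realType}.
Notation mu := (@lebesgue_measure R).

Lemma gaussianE (k e x : R) :
  gaussian k e x = k * normal_peak 1 * expR (- (k ^+ 2 / 2) * `|x - e| ^+ 2).
Proof.
rewrite /gaussian rhoE expRD lnK ?posrE ?normal_peak_gt0 ?oner_eq0//.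
rewrite real_normK ?num_real// -mulrA; congr (_ * (_ * expR _)).
by field.
Qed.

Lemma power_gaussian_of_weight (p A k e : R) (f : R -> R) : 0 < A -> 0 < k ->
  measurable_fun [set: R] f -> (\int[gamma R]_x (`|f x| `^ p)%:E = A%:E)%E ->
  {ae mu, forall x, bl_weight p^-1 A (Num.norm \o f) x = gaussian k e x} ->
  power_has_gaussian_density p f (A * (k * normal_peak 1)) (k ^+ 2 / 2) e.
Proof.
move=> A0 k0 mf fA h; apply/(power_gaussianP _ _ _ mf fA).
apply: filterS h => x; rewrite gaussianE /bl_weight invrK /= => E.
by rewrite -[RHS]mulrA -E [RHS]mulrC divfK// gt_eqF.
Qed.

(** A finite positive mass excludes [K] = 0 and, Lebesgue measure being infinite, [lambda] = 0. The
    mass then ties [K] to [lambda], and the scale k of the Gaussian satisfies k^2 / 2 = lambda. *)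
Lemma weight_of_power_gaussian (p A K lambda a : R) (f : R -> R) : 0 < A -> 0 <= K ->
  0 <= lambda -> measurable_fun [set: R] f ->
  (\int[gamma R]_x (`|f x| `^ p)%:E = A%:E)%E ->
  power_has_gaussian_density p f K lambda a ->
  0 < lambda /\ {ae mu, forall x,
    bl_weight p^-1 A (Num.norm \o f) x = gaussian (Num.sqrt (2 * lambda)) a x}.
Proof.
move=> A0 K0 l0 mf fA h; have := h _ (measurableT); rewrite fA => AE.
have K_gt0 : 0 < K.
  rewrite lt_neqAle K0 andbT; apply/eqP => K00; move: AE; rewrite -K00.
  under eq_integral do rewrite mul0r; rewrite integral0 => -[] A00.
  by rewrite A00 ltxx in A0.
have l_gt0 : 0 < lambda.
  rewrite lt_neqAle l0 andbT; apply/eqP => l00; move: AE; rewrite -l00.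
  under eq_integral do rewrite oppr0 mul0r expR0 mulr1.
  rewrite integral_cst// [X in (_ * X)%E](_ : _ = +oo%E); last first.
    by have := @lebesgue_measure_itv R `]-oo, +oo[; rewrite set_itvNyy.
  by rewrite mulry gtr0_sg// mul1e.
split => //; set k := Num.sqrt _.
have k0 : 0 < k by rewrite sqrtr_gt0 mulr_gt0.
have kE : k ^+ 2 / 2 = lambda.
  by rewrite sqr_sqrtr ?mulr_ge0// mulrAC divff ?mul1r// pnatr_eq0.
have pk0 : 0 < normal_peak 1 :> R by rewrite normal_peak_gt0// oner_eq0.
pose u := K / (k * normal_peak 1).
have u0 : 0 < u by rewrite divr_gt0// mulr_gt0.
have KE x : K * expR (- lambda * `|x - a| ^+ 2) = u * gaussian k a x.
  by rewrite gaussianE kE /u; field; rewrite !gt_eqF.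
have Au : A = u.
  move: AE; under eq_integral => x _ do rewrite KE EFinM.
  rewrite ge0_integralZl_EFin; [|by []| | |exact: ltW].
  - by rewrite integral_gaussian// mule1 => -[].
  - by move=> x _; rewrite lee_fin gaussian_ge0.
  - by apply/measurable_EFinP; exact: measurable_gaussian.
apply: filterS ((power_gaussianP _ _ _ mf fA).1 h) => x E.
by rewrite /bl_weight invrK /= E KE Au mulrC mulKf// gt_eqF.
Qed.

Lemma Lfun_power (p : R) (f : R -> R) : 0 < p -> f \in Lfun (gamma R) p%:E ->
  measurable_fun [set: R] f /\ exists A, [/\ 0 <= A,
    (\int[gamma R]_x (`|f x| `^ p)%:E = A%:E)%E &
    ('N[gamma R]_p%:E[EFin \o f] = (A `^ p^-1)%:E)%E].
Proof.
move=> p0 /andP[mf nf].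
have {}mf : measurable_fun [set: R] f by move: mf; rewrite inE.
have {}nf : ('N[gamma R]_p%:E[EFin \o f] < +oo)%E by move: nf; rewrite inE.
split => //; have := nf; rewrite unlock /=.
set I := (\int[_]_ _ _)%E => Ioo.
have I0 : (0 <= I)%E by apply: integral_ge0 => x _; rewrite lee_fin powR_ge0.
have fin : I \is a fin_num.
  by rewrite ge0_fin_numE//; apply: lty_poweRy Ioo; rewrite invr_eq0 gt_eqF.
exists (fine I); split; [exact: fine_ge0|by rewrite fineK|].
by rewrite -poweR_EFin fineK.
Qed.

Lemma power_eq0_ae (p : R) (f : R -> R) : 0 < p -> measurable_fun [set: R] f ->
  (\int[gamma R]_x (`|f x| `^ p)%:E = 0)%E <-> {ae gamma R, forall x, f x = 0}.
Proof.
move=> p0 mf.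
have mp : measurable_fun [set: R] (fun x => (`|f x| `^ p)%:E).
  have mpp : measurable_fun [set: R] (@powR R ^~ p) by exact: measurable_powR.
  by apply/measurable_EFinP; apply: (measurableT_comp mpp); exact: measurableT_comp.
have pp x : (0 <= (`|f x| `^ p)%:E)%E by rewrite lee_fin powR_ge0.
split=> [|h].
  move=> /(@ge0_integral_eq0_ae _ (measurableTypeR R) _ (gamma R) _ mp pp).
  by apply: filterS => x [/powR_eq0_eq0/normr0_eq0].
rewrite -[RHS](@integral0 _ _ _ (gamma R) [set: R]); apply: ae_eq_integral => //.
by apply: filterS h => x -> _; rewrite normr0 powR0// gt_eqF.
Qed.

End gaussian_power_weight.

Theorem proposition9 (R : realType) (p q r theta xi : R) (f g : R -> R)
  (hp : 1 < p) (hr : 1 < r) (hpq : p < q)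
  (hpqr : p^-1 + r^-1 = 1 + q^-1)
  (htheta0 : 0 <= theta) (htheta1 : theta < pi / 2)
  (hxi0 : pi / 2 < xi) (hxi1 : xi < pi)
  (hcostheta : cos theta = Num.sqrt ((p - 1) / (q - 1)))
  (hcosxi : cos xi = - Num.sqrt ((r - 1) / (q - 1)))
  (hf : f \in Lfun (gamma R) p%:E) (hg : g \in Lfun (gamma R) r%:E) :
  ('N[gamma R]_q%:E[rotated_product theta xi f g]
     <= 'N[gamma R]_p%:E[EFin \o f] * 'N[gamma R]_r%:E[EFin \o g])%E
  /\
  (('N[gamma R]_q%:E[rotated_product theta xi f g]
      = 'N[gamma R]_p%:E[EFin \o f] * 'N[gamma R]_r%:E[EFin \o g])%E
   <->
   [\/ {ae gamma R, forall x, f x = 0},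
       {ae gamma R, forall x, g x = 0} |
       [/\ constant_sign f, constant_sign g &
           exists K1 K2 lambda a1 a2 : R,
             [/\ 0 <= K1, 0 <= K2, 0 <= lambda,
                 power_has_gaussian_density p f K1 lambda a1 &
                 power_has_gaussian_density r g K2 lambda a2]]]).
Proof.
have p0 : 0 < p by exact: lt_trans ltr01 hp.
have r0 : 0 < r by exact: lt_trans ltr01 hr.
have q1 : 1 < q by exact: lt_trans hp hpq.
have q0 : 0 < q by exact: lt_trans ltr01 q1.
have q10 : 0 < q - 1 by rewrite subr_gt0.
have cE : cos theta ^+ 2 = (p - 1) / (q - 1).
  by rewrite hcostheta sqr_sqrtr// divr_ge0// ?subr_ge0 ltW.
have c'E : cos xi ^+ 2 = (r - 1) / (q - 1).
  by rewrite hcosxi sqrrN sqr_sqrtr// divr_ge0// ?subr_ge0 ltW.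
have ct0 : 0 < cos theta by rewrite hcostheta sqrtr_gt0 divr_gt0// subr_gt0.
have cx0 : cos xi < 0 by rewrite hcosxi oppr_lt0 sqrtr_gt0 divr_gt0// subr_gt0.
have pi2 : 0 < pi / 2 :> R by rewrite divr_gt0// pi_gt0.
have sx0 : 0 < sin xi by rewrite sin_gt0_pi// (lt_trans pi2 hxi0).
have st0 : 0 < sin theta.
  rewrite lt_neqAle sin_ge0_pi ?andbT; last first.
    rewrite htheta0/=; apply: ltW (lt_trans htheta1 _).
    by rewrite ltr_pdivrMr// ltr_pMr ?pi_gt0// ltr1n.
  (* A vanishing sine would give (p - 1) / (q - 1) = 1, against p < q. *)
  apply/eqP => st; have := cos2Dsin2 theta; rewrite -st expr0n addr0 cE.
  by apply/eqP; rewrite lt_eqF// ltr_pdivrMr// mul1r ltrD2r.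
have s2 t : sin t ^+ 2 = 1 - cos t ^+ 2 :> R by rewrite -(cos2Dsin2 t) addrAC subrr add0r.
have [blP cD c'D] := bl_parameters_angles hp hr hpq hpqr ct0 st0 cx0 sx0 cE (s2 _) c'E (s2 _).
set D := cos theta * _ - _ in blP cD c'D.
have UE : rotated_product theta xi f g =
    bl_product p^-1 r^-1 (sin theta) (sin xi) D f g.
  by apply/funext => x; rewrite /rotated_product cD c'D.
have qE : (1 - (1 - q^-1))^-1 = q by rewrite subKr invrK.
have [mf [A [A0 fA ->]]] := Lfun_power p0 hf.
have [mg [B [B0 gB ->]]] := Lfun_power r0 hg.
rewrite UE -EFinM.
set U := bl_product _ _ _ _ _ _ _; set M := _ * _.
have IE : ('N[gamma R]_q%:E[U] = (\int[gamma R]_x (`|U x| `^ q)) `^ q^-1)%E by rewrite unlock.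
have M0 : 0 <= M by rewrite mulr_ge0// powR_ge0.
have I0 : (0 <= \int[gamma R]_x (`|U x| `^ q))%E by apply: integral_ge0 => x _; exact: poweR_ge0.
(* If one function vanishes almost everywhere there is no normalized density to work with; both
   sides of the inequality are then 0. *)
have zero : {ae gamma R, forall x, f x = 0} \/ {ae gamma R, forall x, g x = 0} ->
    ('N[gamma R]_q%:E[U] = M%:E)%E.
  move=> h; have U0 x : U x = 0%E.
    by apply: (bl_product0 blP _ mf mg); case: h => /ae_gammaP; [left|right].
  rewrite (_ : U = cst 0%E); last exact/funext.
  rewrite Lnorm0 ?eqe ?gt_eqF//; congr _%:E; apply/esym/eqP; rewrite mulf_eq0 !powR_eq0.
  case: h => [/(power_eq0_ae p0 mf)|/(power_eq0_ae r0 mg)].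
  - by rewrite fA => -[->]; rewrite eqxx invr_eq0 gt_eqF.
  - by rewrite gB => -[->]; rewrite eqxx !invr_eq0 (gt_eqF r0) orbT.
have [/eqP A00|A_neq0] := boolP (A == 0).
  have f0 : {ae gamma R, forall x, f x = 0} by apply/(power_eq0_ae p0 mf); rewrite fA A00.
  by have NM := zero (or_introl f0); split; [rewrite NM|split => // _; constructor 1].
have [/eqP B00|B_neq0] := boolP (B == 0).
  have g0 : {ae gamma R, forall x, g x = 0} by apply/(power_eq0_ae r0 mg); rewrite gB B00.
  by have NM := zero (or_intror g0); split; [rewrite NM|split => // _; constructor 2].
have A_gt0 : 0 < A by rewrite lt_neqAle eq_sym A_neq0.
have B_gt0 : 0 < B by rewrite lt_neqAle eq_sym B_neq0.
have fA' : (\int[gamma R]_x ((Num.norm \o f) x `^ p^-1^-1)%:E = A%:E)%E by rewrite invrK.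
have gB' : (\int[gamma R]_x ((Num.norm \o g) x `^ r^-1^-1)%:E = B%:E)%E by rewrite invrK.
have ext := bl_product_extremal blP mf mg A_gt0 B_gt0 fA' gB'.
have UM := bl_product_signed_power_le blP mf mg A_gt0 B_gt0 fA' gB'.
rewrite -/U qE -/M in ext UM.
have MqK : (M `^ q) `^ q^-1 = M by rewrite -powRrM mulfV ?gt_eqF// powRr1.
have NE : ('N[gamma R]_q%:E[U] = M%:E)%E <-> (\int[gamma R]_x (`|U x| `^ q) = (M `^ q)%:E)%E.
  rewrite IE; split => [E|->]; last by rewrite poweR_EFin MqK.
  by rewrite -poweR_EFin -E -poweRrM mulVf ?gt_eqF// poweRe1.
split.
  rewrite IE -[in leRHS]MqK -[leRHS]poweR_EFin.
  apply: gt0_ler_poweR => //; first by rewrite invr_ge0 ltW.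
  - by rewrite in_itv/= I0 leey.
  - by rewrite in_itv/= lee_fin powR_ge0 leey.
have ae_sign (h : R -> R) : constant_sign h <->
    {ae lebesgue_measure, forall x, 0 <= h x} \/ {ae lebesgue_measure, forall x, h x <= 0}.
  by split => -[/ae_gammaP ?|/ae_gammaP ?]; [left|right|left|right].
have pk0 : 0 < normal_peak 1 :> R by rewrite normal_peak_gt0// oner_eq0.
split.
  move=> /NE/ext[sf sg [k [e1 [e2 [k0 FE GE]]]]]; constructor 3.
  split; [exact/ae_sign|exact/ae_sign|].
  exists (A * (k * normal_peak 1)), (B * (k * normal_peak 1)), (k ^+ 2 / 2), e1, e2.
  have kp0 : 0 <= k * normal_peak 1 by rewrite mulr_ge0// ltW.
  split; [exact: mulr_ge0|exact: mulr_ge0|by rewrite divr_ge0// sqr_ge0| |].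
  - exact (power_gaussian_of_weight A_gt0 k0 mf fA FE).
  - exact (power_gaussian_of_weight B_gt0 k0 mg gB GE).
case=> [h|h|[/ae_sign sf /ae_sign sg [K1 [K2 [l [a1 [a2 [K10 K20 l0 fK gK]]]]]]]].
- by apply: zero; left.
- by apply: zero; right.
have [l_gt0 FE] := weight_of_power_gaussian A_gt0 K10 l0 mf fA fK.
have [_ GE] := weight_of_power_gaussian B_gt0 K20 l0 mg gB gK.
apply/NE/ext; split => //; exists (Num.sqrt (2 * l)), a1, a2; split => //.
by rewrite sqrtr_gt0 mulr_gt0.
Qed.
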